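(* Let $\mathcal{G}$ be an étale groupoid with compact unit space $\mathcal{G}^{(0)}$, and let $\ell\colon \mathcal{G}\to[0,\infty)$ be a proper continuous length function. Suppose moreover that $d$ is a metric on $\mathcal{G}^{(0)}$ inducing its topology, and fix a metric stratification $\mathcal{K}$ of $\mathcal{G}$ with respect to $d$. Let $n\ge 1$ and let $E_{\mathcal{K},n}=\{f\in \mathrm{Lip}_c^{\mathcal{K}}(\mathcal{G}) \mid L^{\mathcal{K},n}(f)\le 1\}$. Consider the statements: (1) For every $\varepsilon>0$ there is $\phi\in C_c(\mathcal{G})$ such that $m_\phi$ is unital and $\mathcal{K}$-continuous, and such that $$\sup_{f\in E_{\mathcal{K},n}}\Vert f-m_\phi(f)\Vert_{C_r^*(\mathcal{G})}<\varepsilon .$$ (2) $(\mathrm{Lip}_c^{\mathcal{K}}(\mathcal{G}),L^{\mathcal{K},n})$ is a compact quantum metric space. Then (1) implies (2). Moreover, the converse implication (2) $\Rightarrow$ (1) holds if $\mathcal{G}$ admits a sequence of functions $(\phi_j)_{j\in\mathbb{N}}\subseteq C_c(\mathcal{G})$ converging uniformly to $1$ on compact subsets of $\mathcal{G}$, such that for all $j$ the map $m_{\phi_j}$ is unital and $\mathcal{K}$-continuous with some coefficient $D_j\ge 0$, and satisfying $\sup_j\Vert m_{\phi_j}\Vert<\infty$.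
   Context: **Groupoids.** All groupoids are locally compact and Hausdorff. For a groupoid $\mathcal{G}$ with unit space $\mathcal{G}^{(0)}$, $r(\gamma)=\gamma\gamma^{-1}$ and $s(\gamma)=\gamma^{-1}\gamma$; $\mathcal{G}$ is étale if $r$ is a local homeomorphism; $\mathcal{G}_u=s^{-1}(u)$, $\mathcal{G}^u=r^{-1}(u)$. $C_c(\mathcal{G})$ is a $*$-algebra with $f*g(\gamma)=\sum_{\mu\in\mathcal{G}_{s(\gamma)}}f(\gamma\mu^{-1})g(\mu)$ and $f^*(\gamma)=\overline{f(\gamma^{-1})}$. $\mathcal{E}$ is the right Hilbert $C(\mathcal{G}^{(0)})$-module obtained by completing $C_c(\mathcal{G})$ for $\langle\xi,\eta\rangle(u)=\sum_{\mu\in\mathcal{G}_u}\overline{\xi(\mu)}\eta(\mu)$, with $(\xi\cdot h)(\gamma)=\xi(\gamma)h(s(\gamma))$. The left regular representation is $(\Lambda(f)\xi)(\gamma)=\sum_{\mu\in\mathcal{G}_{s(\gamma)}}f(\gamma\mu^{-1})\xi(\mu)$, and $C_r^*(\mathcal{G})$ is the closure of $\Lambda(C_c(\mathcal{G}))$ in the adjointable operators $\mathcal{L}_{C(\mathcal{G}^{(0)})}(\mathcal{E})$; we regard $C_c(\mathcal{G})\subseteq C_r^*(\mathcal{G})$, with unit $1_{\mathcal{G}^{(0)}}$. **Length functions.** A continuous length function is a continuous $\ell\colon\mathcal{G}\to[0,\infty)$ with $\ell(\gamma)=0$ iff $\gamma\in\mathcal{G}^{(0)}$, $\ell(\gamma^{-1})=\ell(\gamma)$,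 and $\ell(\gamma\mu)\le\ell(\gamma)+\ell(\mu)$ for composable $\gamma,\mu$. It is proper if $\ell^{-1}([0,t])$ is compact for all $t\ge0$. $B_\ell(t)=\{\gamma\mid\ell(\gamma)\le t\}$. Standing assumption: for every $t\ge0$ there is $F_t\ge1$ with $\sup_{u\in\mathcal{G}^{(0)}}|B_\ell(t)\cap\mathcal{G}_u|\le F_t$. **Commutator seminorm.** $D_\ell\colon C_c(\mathcal{G})\to\mathcal{E}$ is $(D_\ell\xi)(\gamma)=\ell(\gamma)\xi(\gamma)$. For $f\in C_c(\mathcal{G})$, $\delta^n(f)$ is the $n$-fold iterated commutator $[D_\ell,[D_\ell,\dots[D_\ell,\Lambda(f)]]]$, which extends to an adjointable operator on $\mathcal{E}$, and $L^n_\ell(f)=\Vert\delta^n(f)\Vert_{\mathcal{L}_{C(\mathcal{G}^{(0)})}(\mathcal{E})}$. **Metric stratification.** Given a metric $d$ inducing the topology of the compact space $\mathcal{G}^{(0)}$, a metric stratification of $\mathcal{G}$ with respect to $d$ is a collection $\mathcal{K}=\{K_i\}_{i\in I}$ of subsets of $\mathcal{G}$, $I$ countable, such that: (1) $\mathcal{G}=\bigcup_iK_i$; (2) $K_{i_1}\cap K_{i_2}=\emptyset$ for $i_1\ne i_2$; (3) each $K_i$ is precompact and open; (4) there is a distinguished element $K_e=\mathcal{G}^{(0)}$ in $\mathcal{K}$; (5) $K_i\in\mathcal{K}$ implies $K_i^{-1}\in\mathcal{K}$; (6) for each $i$, $d^{(i)}(\gamma,\mu)=\max\{d(s(\gamma),s(\mu)),d(r(\gamma),r(\mu))\}$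 makes $K_i$ a totally bounded metric space. (Some $K_i$ may be empty.) **Total seminorm.** $L^{K_i}_{\mathrm{Lip}}(f)=\sup\{|f(\gamma)-f(\mu)|/d^{(i)}(\gamma,\mu)\mid\gamma\neq\mu\in K_i\}$, $L^{\mathcal{K}}_{\mathrm{Lip}}(f)=\sup_{i\in I}L^{K_i}_{\mathrm{Lip}}(f)$, $\mathrm{Lip}_c^{\mathcal{K}}(\mathcal{G})=\{f\in C_c(\mathcal{G})\mid L^{\mathcal{K}}_{\mathrm{Lip}}(f)<\infty\}$, and $L^{\mathcal{K},n}(f)=\max\{L^n_\ell(f),L^{\mathcal{K}}_{\mathrm{Lip}}(f)\}$ for $f\in \mathrm{Lip}_c^{\mathcal{K}}(\mathcal{G})$. **Multipliers.** For $\phi\in C_c(\mathcal{G})$ there is a (completely) bounded map $m_\phi\colon C_r^*(\mathcal{G})\to C_r^*(\mathcal{G})$, $m_\phi(f)(\gamma)=\phi(\gamma)f(\gamma)$; $\Vert m_\phi\Vert$ is its operator norm. It is unital if $m_\phi(1_{\mathcal{G}^{(0)}})=1_{\mathcal{G}^{(0)}}$. It (or $\phi$) is $\mathcal{K}$-continuous with coefficient $D\ge0$ if $L^{\mathcal{K}}_{\mathrm{Lip}}(m_\phi(f))\le D\,L^{\mathcal{K}}_{\mathrm{Lip}}(f)$ for all $f\in\mathrm{Lip}_c^{\mathcal{K}}(\mathcal{G})$, and $\mathcal{K}$-continuous if this holds for some $D\geq 0$. **Compact quantum metric spaces.** An operator system $\mathcal{X}$ is a unital $*$-invariant (not necessarily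 closed) subspace of a unital $C^*$-algebra; $S(\mathcal{X})$ is the set of positive unital functionals on $\mathcal{X}$. For a seminorm $L\colon\mathcal{X}\to[0,\infty)$ with $L(x^* )=L(x)$ and $L(1)=0$ (a slip-norm), the pair $(\mathcal{X},L)$ is a compact quantum metric space if $\mathrm{mk}_L(\phi,\psi)=\sup\{|\phi(x)-\psi(x)|\mid x\in \mathcal{X}, L(x)\le1\}$ metrizes the weak$^*$ topology on $S(\mathcal{X})$. Here $\mathrm{Lip}_c^{\mathcal{K}}(\mathcal{G})$ is an operator system in $C_r^*(\mathcal{G})$ and $L^{\mathcal{K},n}$ is a slip-norm on it. *)

(* Defs.v *)
From HB Require Import structures.
From mathcomp Require Import all_boot all_order all_algebra complex.
From mathcomp Require Import all_classical all_reals all_analysis.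

Set Implicit Arguments.
Unset Strict Implicit.
Unset Printing Implicit Defensive.
Import Order.TTheory GRing.Theory Num.Theory.
Import numFieldNormedType.Exports.
Export ComplexField.Normc(normc).

Local Open Scope classical_set_scope.
Local Open Scope ring_scope.
Local Open Scope complex_scope.
Local Open Scope ereal_scope.

(** The complex numbers, with the topology of the modulus.  The modulus as an
    element of [R] is [normc]. *)
Notation "'Cplx' R" := (R[i]^o) (at level 10, R at level 9) : type_scope.

(** Supremum in [[0, +oo]], so that the supremum of the empty set is 0. *)
Definition esup0 (R : realType) (A : set \bar R) : \bar R :=
  ereal_sup (A `|` [set 0]).

Section Metrics.
Variable R : realType.

Definition metric_on (T : Type) (A : set T) (d : T -> T -> R) : Prop :=
  [/\ forall x y, A x -> A y -> (0 <= d x y)%R,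
      forall x y, A x -> A y -> (d x y = 0%R <-> x = y),
      forall x y, A x -> A y -> d x y = d y x
    & forall x y z, A x -> A y -> A z -> (d x z <= d x y + d y z)%R].

(** The balls of [d] in [A] generate the subspace topology of [A]. *)
Definition induces_topology (T : topologicalType) (A : set T)
    (d : T -> T -> R) : Prop :=
  forall x, A x -> forall B : set T,
    within A (nbhs x) B <->
    exists2 r : R, (0 < r)%R & forall y, A y -> (d x y < r)%R -> B y.

Definition metrizes (T : topologicalType) (A : set T) (d : T -> T -> R) : Prop :=
  metric_on A d /\ induces_topology A d.

Definition totally_bounded (T : Type) (A : set T) (d : T -> T -> R) : Prop :=
  forall eps : R, (0 < eps)%R -> exists F : set T,
    [/\ finite_set F, F `<=` A
      & forall x, A x -> exists2 y, F y & (d x y < eps)%R].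

End Metrics.

(** Locally compact Hausdorff groupoids.  [gmul] is a total function whose
    values are only meaningful on [composable]; units are identified with
    arrows. *)
Record groupoid := Groupoid {
  arrow :> topologicalType;
  composable : set (arrow * arrow);
  gmul : arrow -> arrow -> arrow;
  ginv : arrow -> arrow;
  ginvK : forall a, ginv (ginv a) = a;
  gmulA : forall a b c, composable (a, b) -> composable (b, c) ->
    [/\ composable (gmul a b, c), composable (a, gmul b c)
      & gmul (gmul a b) c = gmul a (gmul b c)];
  composableV : forall a, composable (a, ginv a);
  gmulKV : forall a b, composable (a, b) ->
    gmul (ginv a) (gmul a b) = b /\ gmul (gmul a b) (ginv b) = a;
  ginv_continuous : continuous ginv;
  gmul_continuous :
    {within composable, continuous (fun p => gmul p.1 p.2)};
  arrow_locally_compact : locally_compact [set: arrow];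
  arrow_hausdorff : hausdorff_space arrow
}.

Section Groupoids.
Variable G : groupoid.

Definition grange (a : G) : G := gmul a (ginv a).
Definition gsource (a : G) : G := gmul (ginv a) a.
Definition units : set G := range grange.

(** [G_u], the arrows with source [u]. *)
Definition sfiber (u : G) : set G := [set a | gsource a = u].

(** The range map is a local homeomorphism onto the unit space, the latter
    with its subspace topology. *)
Definition etale : Prop :=
  forall a : G, exists U : set G,
    [/\ open U, U a, {within U, continuous grange},
        {in U &, injective grange}
      & forall W, open W -> W `<=` U ->
          exists2 V : set G, open V & grange @` W = V `&` units].

End Groupoids.

Section LengthFunctions.
Variables (R : realType) (G : groupoid).

Definition length_function (ell : G -> R) : Prop :=
  [/\ continuous ell,
      forall a, (0 <= ell a)%R,
      forall a, ell a = 0%R <-> units a,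
      forall a, ell (ginv a) = ell a
    & forall a b, composable (a, b) -> (ell (gmul a b) <= ell a + ell b)%R].

Definition lball (ell : G -> R) (t : R) : set G := [set a | (ell a <= t)%R].

Definition proper_length (ell : G -> R) : Prop :=
  forall t : R, (0 <= t)%R -> compact (lball ell t).

Definition bounded_fibers (ell : G -> R) : Prop :=
  forall t : R, (0 <= t)%R -> exists2 F : nat, (1 <= F)%N &
    forall u, units u -> (lball ell t `&` sfiber u #<= `I_F)%card.

End LengthFunctions.

Section ReducedCstarAlgebra.
Variables (R : realType) (G : groupoid).
Implicit Types (f g xi eta : G -> Cplx R).
Implicit Types (S T : (G -> Cplx R) -> (G -> Cplx R)).

Definition Cc : set (G -> Cplx R) :=
  [set f | continuous f /\ compact (closure [set a | f a != 0%R])].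

Definition gunit : G -> Cplx R := \1_(@units G).

Definition gstar f : G -> Cplx R := fun a => conjc (f (ginv a)).

(** Unordered sums; only used on absolutely summable families. *)
Definition rsum (A : set G) (h : G -> R) : R :=
  (fine (\esum_(a in A) (Order.max (h a) 0)%:E)
   - fine (\esum_(a in A) (Order.max (- h a) 0)%:E))%R.

Definition csum (A : set G) (h : G -> Cplx R) : Cplx R :=
  rsum A (fun a => complex.Re (h a)) +i* rsum A (fun a => complex.Im (h a)).

(** The value at the unit [u] of the [C(G^0)]-valued inner product. *)
Definition inner xi eta (u : G) : Cplx R :=
  csum (sfiber u) (fun a => conjc (xi a) * eta a)%R.

Definition module_norm xi : \bar R :=
  esup0 [set sqrte (\esum_(a in sfiber u) (normc (xi a) ^+ 2)%R%:E)
        | u in @units G].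

(** The Hilbert module completing [Cc], realized as functions on [G]: the
    functions of finite [module_norm] form a Banach space (the bounded families
    of vectors of the spaces [l^2(G_u)]) which contains [Cc] isometrically, so
    the completion of [Cc] is its closure there. *)
Definition hmod : set (G -> Cplx R) :=
  [set xi | forall eps : R, (0 < eps)%R ->
    exists2 eta, Cc eta & module_norm (fun a => xi a - eta a)%R < eps%:E].

(** Operators on [hmod] are represented by functions defined on all of
    [G -> Cplx R], of which only the restriction to [hmod] matters. *)
Definition is_adjoint T S : Prop :=
  [/\ forall xi, hmod xi -> hmod (T xi),
      forall xi, hmod xi -> hmod (S xi)
    & forall xi eta, hmod xi -> hmod eta ->
        forall u, units u -> inner (T xi) eta u = inner xi (S eta) u].

Definition adjointable T : Prop := exists S, is_adjoint T S.

Definition opnorm T : \bar R :=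
  esup0 [set module_norm (T xi)
        | xi in [set xi | hmod xi /\ module_norm xi <= 1]].

(** The left regular representation.  When [f] has compact support and [G] is
    etale, the sum has finite support for every function [xi]. *)
Definition lreg f : (G -> Cplx R) -> (G -> Cplx R) :=
  fun xi a => (\sum_(m \in sfiber (gsource a)) (f (gmul a (ginv m)) * xi m))%R.

(** The operators in the reduced C*-algebra; [f] in [Cc] is regarded as an
    element of it through [lreg f]. *)
Definition Cred : set ((G -> Cplx R) -> (G -> Cplx R)) :=
  [set T | adjointable T /\
    forall eps : R, (0 < eps)%R -> exists2 f, Cc f &
      opnorm (fun xi a => T xi a - lreg f xi a)%R < eps%:E].

Definition Cred_norm f : \bar R := opnorm (lreg f).

(** Positivity of an element of [Cc] in the reduced C*-algebra: it has the
    form [T^* T]. *)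
Definition Cred_pos f : Prop :=
  exists T S, [/\ Cred T, is_adjoint T S
                & forall xi, hmod xi -> lreg f xi = S (T xi)].

(** The adjointable operator on [hmod] extending an operator on [Cc]. *)
Definition adj_ext T : (G -> Cplx R) -> (G -> Cplx R) :=
  xget T [set S | adjointable S /\ forall xi, Cc xi -> S xi = T xi].

Section CommutatorSeminorm.
Variable ell : G -> R.

Definition Dlen xi : G -> Cplx R := fun a => ((ell a)%:C * xi a)%R.

Definition commD T : (G -> Cplx R) -> (G -> Cplx R) :=
  fun xi a => (Dlen (T xi) a - T (Dlen xi) a)%R.

Definition delta (n : nat) f : (G -> Cplx R) -> (G -> Cplx R) :=
  iter n commD (lreg f).

Definition Lell (n : nat) f : \bar R := opnorm (adj_ext (delta n f)).

End CommutatorSeminorm.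

Definition mult (phi f : G -> Cplx R) : G -> Cplx R :=
  fun a => (phi a * f a)%R.

(** The multiplier [m_phi] on the reduced C*-algebra.  An element [T] of the
    latter is identified with the function [T gunit] on [G], which is [f] if
    [T] is [lreg f]; the product of it with [phi] lies in [Cc]. *)
Definition mult_op (phi : G -> Cplx R) T : (G -> Cplx R) -> (G -> Cplx R) :=
  lreg (mult phi (T gunit)).

Definition mult_norm (phi : G -> Cplx R) : \bar R :=
  esup0 [set opnorm (mult_op phi T)
        | T in [set T | Cred T /\ opnorm T <= 1]].

Definition mult_unital (phi : G -> Cplx R) : Prop := mult phi gunit = gunit.

End ReducedCstarAlgebra.

Arguments gunit {R G}.
Arguments Cc {R G}.
Arguments hmod {R G}.
Arguments Cred {R G}.

Section MetricStratifications.
Variables (R : realType) (G : groupoid) (d : G -> G -> R).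

(** The metric [d^(i)], given by the same formula on each [K_i]. *)
Definition dstrat (a b : G) : R :=
  Order.max (d (gsource a) (gsource b)) (d (grange a) (grange b)).

Definition metric_stratification (I : countType) (K : I -> set G) : Prop :=
  [/\ \bigcup_i K i = [set: G],
      forall i j, i <> j -> K i `&` K j = set0,
      forall i, precompact (K i) /\ open (K i),
      exists e, K e = @units G
    & (forall i, exists j, K j = (@ginv G) @` K i) /\
      (forall i, metric_on (K i) dstrat /\ totally_bounded (K i) dstrat)].

Variables (I : countType) (K : I -> set G).
Implicit Types (f phi : G -> Cplx R).

Definition LLip_on (i : I) f : \bar R :=
  esup0 [set (normc (f p.1 - f p.2) / dstrat p.1 p.2)%R%:E
        | p in [set p : G * G | [/\ K i p.1, K i p.2 & p.1 <> p.2]]].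

Definition LLip f : \bar R := esup0 (range (fun i => LLip_on i f)).

Definition LipC : set (G -> Cplx R) := [set f | Cc f /\ LLip f < +oo].

Definition total_seminorm (ell : G -> R) (n : nat) f : \bar R :=
  maxe (Lell ell n f) (LLip f).

Definition Kcontinuous_with phi (D : R) : Prop :=
  (0 <= D)%R /\ forall f, LipC f -> LLip (mult phi f) <= D%:E * LLip f.

Definition Kcontinuous phi : Prop := exists D : R, Kcontinuous_with phi D.

Definition seminorm_ball (ell : G -> R) (n : nat) : set (G -> Cplx R) :=
  [set f | LipC f /\ total_seminorm ell n f <= 1].

End MetricStratifications.

(** Compact quantum metric spaces given by operator systems of the reduced
    C*-algebra which consist of elements of [Cc]. *)
Section CompactQuantumMetricSpaces.
Variables (R : realType) (G : groupoid).
Variables (X : set (G -> Cplx R)) (L : (G -> Cplx R) -> \bar R).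

Definition operator_system : Prop :=
  [/\ X `<=` Cc, X gunit,
      forall (c : Cplx R) f g, X f -> X g -> X (fun a => c * f a + g a)%R
    & forall f, X f -> X (gstar f)].

Definition slip_norm : Prop :=
  [/\ forall f, X f -> 0 <= L f /\ L f < +oo,
      forall f g, X f -> X g -> L (fun a => f a + g a)%R <= L f + L g,
      forall (c : Cplx R) f, X f ->
        L (fun a => c * f a)%R = (normc c)%:E * L f,
      forall f, X f -> L (gstar f) = L f
    & L gunit = 0].

(** Functionals on [X] carry the topology of pointwise convergence, that is,
    the weak* topology. *)
Definition functional : topologicalType := {ptws X -> Cplx R}.

(** Linearity is stated through the underlying functions, because the
    operations of [X] are only available under [operator_system]. *)
Definition states : set functional :=
  [set w | [/\ forall (c : Cplx R) (x y z : X),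
                 (forall a, val z a = c * val x a + val y a)%R ->
                 w z = (c * w x + w y)%R,
               forall x : X, Cred_pos (val x) -> (0 <= (w x : R[i]))%R
             & forall x : X, val x = gunit -> w x = 1%R]].

Definition mk_dist (w v : functional) : \bar R :=
  esup0 [set (normc (w x - v x)%R)%:E | x in [set x : X | L (val x) <= 1]].

Definition compact_quantum_metric_space : Prop :=
  [/\ operator_system, slip_norm,
      forall w v, states w -> states v -> mk_dist w v < +oo
    & metrizes states (fun w v => fine (mk_dist w v))].

End CompactQuantumMetricSpaces.

Definition cvg1_on_compacts (R : realType) (G : groupoid)
    (phi : nat -> G -> Cplx R) : Prop :=
  {family compact, phi @ \oo --> (cst 1%R : G -> Cplx R)}.

(* Main.v *)
(** Statement (2) is equivalent to total boundedness, modulo the constants and for the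
    reduced norm, of the unit ball [E] of the total seminorm.

    If [E] is totally bounded modulo constants, then the Monge-Kantorovich metric
    metrizes the weak* topology, because a state is bounded, hence controlled on
    [E] by its values on a finite net.  Conversely the states are weak* compact, so
    finitely many of them are a net for the metric;
      an element of [E] is then determined,
    up to a constant and a small error at every state, by its values at that net, and
    the vector states detect the reduced norm.  Boundedness of states follows from the
    positivity of [1 - h] for small self-adjoint [h], whose square root is obtained by
    iterating [z |-> (h + z^2) / 2].

    Under (1), [f] in [E] is close to [m_phi f], which lives on finitely many [K_i].
    There [f] is 1-Lipschitz, and bounded modulo constants because [ell^n |f| <= 1],
      so a
    finite net of points determines [m_phi f] up to a small error; the Schur test turns
    this into a small reduced norm.  For the converse, write [f] as an element of a
    finite net plus a constant plus a small error: [m_(phi_j)] is close to the identity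
    on the net, fixes the constants, and is uniformly bounded on the error. *)

Require Import Defs.
From mathcomp Require Import all_boot all_order all_algebra complex finmap.
From mathcomp Require Import all_classical all_reals all_analysis.
From mathcomp Require Import ring lra.

Set Implicit Arguments.
Unset Strict Implicit.
Unset Printing Implicit Defensive.
Import Order.TTheory GRing.Theory Num.Theory.
Import numFieldNormedType.Exports.

Local Open Scope classical_set_scope.
Local Open Scope ring_scope.

(** * Complex numbers *)

(** The obstacle is that the reduced norm involves infinite fibres, while the hypotheses give
    pointwise information. Finite propagation bridges the two: for [f] in [Cc], both [lreg f] and
    [delta ell n f] have kernels supported where [ell (a m^-1)] is at most some [t], the second
    kernel being the first multiplied by [(ell a - ell m)^n]. A fibre has at most [F_t] points of
    length at most [t], so the Schur test bounds such operators by the supremum of the kernel, up to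
    a constant depending on [t] alone; multiplication by [phi] supplies a common [t].

    The bound [ell^n |f| <= 1] results from applying the commutator to [gunit], which is a point
    mass on each fibre. It is void on units, where [ell] vanishes; there the Lipschitz condition
    takes over, relative to the value at one base unit, and that value yields the scalar to
    subtract. Scalars cause no error because the unit space is itself a stratum, so that [gunit] is
    constant on strata, and because [m_phi] is unital.

    The factors 2 and 4 in the bounds for states and for the numerical radius are not optimal; total
    boundedness needs only some constant. *)

Section ComplexNumbers.
Variable R : realType.
Implicit Types (x y z : Cplx R) (r : R).

Lemma normc_ge0 x : 0 <= normc x.
Proof. by case: x => a b /=; exact: sqrtr_ge0. Qed.

Lemma sqr_normcE x : normc x ^+ 2 = complex.Re x ^+ 2 + complex.Im x ^+ 2.
Proof. by case: x => a b /=; rewrite sqr_sqrtr// addr_ge0// sqr_ge0. Qed.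

Lemma normc_le r x : 0 <= r -> normc x ^+ 2 <= r ^+ 2 -> normc x <= r.
Proof. by move=> r0; rewrite ler_sqr ?nnegrE// normc_ge0. Qed.

Lemma normcD_le x y : normc (x + y) <= normc x + normc y.
Proof. exact: complex.le_normcD. Qed.

Lemma normc_opp x : normc (- x) = normc x.
Proof. exact: complex.normcN. Qed.

Lemma normc_mul x y : normc (x * y) = normc x * normc y.
Proof. exact: ComplexField.Normc.normcM. Qed.

Lemma normc_zero : normc (0 : Cplx R) = 0.
Proof. exact: ComplexField.Normc.normc0. Qed.

Lemma normc_one : normc (1 : Cplx R) = 1.
Proof. exact: ComplexField.Normc.normc1. Qed.

Lemma normc_eq0 x : (normc x == 0) = (x == 0).
Proof.
apply/eqP/eqP => [|->]; last exact: normc_zero.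
exact: ComplexField.Normc.eq0_normc.
Qed.

Lemma normcBC x y : normc (x - y) = normc (y - x).
Proof. by rewrite -normc_opp opprB. Qed.

Lemma normcB_le x y : normc (x - y) <= normc x + normc y.
Proof. by rewrite -(normc_opp y) normcD_le. Qed.

Lemma normc_dist_le x y : `|normc x - normc y| <= normc (x - y).
Proof.
rewrite ler_norml; apply/andP; split.
  have := normcD_le (y - x) x; rewrite subrK normcBC; lra.
have := normcD_le (x - y) y; rewrite subrK; lra.
Qed.

Lemma normc_conj x : normc (conjc x : Cplx R) = normc x.
Proof. by case: x => a b /=; rewrite sqrrN. Qed.

Lemma normc_real r : normc (r%:C%C : Cplx R) = `|r|.
Proof. by rewrite /= expr0n /= addr0 sqrtr_sqr. Qed.

Lemma normc_Re x : `|complex.Re x| <= normc x.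
Proof.
rewrite -ler_sqr ?nnegrE ?normc_ge0// sqr_normcE real_normK ?num_real//.
by rewrite lerDl sqr_ge0.
Qed.

Lemma normc_Im x : `|complex.Im x| <= normc x.
Proof.
rewrite -ler_sqr ?nnegrE ?normc_ge0// sqr_normcE real_normK ?num_real//.
by rewrite lerDr sqr_ge0.
Qed.

Lemma normc_ReIm x : normc x <= `|complex.Re x| + `|complex.Im x|.
Proof.
apply: normc_le; first by rewrite addr_ge0.
rewrite sqr_normcE sqrrD !real_normK ?num_real//.
by rewrite -addrA lerD2l lerDr mulrn_wge0// mulr_ge0.
Qed.

Lemma normc_sum (T : Type) (s : seq T) (f : T -> Cplx R) :
  normc (\sum_(a <- s) f a) <= \sum_(a <- s) normc (f a).
Proof.
elim: s => [|a s IH]; first by rewrite !big_nil normc_zero.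
by rewrite !big_cons (le_trans (normcD_le _ _))// lerD2l.
Qed.

Lemma conj_mulE x : (conjc x * x : Cplx R) = (normc x ^+ 2)%:C%C.
Proof.
rewrite sqr_normcE; case: x => a b /=; apply/eqP; rewrite eq_complex /=.
by apply/andP; split; apply/eqP; ring.
Qed.

Lemma conjc_add x y : conjc (x + y : Cplx R) = conjc x + conjc y :> Cplx R.
Proof. exact: (rmorphD (@conjc R)). Qed.
Lemma conjc_mul x y : conjc (x * y : Cplx R) = conjc x * conjc y :> Cplx R.
Proof. exact: (rmorphM (@conjc R)). Qed.
Lemma conjc_opp x : conjc (- x : Cplx R) = - conjc x :> Cplx R.
Proof. exact: (rmorphN (@conjc R)). Qed.
Lemma conjc_zero : conjc (0 : Cplx R) = 0 :> Cplx R.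
Proof. exact: (rmorph0 (@conjc R)). Qed.
Lemma conjc_one : conjc (1 : Cplx R) = 1 :> Cplx R.
Proof. exact: (rmorph1 (@conjc R)). Qed.
Lemma conjc_involutive x : conjc (conjc x) = x.
Proof. exact: conjcK. Qed.
Lemma conjc_sum (T : Type) (s : seq T) (f : T -> Cplx R) :
  conjc (\sum_(a <- s) f a) = \sum_(a <- s) (conjc (f a) : Cplx R) :> Cplx R.
Proof. exact: (rmorph_sum (@conjc R)). Qed.

Lemma realcD r s : ((r + s)%:C)%C = r%:C%C + s%:C%C :> Cplx R.
Proof. exact: (rmorphD (@real_complex_def R (Phant R))). Qed.
Lemma realcM r s : ((r * s)%:C)%C = r%:C%C * s%:C%C :> Cplx R.
Proof. exact: (rmorphM (@real_complex_def R (Phant R))). Qed.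
Lemma realcB r s : ((r - s)%:C)%C = r%:C%C - s%:C%C :> Cplx R.
Proof. exact: (rmorphB (@real_complex_def R (Phant R))). Qed.

Lemma realcN r : ((- r)%:C)%C = - r%:C%C :> Cplx R.
Proof. exact: (rmorphN (@real_complex_def R (Phant R))). Qed.
Lemma realc1 : 1%:C%C = 1 :> Cplx R.
Proof. exact: (rmorph1 (@real_complex_def R (Phant R))). Qed.
Lemma realcX r n : ((r ^+ n)%:C)%C = r%:C%C ^+ n :> Cplx R.
Proof. exact: (rmorphXn (@real_complex_def R (Phant R))). Qed.
Lemma conjc_realc r : conjc (r%:C%C : Cplx R) = r%:C%C.
Proof. exact: conjc_real. Qed.

(** The norm of [Cplx R] takes values in [R[i]], whose positive elements are exactly the positive
    reals, so a real epsilon suffices. *)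
Lemma cvgcP (T : Type) (F : set_system T) {FF : Filter F} (f : T -> Cplx R)
    (l : Cplx R) :
  f @ F --> l <-> forall e : R, 0 < e -> \forall x \near F, normc (l - f x) < e.
Proof.
split=> [/cvgrPdist_lt H e e0|H].
  have /H : (0 : R[i]) < e%:C%C by rewrite ltcR.
  by apply: filterS => x; rewrite normc_def ltcR; case: (l - f x).
apply/cvgrPdist_lt => -[e e'] /=; rewrite ltcE /= => /andP[/eqP -> e0].
move: (H _ e0); apply: filterS => x.
by rewrite normc_def /= ltcE /= eqxx /=; case: (l - f x).
Qed.

Lemma near_normc x e : 0 < e -> \forall y \near x, normc (x - y) < e.
Proof.
move=> e0; apply: (iffLR (@cvgcP _ (nbhs x) (nbhs_filter x) (fun y => y) x)) => //.
Qed.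

Lemma continuous_normc : continuous (fun x : Cplx R => normc x).
Proof.
move=> x; apply/(@cvgrPdist_lt _ _ _ (nbhs x) (nbhs_filter x)) => e e0.
move: (near_normc x e0).
by apply: filterS => y; exact: le_lt_trans (normc_dist_le _ _).
Qed.

Lemma continuous_conjc : continuous (fun x : Cplx R => conjc x : Cplx R).
Proof.
move=> x; apply/(@cvgcP _ (nbhs x) (nbhs_filter x)) => e e0.
move: (near_normc x e0).
by apply: filterS => y; rewrite -normc_conj conjc_add conjc_opp.
Qed.

Lemma continuous_realc : continuous (fun r : R => r%:C%C : Cplx R).
Proof.
move=> x; apply/(@cvgcP _ (nbhs x) (nbhs_filter x)) => e e0.
have : \forall y \near x, `|x - y| < e by exact: nbhsx_ballx.
by apply: filterS => y; rewrite -realcB normc_real.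
Qed.

Lemma continuous_Re : continuous (fun x : Cplx R => complex.Re x).
Proof.
move=> x; apply/(@cvgrPdist_lt _ _ _ (nbhs x) (nbhs_filter x)) => e e0.
move: (near_normc x e0).
apply: filterS => y; apply: le_lt_trans.
by apply: le_trans (normc_Re _); case: (x) (y) => ? ? [].
Qed.

Lemma continuous_Im : continuous (fun x : Cplx R => complex.Im x).
Proof.
move=> x; apply/(@cvgrPdist_lt _ _ _ (nbhs x) (nbhs_filter x)) => e e0.
move: (near_normc x e0).
apply: filterS => y; apply: le_lt_trans.
by apply: le_trans (normc_Im _); case: (x) (y) => ? ? [].
Qed.

Section Limits.
Variables (T : Type) (F : set_system T).
Context {FF : Filter F}.

Lemma cvgcD (f g : T -> Cplx R) (l m : Cplx R) : f @ F --> l -> g @ F --> m ->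
  (fun t => f t + g t) @ F --> l + m.
Proof. exact: cvgD. Qed.

Lemma cvgcB (f g : T -> Cplx R) (l m : Cplx R) : f @ F --> l -> g @ F --> m ->
  (fun t => f t - g t) @ F --> l - m.
Proof. exact: cvgB. Qed.

Lemma cvgcM (f g : T -> Cplx R) (l m : Cplx R) : f @ F --> l -> g @ F --> m ->
  (fun t => f t * g t) @ F --> l * m.
Proof. exact: cvgM. Qed.

Lemma cvgc_sum (J : eqType) (s : seq J) (f : J -> T -> Cplx R)
    (l : J -> Cplx R) :
  (forall j, j \in s -> f j @ F --> l j) ->
  (fun t => \sum_(j <- s) f j t) @ F --> \sum_(j <- s) l j.
Proof.
elim: s => [|j s IH] H.
  rewrite big_nil (_ : (fun t => _) = cst 0); first exact: cvg_cst.
  by apply/funext => t; rewrite big_nil.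
rewrite big_cons (_ : (fun t => _) =
    (fun t => f j t + \sum_(j <- s) f j t)); last first.
  by apply/funext => t; rewrite big_cons.
apply: cvgcD; first by apply: H; rewrite mem_head.
by apply: IH => i si; apply: H; rewrite in_cons si orbT.
Qed.
End Limits.

(** Nested intervals: [2 r 2^-n] is the tail of the geometric series, so the lower ends
    [q n - 2 r 2^-n] increase and the upper ends decrease. The limit is the supremum of the lower
    ends, and the explicit rate is what later estimates consume. *)
Lemma geometric_real (q : nat -> R) r :
  (forall n, `|q n.+1 - q n| <= r * 2^-1 ^+ n) ->
  exists l, forall n, `|l - q n| <= 2 * r * 2^-1 ^+ n.
Proof.
move=> H.
have r0 : 0 <= r by have := H 0%N; rewrite expr0 mulr1; exact: le_trans.
pose p n : R := 2^-1 ^+ n; have pS n : p n.+1 = p n / 2 by rewrite /p exprSr.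
have p0 n : 0 <= p n by rewrite /p exprn_ge0.
have HH n : `|q n.+1 - q n| <= r * p n by exact: H.
have A m n : (m <= n)%N -> q m - 2 * r * p m <= q n - 2 * r * p n /\
    q n + 2 * r * p n <= q m + 2 * r * p m.
  elim: n => [|n IH]; first by rewrite leqn0 => /eqP ->.
  rewrite leq_eqVlt => /predU1P[->//|]; rewrite ltnS => /IH [].
  have := HH n; rewrite ler_norml pS => /andP[]; lra.
have B m n : q m - 2 * r * p m <= q n + 2 * r * p n.
  have P1 k : 0 <= 2 * r * p k by rewrite mulr_ge0// mulr_ge0.
  case: (leqP m n) => [/A[]|/ltnW/A[]]; have := P1 n; have := P1 m; lra.
pose S := range (fun n => q n - 2 * r * p n).
have Sne : S !=set0 by exists (q 0%N - 2 * r * p 0%N), 0%N.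
have Sub n : ubound S (q n + 2 * r * p n) by move=> _ [m _ <-]; exact: B.
exists (sup S) => n; rewrite ler_distl; apply/andP; split.
  apply: ub_le_sup; last by exists n.
  by exists (q 0%N + 2 * r * p 0%N); exact: Sub.
by apply: ge_sup.
Qed.

Lemma geometric_complex (q : nat -> Cplx R) r :
  (forall n, normc (q n.+1 - q n) <= r * 2^-1 ^+ n) ->
  exists l : Cplx R, forall n, normc (l - q n) <= 4 * r * 2^-1 ^+ n.
Proof.
move=> H.
have [n|l1 H1] := @geometric_real (fun n => complex.Re (q n)) r.
  apply: le_trans (H n); apply: le_trans (normc_Re _).
  by case: (q n) (q n.+1) => ? ? [].
have [n|l2 H2] := @geometric_real (fun n => complex.Im (q n)) r.
  apply: le_trans (H n); apply: le_trans (normc_Im _).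
  by case: (q n) (q n.+1) => ? ? [].
exists (l1 +i* l2)%C => n; apply: le_trans (normc_ReIm _) _.
have := H1 n; have := H2 n; case: (q n) => a b /=; lra.
Qed.

Lemma compact_rectangle (M : R) : compact
  [set x : Cplx R | `|complex.Re x| <= M /\ `|complex.Im x| <= M].
Proof.
have cI : compact `[- M, M] by exact: segment_compact.
have : compact ((fun p : R * R => (p.1%:C + 'i * p.2%:C)%C : Cplx R) @`
    (`[- M, M] `*` `[- M, M])).
  apply: continuous_compact; last exact: compact_setX.
  apply: continuous_subspaceT => p.
  apply: cvgcD.
    apply: continuous_comp; [exact: cvg_fst|exact: continuous_realc].
  apply: cvgcM; first exact: cvg_cst.
  apply: continuous_comp; [exact: cvg_snd|exact: continuous_realc].
congr compact; apply/seteqP; split => [_ [[a b] /= [Ma Mb] <-]|x [Mr Mi]].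
  move: Ma Mb; rewrite !in_itv /= -!ler_norml.
  by rewrite !(mul0r, mul1r, addr0, add0r, subr0).
exists (complex.Re x, complex.Im x); last first.
  by rewrite /= [RHS]complexE.
by split; rewrite /= in_itv /= -ler_norml.
Qed.

End ComplexNumbers.

(** * Finite nets and compactness *)

Lemma seq_bound (R : realType) (J : eqType) (T : Type) (E : set T) (s : seq J)
    (g : J -> T -> R) :
  (forall j, j \in s -> exists M, forall x, E x -> g j x <= M) ->
  exists2 M, 0 <= M & forall j, j \in s -> forall x, E x -> g j x <= M.
Proof.
elim: s => [|j s IH] H; first by exists 0.
have [i si|M M0 HM] := IH; first by apply: H; rewrite in_cons si orbT.
have [M' HM'] := H j (mem_head _ _); exists (Num.max M M').
  by rewrite le_max M0.
move=> i; rewrite in_cons => /predU1P[->|si] x Ex; rewrite le_max.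
  by rewrite HM' ?orbT.
by rewrite HM.
Qed.

Lemma truncn_close (R : realType) (e M x y : R) : 0 < e -> `|x| <= M -> `|y| <= M ->
  Num.truncn ((x + M) / e) = Num.truncn ((y + M) / e) -> `|x - y| <= e.
Proof.
move=> e0; rewrite !ler_norml => /andP[x1 x2] /andP[y1 y2] E.
have X : 0 <= (x + M) / e by rewrite divr_ge0 ?(ltW e0)//; lra.
have Y : 0 <= (y + M) / e by rewrite divr_ge0 ?(ltW e0)//; lra.
have /andP[] := truncn_itv X; have /andP[] := truncn_itv Y; rewrite E.
rewrite -natr1; move: (_%:R) => k.
rewrite !ler_pdivlMr// !ltr_pdivrMr// mulrDl mul1r => ? ? ? ?.
by apply/andP; split; lra.
Qed.

(** Pigeonhole: each [x] is coded by the grid squares that contain its finitely many values, and one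
    representative is kept for every code that occurs. The mesh is [e / 2] because the errors of the
    real and imaginary parts add up. For empty [s] this merely picks an element of [E], if there is
    one. *)
Lemma cells (R : realType) (J : eqType) (T : Type) (E : set T) (s : seq J)
    (g : J -> T -> Cplx R) (e : R) : 0 < e ->
  (forall j, j \in s -> exists M, forall x, E x -> normc (g j x) <= M) ->
  exists (m : nat) (A : 'I_m -> T), (forall i, E (A i)) /\
    forall x, E x -> exists i, forall j, j \in s -> normc (g j x - g j (A i)) <= e.
Proof.
move=> e0 /seq_bound[M M0 HM]; have e20 : 0 < e / 2 by rewrite divr_gt0.
pose k := Num.truncn ((M + M) / (e / 2)).
pose q (y : R) := Num.truncn ((y + M) / (e / 2)).
have qk y : `|y| <= M -> (q y < k.+1)%N.
  rewrite ler_norml => /andP[_ yM]; rewrite ltnS; apply: le_truncn.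
  by rewrite ler_pM2r ?invr_gt0//; lra.
pose code x : {ffun 'I_(size s) -> 'I_k.+1 * 'I_k.+1} :=
  [ffun i => let z := g (tnth (in_tuple s) i) x in
     (inord (q (complex.Re z)), inord (q (complex.Im z)))].
pose P := [pred c | `[< exists x, E x /\ code x = c >]].
have /choice[A HA] : forall i : 'I_#|P|, exists x, E x /\ code x = enum_val i.
  by move=> i; apply/asboolP; exact: (enum_valP i).
exists #|P|, A; split=> [i|x Ex]; first by have [] := HA i.
have Px : code x \in P by apply/asboolP; exists x.
exists (enum_rank_in Px (code x)) => j js.
have [EA] := HA (enum_rank_in Px (code x)); rewrite enum_rankK_in//.
set y := A _ in EA *; have /seq_tnthP[i ji] := js.
move=> /ffunP/(_ i); rewrite !ffunE -ji => -[/(congr1 val) + /(congr1 val)].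
have re z : E z -> `|complex.Re (g j z)| <= M.
  by move=> Ez; apply: le_trans (normc_Re _) _; exact: HM.
have im z : E z -> `|complex.Im (g j z)| <= M.
  by move=> Ez; apply: le_trans (normc_Im _) _; exact: HM.
rewrite /= !inordK ?qk ?re ?im// => /(truncn_close e20 (re _ EA) (re _ Ex)) H1.
move=> /(truncn_close e20 (im _ EA) (im _ Ex)) H2.
rewrite normcBC; apply: le_trans (normc_ReIm _) _; move: H1 H2.
case: (g j x) (g j y) => a b [c d] /= H1 H2; lra.
Qed.

(** If no finite subfamily covers, the complements in [A] of finite unions generate a proper filter
    on [A]. A cluster point [p] of it lies in [A], and its own neighbourhood [B p] has been removed
    by the list [[:: p]]. *)
Lemma compact_finite_cover (T : topologicalType) (A : set T) (B : T -> set T) :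
  compact A -> (forall x, A x -> nbhs x (B x)) ->
  exists s : seq T, (forall y, y \in s -> A y) /\
    forall x, A x -> exists2 y, y \in s & B y x.
Proof.
move=> cA nB; apply: contrapT => N.
pose C (s : seq T) := A `\` [set x | exists2 y, y \in s & B y x].
pose F : set_system T := [set S | exists2 s : seq T,
  (forall y, y \in s -> A y) & C s `<=` S].
have FF : ProperFilter F.
  split.
    move=> [s sA sC]; apply: N; exists s; split=> // x Ax.
    by apply: contrapT => nx; apply: (sC x); split.
  split; first by exists [::].
  - move=> P Q [s sA sP] [r rA rQ]; exists (s ++ r).
      by move=> y; rewrite mem_cat => /orP[/sA|/rA].
    move=> x [Ax nx]; split; [apply: sP|apply: rQ]; split=> // -[y ys By];
      by apply: nx; exists y => //; rewrite mem_cat ys ?orbT.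
  - by move=> P Q PQ [s sA sP]; exists s => // x /sP/PQ.
have FA : F A by exists [::] => // x [].
have [p [Ap clp]] := cA F FF FA.
have FB : F (C [:: p]) by exists [:: p] => // y; rewrite mem_seq1 => /eqP ->.
have [x [[_ nx] Bx]] := clp _ _ FB (nB p Ap).
by apply: nx; exists p => //; rewrite mem_seq1.
Qed.

Lemma ptws_cvg (I : eqType) (V : topologicalType) (F : set_system {ptws I -> V})
    (w : {ptws I -> V}) : Filter F ->
  (forall x, (fun v : {ptws I -> V} => v x) @ F --> w x) -> F --> w.
Proof.
move=> FF pw; apply/cvg_sup => x; apply/cvg_image.
  by apply/seteqP; split=> // v _; exists (fun=> v).
apply: cvg_trans (pw x) => W FW; exists ((fun v : {ptws I -> V} => v x) @^-1` W) => //.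
by rewrite image_preimage//; apply/seteqP; split=> // v _; exists (fun=> v).
Qed.

(** * Groupoids *)

Section GroupoidAlgebra.
Variable G : groupoid.
Implicit Types a b m p u : G.

Lemma composableVl a : composable (ginv a, a).
Proof. by have := composableV (ginv a); rewrite ginvK. Qed.

Lemma grangeV a : grange (ginv a) = gsource a.
Proof. by rewrite /grange ginvK. Qed.

Lemma gsourceV a : gsource (ginv a) = grange a.
Proof. by rewrite /gsource ginvK. Qed.

Lemma gmul_gsource a : gmul a (gsource a) = a.
Proof. by have [+ _] := gmulKV (composableVl a); rewrite ginvK. Qed.

Lemma gmul_grange a : gmul (grange a) a = a.
Proof. by have [_] := gmulKV (composableV a); rewrite ginvK. Qed.

(** Bracketing [a^-1 (a b) b^-1] in two ways gives [b b^-1 = a^-1 a]. Conversely, [a] is composable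
    with [a^-1 a = b b^-1], which is composable with [b]. *)
Lemma composableE a b : composable (a, b) <-> gsource a = grange b.
Proof.
split=> [ab|sr].
  have [E1 E2] := gmulKV ab.
  have [_ c1 _] := gmulA (composableVl a) ab.
  have [c2 _ _] := gmulA ab (composableV b).
  have [_ _ E] := gmulA c1 c2.
  by rewrite E1 E2 in E.
have [_ c1 _] := gmulA (composableV a) (composableVl a).
have [c2 _ _] := gmulA (composableV b) (composableVl b).
rewrite -/(gsource a) sr in c1; have [+ _ _] := gmulA c1 c2.
by rewrite -sr gmul_gsource.
Qed.

Lemma grangeM a b : gsource a = grange b -> grange (gmul a b) = grange a.
Proof.
move=> /composableE ab; have [_ c _] := gmulA (composableVl a) ab.
by move/composableE: c; rewrite gsourceV.
Qed.

Lemma gsourceM a b : gsource a = grange b -> gsource (gmul a b) = gsource b.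
Proof.
move=> /composableE ab; have [c _ _] := gmulA ab (composableV b).
by move/composableE: c; rewrite grangeV.
Qed.

Lemma gsource_grange a : gsource (grange a) = grange a.
Proof. by rewrite {2}/grange gsourceM ?gsourceV// grangeV. Qed.

Lemma unit_grange a : units (grange a).
Proof. by exists a. Qed.

Lemma unit_gsource a : units (gsource a).
Proof. by exists (ginv a); rewrite ?grangeV. Qed.

Lemma gsource_unit u : units u -> gsource u = u.
Proof. by move=> [a _ <-]; exact: gsource_grange. Qed.

Lemma gsource_gsource a : gsource (gsource a) = gsource a.
Proof. exact/gsource_unit/unit_gsource. Qed.

Lemma gdivK a m : gsource m = gsource a -> gmul (gmul a (ginv m)) m = a.
Proof.
move=> ma; have /composableE/gmulKV[_] : gsource a = grange (ginv m).
  by rewrite grangeV.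
by rewrite ginvK.
Qed.

Lemma gmulK a m : gsource a = grange m -> gmul (gmul a m) (ginv m) = a.
Proof. by move=> /composableE/gmulKV[]. Qed.

Lemma gsource_div a m : gsource m = gsource a ->
  gsource (gmul a (ginv m)) = grange m.
Proof. by move=> ma; rewrite gsourceM ?gsourceV// grangeV. Qed.

Lemma grange_div a m : gsource m = gsource a ->
  grange (gmul a (ginv m)) = grange a.
Proof. by move=> ma; rewrite grangeM// grangeV. Qed.

Lemma ginv_div a m : gsource m = gsource a ->
  ginv (gmul a (ginv m)) = gmul m (ginv a).
Proof.
move=> ma; set q := gmul a (ginv m).
have qm : gmul q m = a by exact: gdivK.
have /composableE/gmulKV[E _] : gsource q = grange m by exact: gsource_div.
rewrite -E qm gmulK// gsourceV /q grange_div//.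
Qed.

(** This cancellation is the change of variable [m] to [m p^-1] behind the multiplicativity of the
    regular representation. *)
Lemma gdiv_div a m p : gsource m = gsource a -> gsource p = gsource a ->
  gmul (gmul a (ginv p)) (ginv (gmul m (ginv p))) = gmul a (ginv m).
Proof.
move=> ma pa; rewrite ginv_div ?pa//.
have c1 : composable (gmul a (ginv p), p) by apply/composableE; exact: gsource_div.
have c2 : composable (p, ginv m) by apply/composableE; rewrite grangeV pa.
by have [_ _ <-] := gmulA c1 c2; rewrite gdivK.
Qed.

Lemma unit_div a m : gsource m = gsource a ->
  units (gmul a (ginv m)) <-> a = m.
Proof.
move=> ma; split=> [U|->]; last exact: unit_grange.
have := gdivK ma; have := gsource_div ma; rewrite gsource_unit// => ->.
by rewrite gmul_grange.
Qed.

Lemma ginv_unit u : units u -> ginv u = u.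
Proof. by move=> [a _ <-]; rewrite /grange ginv_div. Qed.

Lemma gdiv_gsource a : gmul a (ginv (gsource a)) = a.
Proof. by rewrite ginv_unit ?gmul_gsource//; exact: unit_gsource. Qed.

Lemma gmul_cvg (T : Type) (F : set_system T) {FF : Filter F} (f g : T -> G) a b :
  f @ F --> a -> g @ F --> b -> composable (a, b) ->
  (\forall x \near F, composable (f x, g x)) ->
  (fun x => gmul (f x) (g x)) @ F --> gmul a b.
Proof.
move=> fa gb ab fg.
have /subspace_continuousP/(_ _ ab) /= H := @gmul_continuous G.
move=> W /H; rewrite /= => HW.
have : \forall x \near F, composable (f x, g x) -> W (gmul (f x) (g x)).
  have : (fun x => (f x, g x)) @ F --> (a, b) by exact: cvg_pair.
  by move/(_ _ HW).
by apply: filterS2 fg => x cx /(_ cx).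
Qed.

Lemma continuous_gsource : continuous (@gsource G).
Proof.
move=> a; apply: gmul_cvg; [exact: ginv_continuous|exact: cvg_id| |].
  exact: composableVl.
by near=> x; exact: composableVl.
Unshelve. all: by end_near. Qed.

(** The local inverse of the range map at [m0^-1], transported by inversion. The value [sg a] is the
    point of the chart over the source of [a]; it tends to [m0] because the range map sends small
    open sets to relatively open sets of units. *)
Lemma source_section (G_etale : etale G) m0 : exists (U : set G) (sg : G -> G),
  [/\ open U, U m0, {in U &, injective (@gsource G)}
    & forall a0, gsource m0 = gsource a0 ->
      (\forall a \near a0, U (sg a) /\ gsource (sg a) = gsource a) /\
      sg @ a0 --> m0].
Proof.
have [U [oU Um _ injU imU]] := G_etale (ginv m0).
pose V := @ginv G @^-1` U.
have oV : open V by apply: open_comp => // x _; exact: ginv_continuous.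
have injV : {in V &, injective (@gsource G)}.
  move=> x y /set_mem Vx /set_mem Vy; rewrite -!grangeV => /injU E.
  by rewrite -(ginvK x) -(ginvK y) E ?inE.
pose sg a := xget m0 [set m | V m /\ gsource m = gsource a].
exists V, sg; split=> //=.
move=> a0 ma0.
have H W : nbhs m0 W -> \forall a \near a0, exists m,
    [/\ V m, W m & gsource m = gsource a].
  rewrite nbhsE => -[W0 [oW0 W0m] W0W].
  have oWU : open (@ginv G @^-1` W0 `&` U).
    by apply: openI => //; apply: open_comp => // x _; exact: ginv_continuous.
  have [|O oO imO] := imU _ oWU; first by move=> x [].
  have Oa0 : O (gsource a0).
    have : (@grange G @` (@ginv G @^-1` W0 `&` U)) (grange (ginv m0)).
      by exists (ginv m0) => //; split=> //; rewrite /preimage /= ginvK.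
    by rewrite imO grangeV ma0 => -[].
  have : \forall a \near a0, O (gsource a).
    exact: continuous_gsource (open_nbhs_nbhs (conj oO Oa0)).
  apply: filterS => a /= Oa.
  have : (O `&` @units G) (gsource a) by split => //; exact: unit_gsource.
  rewrite -imO => -[b [W0b Ub] ba]; exists (ginv b).
  split; [by rewrite /V /preimage /= ginvK|exact: W0W|by rewrite gsourceV].
split.
  have /H : nbhs m0 setT by exact: filter_nbhsT.
  apply: filterS => a [m [Vm _ sm]].
  exact: (@xgetI _ m0 [set m | V m /\ gsource m = gsource a] m (conj Vm sm)).
move=> W /H /=; apply: filterS => a [m [Vm Wm sm]].
have [Vx sx] := @xgetI _ m0 [set m | V m /\ gsource m = gsource a] m (conj Vm sm).
by rewrite /= (_ : sg a = m)//; apply: injV; rewrite ?inE// sx.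
Qed.

End GroupoidAlgebra.

Lemma near_seq (T : eqType) (X : Type) (F : set_system X) {FF : Filter F}
    (L : seq T) (P : T -> X -> Prop) :
  (forall m, m \in L -> \forall a \near F, P m a) ->
  \forall a \near F, forall m, m \in L -> P m a.
Proof.
elim: L => [_|m L IH H]; first exact: filterE.
have := IH (fun n nL => H n (@mem_behead _ (m :: L) n nL)).
apply: filterS2 (H m (mem_head _ _)) => a Pm PL n.
by rewrite in_cons => /predU1P[->//|]; exact: PL.
Qed.

Lemma fsbig_list (T : choiceType) (V : nmodType) (A : set T) (s : seq T)
    (f : T -> V) : uniq s -> (forall a, a \in s -> A a) ->
  (forall a, A a -> a \notin s -> f a = 0) ->
  \sum_(a \in A) f a = \sum_(a <- s) f a.
Proof.
move=> us sA f0; rewrite (fsbigE s)//.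
by rewrite big_seq_cond [RHS]big_seq; apply: eq_bigl => a;
  rewrite andb_idr// => /sA/mem_set.
Qed.

(** * Unordered sums and fiberwise inner products *)

Section FiniteSubsetFilter.
Variable T : choiceType.
Implicit Types (A : set T) (s : seq T).

Definition subseq_of A s := uniq s /\ forall a, a \in s -> A a.

(** The filter of eventually-true properties of the finite subsets of [A],
    encoded as duplicate-free lists. *)
Definition finsub A : set_system (seq T) := [set P | exists2 s0, subseq_of A s0 &
  forall s, subseq_of A s -> {subset s0 <= s} -> P s].

Lemma subseq_nil A : subseq_of A [::]. Proof. by []. Qed.

Lemma subseq_cat A s1 s2 : subseq_of A s1 -> subseq_of A s2 ->
  subseq_of A (undup (s1 ++ s2)).
Proof.
move=> [_ H1] [_ H2]; split; first exact: undup_uniq.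
by move=> a; rewrite mem_undup mem_cat => /orP[/H1|/H2].
Qed.

Global Instance finsub_filter A : ProperFilter (finsub A).
Proof.
split; first by move=> [s0 As0 /(_ s0 As0)]; apply.
split.
- by exists [::]; [exact: subseq_nil|].
- move=> P Q [s1 As1 H1] [s2 As2 H2].
  exists (undup (s1 ++ s2)); first exact: subseq_cat.
  move=> s As sub; split.
    by apply: H1 => // a as1; apply: sub; rewrite mem_undup mem_cat as1.
  by apply: H2 => // a as2; apply: sub; rewrite mem_undup mem_cat as2 orbT.
- by move=> P Q PQ [s0 As0 H]; exists s0 => // s As sub; apply/PQ/H.
Qed.

Lemma finsub_self A : finsub A (subseq_of A).
Proof. by exists [::]; [exact: subseq_nil|]. Qed.

Lemma sum_widen (V : nmodType) s0 s (f : T -> V) : uniq s0 -> uniq s ->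
  {subset s0 <= s} -> (forall a, a \in s -> a \notin s0 -> f a = 0) ->
  \sum_(a <- s) f a = \sum_(a <- s0) f a.
Proof.
move=> u0 us sub f0; rewrite (bigID (mem s0)) /= [X in _ + X]big_seq_cond.
rewrite [X in _ + X]big1; last by move=> a /andP[]; exact: f0.
rewrite addr0 -big_filter; apply: perm_big; apply: uniq_perm => //.
  exact: filter_uniq.
by move=> a; rewrite mem_filter andb_idr//; exact: sub.
Qed.

Lemma ler_sum_subset (R : numDomainType) s0 s (f : T -> R) : uniq s0 -> uniq s ->
  {subset s0 <= s} -> (forall a, 0 <= f a) ->
  \sum_(a <- s0) f a <= \sum_(a <- s) f a.
Proof.
move=> u0 us sub f0; rewrite [leRHS](bigID (mem s0)) /=.
have -> : \sum_(a <- s | a \in s0) f a = \sum_(a <- s0) f a.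
  rewrite -big_filter; apply: perm_big; apply: uniq_perm => //.
    exact: filter_uniq.
  by move=> a; rewrite mem_filter andb_idr//; exact: sub.
by rewrite lerDl sumr_ge0.
Qed.

Variable R : realType.

Lemma esum_leP A (h : T -> R) M : (forall a, 0 <= h a) ->
  (\esum_(a in A) (h a)%:E <= M%:E)%E <->
  forall s, subseq_of A s -> \sum_(a <- s) h a <= M.
Proof.
move=> h0; split=> [le s [us sA]|H].
  rewrite -lee_fin; apply: le_trans le; apply: esum_ge.
  exists [set` s]; first by split; [exact: finite_seq|].
  by rewrite -fsbig_seq// sumEFin.
apply: ge_ereal_sup => _ [X [finX XA] <-].
rewrite fsbig_finite//= sumEFin lee_fin; apply: H; split; first exact: fset_uniq.
by move=> a; rewrite in_fset_set// inE => /XA.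
Qed.

Lemma esum_cvg A (h : T -> R) M : (forall a, 0 <= h a) ->
  (forall s, subseq_of A s -> \sum_(a <- s) h a <= M) ->
  (fun s => \sum_(a <- s) h a) @ finsub A -->
    fine (\esum_(a in A) (h a)%:E)%E.
Proof.
move=> h0 hM; have H := esum_leP A _ h0.
have E0 : (0 <= \esum_(a in A) (h a)%:E)%E.
  by apply: esum_ge0 => a _; rewrite lee_fin.
case: (\esum_(a in A) _)%E H E0 => [r H _ /=|/(_ M)[_ /(_ hM)]|//]; last by [].
apply/cvgrPdist_lt => e e0.
have [s0 s0A s0r] : exists2 s0, subseq_of A s0 & r - e < \sum_(a <- s0) h a.
  apply: contrapT => N; have : (r%:E <= (r - e)%:E)%E.
    apply/H => s sA; rewrite leNgt; apply/negP => lt; apply: N; by exists s.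
  by rewrite lee_fin; lra.
exists s0 => // s sA sub; rewrite /= ger0_norm.
  rewrite ltrBlDl -ltrBlDr (lt_le_trans s0r)// ler_sum_subset//.
  - by case: s0A.
  - by case: sA.
by rewrite subr_ge0; apply: (iffLR (H r)).
Qed.

End FiniteSubsetFilter.

Section FiberSums.
Variables (R : realType) (G : groupoid).
Implicit Types (A : set G) (s : seq G) (h : G -> Cplx R).

Lemma rsum_cvg A (h : G -> R) M :
  (forall s, subseq_of A s -> \sum_(a <- s) `|h a| <= M) ->
  (fun s => \sum_(a <- s) h a) @ finsub A --> rsum A h.
Proof.
move=> hM; pose hp a := Order.max (h a) 0; pose hm a := Order.max (- h a) 0.
have hp0 a : 0 <= hp a by rewrite /hp le_max lexx orbT.
have hm0 a : 0 <= hm a by rewrite /hm le_max lexx orbT.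
have hpm a : h a = hp a - hm a.
  rewrite /hp /hm; have [h0|h0] := leP 0 (h a).
    by rewrite max_r ?subr0// oppr_le0.
  by rewrite max_l ?sub0r ?opprK// oppr_ge0 ltW.
have hpN a : hp a <= `|h a| by rewrite /hp ge_max ler_norm normr_ge0.
have hmN a : hm a <= `|h a| by rewrite /hm ge_max -normrN ler_norm normr_ge0.
have Cp := @esum_cvg _ _ A hp M hp0 _.
have Cm := @esum_cvg _ _ A hm M hm0 _.
rewrite (_ : (fun s => _) = (fun s => \sum_(a <- s) hp a - \sum_(a <- s) hm a)).
  apply: cvgB; [apply: Cp|apply: Cm] => s sA; apply: le_trans (hM s sA);
  exact: ler_sum.
by apply/funext => s; rewrite -sumrB; apply: eq_bigr.
Qed.

Lemma Re_sum (T : Type) (s : seq T) (h : T -> Cplx R) :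
  complex.Re (\sum_(a <- s) h a) = \sum_(a <- s) complex.Re (h a).
Proof.
elim: s => [|a s IH]; first by rewrite !big_nil.
by rewrite !big_cons -IH; case: (h a) (\sum_(a <- s) h a) => ? ? [].
Qed.

Lemma Im_sum (T : Type) (s : seq T) (h : T -> Cplx R) :
  complex.Im (\sum_(a <- s) h a) = \sum_(a <- s) complex.Im (h a).
Proof.
elim: s => [|a s IH]; first by rewrite !big_nil.
by rewrite !big_cons -IH; case: (h a) (\sum_(a <- s) h a) => ? ? [].
Qed.

(** Bounded absolute partial sums make the sums of the positive and negative parts of both
    coordinates finite, so [csum] becomes a limit along finite subsets; all later computations with
    it go through this limit. *)
Lemma csum_cvg A h M :
  (forall s, subseq_of A s -> \sum_(a <- s) normc (h a) <= M) ->
  (fun s => \sum_(a <- s) h a) @ finsub A --> csum A h.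
Proof.
move=> hM; apply/cvgcP => e e0; have e20 : 0 < e / 2 by rewrite divr_gt0.
have /cvgrPdist_lt/(_ _ e20) H1 : (fun s => \sum_(a <- s) complex.Re (h a)) @
    finsub A --> rsum A (fun a => complex.Re (h a)).
  apply: (@rsum_cvg _ _ M) => s sA; apply: le_trans (hM s sA).
  by apply: ler_sum => a _; exact: normc_Re.
have /cvgrPdist_lt/(_ _ e20) H2 : (fun s => \sum_(a <- s) complex.Im (h a)) @
    finsub A --> rsum A (fun a => complex.Im (h a)).
  apply: (@rsum_cvg _ _ M) => s sA; apply: le_trans (hM s sA).
  by apply: ler_sum => a _; exact: normc_Im.
apply: filterS2 H1 H2 => s; rewrite -Re_sum -Im_sum /csum.
move=> H1 H2; apply: (le_lt_trans (normc_ReIm _)).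
by move: H1 H2; case: (\sum_(a <- s) h a) => x y /=; lra.
Qed.

Lemma csum_unique A h M (l : Cplx R) :
  (forall s, subseq_of A s -> \sum_(a <- s) normc (h a) <= M) ->
  (fun s => \sum_(a <- s) h a) @ finsub A --> l -> csum A h = l.
Proof.
move=> /csum_cvg H1 H2; apply: cvg_unique H1 H2.
exact: norm_hausdorff.
Qed.

Lemma csum_finite A h s0 : subseq_of A s0 ->
  (forall a, A a -> a \notin s0 -> h a = 0) -> csum A h = \sum_(a <- s0) h a.
Proof.
move=> [u0 A0] h0.
apply: (@csum_unique _ _ (\sum_(a <- s0) normc (h a))) => [s [us sA]|].
  apply: (@le_trans _ _ (\sum_(a <- undup (s0 ++ s)) normc (h a))).
    apply: ler_sum_subset; rewrite ?undup_uniq//; last by move=> a; exact: normc_ge0.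
    by move=> a; rewrite mem_undup mem_cat => ->; rewrite orbT.
  rewrite (@sum_widen _ _ s0) ?undup_uniq//.
    by move=> a; rewrite mem_undup mem_cat => ->.
  move=> a; rewrite mem_undup mem_cat => /orP[->//|/sA Aa] /(h0 _ Aa) ->.
  by rewrite normc_zero.
apply: (cvg_trans (G := (fun=> \sum_(a <- s0) h a) @ finsub A)).
  apply: near_eq_cvg; exists s0 => // s [us sA] sub /=.
  by apply/esym/sum_widen => // a /sA; exact: h0.
exact: cvg_cst.
Qed.

(** The l^2-norm of [xi] on the fiber [G_u] is bounded through finite partial sums,
    so that no convergence statement is needed. *)
Definition fiber_bound (u : G) (c : R) (xi : G -> Cplx R) := forall s,
  subseq_of (sfiber u) s -> \sum_(a <- s) normc (xi a) ^+ 2 <= c ^+ 2.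

(** The inequality [2 x y <= l x^2 + y^2 / l] with weight [l = (c' + e) / (c + e)]; the perturbation
    [e] keeps [l] positive when a bound is zero, and is then made small. *)
Lemma finite_CS (T : Type) (s : seq T) (x y : T -> R) c c' :
  0 <= c -> 0 <= c' -> (forall a, 0 <= x a) -> (forall a, 0 <= y a) ->
  \sum_(a <- s) x a ^+ 2 <= c ^+ 2 -> \sum_(a <- s) y a ^+ 2 <= c' ^+ 2 ->
  \sum_(a <- s) x a * y a <= c * c'.
Proof.
move=> c0 c'0 x0 y0 xc yc.
have S0 z : 0 <= \sum_(a <- s) (z a) ^+ 2 :> R.
  by apply: sumr_ge0 => a _; exact: sqr_ge0.
have H e : 0 < e -> \sum_(a <- s) x a * y a <= (c + e) * (c' + e).
  move=> e0; have p : 0 < c + e by lra.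
  have q : 0 < c' + e by lra.
  pose l := (c' + e) / (c + e); have l0 : 0 < l by rewrite divr_gt0.
  have lE : l * (c + e) = c' + e by rewrite /l mulfVK// gt_eqF.
  apply: (@le_trans _ _ (\sum_(a <- s) ((l * x a ^+ 2 + l^-1 * y a ^+ 2) / 2))).
    apply: ler_sum => a _; have : 0 <= (l * x a - y a) ^+ 2 / (2 * l).
      by rewrite divr_ge0// ?sqr_ge0// mulr_ge0// ltW.
    rewrite (_ : _ / _ = (l * x a ^+ 2 + l^-1 * y a ^+ 2) / 2 - x a * y a);
      first by rewrite subr_ge0.
    by field; rewrite gt_eqF.
  rewrite -mulr_suml big_split /= -!mulr_sumr.
  have X : l * (\sum_(a <- s) x a ^+ 2) <= l * (c + e) ^+ 2.
    apply: ler_wpM2l; first exact: ltW.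
    by apply: le_trans xc _; rewrite ler_sqr ?nnegrE; lra.
  have Y : l^-1 * (\sum_(a <- s) y a ^+ 2) <= l^-1 * (c' + e) ^+ 2.
    apply: ler_wpM2l; first by rewrite invr_ge0 ltW.
    by apply: le_trans yc _; rewrite ler_sqr ?nnegrE; lra.
  have E1 : l * (c + e) ^+ 2 = (c + e) * (c' + e) by rewrite -lE; ring.
  have E2 : l^-1 * (c' + e) ^+ 2 = (c + e) * (c' + e).
    by rewrite -lE; field; rewrite gt_eqF.
  rewrite E1 in X; rewrite E2 in Y; lra.
rewrite leNgt; apply/negP => lt; set S := \sum_(a <- s) _ in H lt.
pose D := S - c * c'; have D0 : 0 < D by rewrite subr_gt0.
pose m := c + c' + 1; have m0 : 0 < m by rewrite /m; lra.
(* The excess [(c + e) (c' + e) - c c' = e (c + c' + e)] is at most [e m], as [e <= 1], hence at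
   most [D / 2]. *)
pose e := Order.min 1 (D / (2 * m)).
have e0 : 0 < e by rewrite lt_min ltr01 divr_gt0// mulr_gt0.
have e1 : e <= 1 by rewrite ge_min lexx.
have e2 : e * m <= D / 2.
  rewrite -ler_pdivlMr//; rewrite (_ : D / 2 / m = D / (2 * m)).
    by rewrite ge_min lexx orbT.
  by field; rewrite gt_eqF.
have := H e e0; rewrite /D /m in e2 *.
have : e * e <= e by rewrite ler_piMr// ltW.
rewrite mulrDl !mulrDr; rewrite /D in D0 *; lra.
Qed.

Section Fiber.
Variable u : G.
Implicit Types (xi eta x y z : G -> Cplx R) (c : R).

Lemma fiber_bound_le c c' x : 0 <= c -> c <= c' -> fiber_bound u c x ->
  fiber_bound u c' x.
Proof.
move=> c0 cc H s /H/le_trans; apply; rewrite ler_sqr ?nnegrE//.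
exact: le_trans cc.
Qed.

Lemma fiber_boundD c c' x y : 0 <= c -> 0 <= c' -> fiber_bound u c x ->
  fiber_bound u c' y ->
  fiber_bound u (c + c') (fun a => x a + y a).
Proof.
move=> c0 c'0 Hx Hy s sA; have X := Hx _ sA; have Y := Hy _ sA.
have Z := finite_CS c0 c'0 (fun a => normc_ge0 (x a)) (fun a => normc_ge0 (y a)) X Y.
apply: (@le_trans _ _ (\sum_(a <- s) (normc (x a) ^+ 2 +
    (2 * (normc (x a) * normc (y a)) + normc (y a) ^+ 2)))).
  apply: ler_sum => a _; rewrite (_ : _ + _ = (normc (x a) + normc (y a)) ^+ 2).
    by rewrite ler_sqr ?nnegrE ?normcD_le ?addr_ge0 ?normc_ge0.
  by ring.
rewrite !big_split /= -mulr_sumr sqrrD; lra.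
Qed.

Lemma fiber_boundZ c k x : fiber_bound u c x ->
  fiber_bound u (normc k * c) (fun a => k * x a).
Proof.
move=> H s /H le; under eq_bigr do rewrite normc_mul exprMn.
by rewrite -mulr_sumr exprMn ler_wpM2l// sqr_ge0.
Qed.

Lemma fiber_bound_normc c x a : 0 <= c -> fiber_bound u c x -> gsource a = u ->
  normc (x a) <= c.
Proof.
move=> c0 H au; apply: normc_le => //.
have := H [:: a]; rewrite big_seq1; apply; split=> // b.
by rewrite mem_seq1 => /eqP ->.
Qed.

Lemma fiber_bound_inner_sum c c' x y s : 0 <= c -> 0 <= c' -> fiber_bound u c x ->
  fiber_bound u c' y ->
  subseq_of (sfiber u) s ->
  \sum_(a <- s) normc (conjc (x a) * y a : Cplx R) <= c * c'.
Proof.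
move=> c0 c'0 Hx Hy sA; under eq_bigr do rewrite normc_mul normc_conj.
by apply: finite_CS => //; [move=> a; exact: normc_ge0..|exact: Hx|exact: Hy].
Qed.

Definition l2 x := exists2 c, 0 <= c & fiber_bound u c x.

Lemma l2D x y : l2 x -> l2 y -> l2 (fun a => x a + y a).
Proof.
by move=> [c c0 H] [c' c'0 H']; exists (c + c'); [exact: addr_ge0|exact: fiber_boundD].
Qed.

Lemma l2Z k x : l2 x -> l2 (fun a => k * x a).
Proof.
move=> [c c0 H]; exists (normc k * c); last exact: fiber_boundZ.
by rewrite mulr_ge0// normc_ge0.
Qed.

Lemma inner_cvg x y : l2 x -> l2 y ->
  (fun s => \sum_(a <- s) (conjc (x a) * y a : Cplx R)) @ finsub (sfiber u) -->
    inner x y u.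
Proof.
move=> [c c0 Hx] [c' c'0 Hy]; apply: (@csum_cvg _ _ (c * c')) => s sA.
exact: fiber_bound_inner_sum.
Qed.

Lemma inner_unique x y (l : Cplx R) : l2 x -> l2 y ->
  (fun s => \sum_(a <- s) (conjc (x a) * y a : Cplx R)) @ finsub (sfiber u) --> l ->
  inner x y u = l.
Proof.
move=> hx hy H; apply: cvg_unique (inner_cvg hx hy) H.
exact: norm_hausdorff.
Qed.

Lemma innerD x y z : l2 x -> l2 y -> l2 z ->
  inner x (fun a => y a + z a) u = inner x y u + inner x z u.
Proof.
move=> hx hy hz; apply: inner_unique => //; first exact: l2D.
rewrite (_ : (fun s => _) = (fun s => \sum_(a <- s) (conjc (x a) * y a : Cplx R) +
    \sum_(a <- s) (conjc (x a) * z a : Cplx R))).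
  by apply: cvgcD; exact: inner_cvg.
by apply/funext => s; rewrite -big_split; apply: eq_bigr => a _; rewrite mulrDr.
Qed.

Lemma innerZ x y k : l2 x -> l2 y ->
  inner x (fun a => k * y a) u = k * inner x y u.
Proof.
move=> hx hy; apply: inner_unique => //; first exact: l2Z.
rewrite (_ : (fun s => _) = (fun s => k * \sum_(a <- s) (conjc (x a) * y a : Cplx R))).
  by apply: cvgcM; [exact: cvg_cst|exact: inner_cvg].
by apply/funext => s; rewrite mulr_sumr; apply: eq_bigr => a _; rewrite mulrCA.
Qed.

Lemma innerC x y : l2 x -> l2 y -> inner y x u = conjc (inner x y u).
Proof.
move=> hx hy; apply: inner_unique => //.
rewrite (_ : (fun s => _) =
    (fun s => conjc (\sum_(a <- s) (conjc (x a) * y a : Cplx R)) : Cplx R)).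
  by apply: cvg_comp (inner_cvg hx hy) _; exact: continuous_conjc.
apply/funext => s; rewrite conjc_sum; apply: eq_bigr => a _.
by rewrite conjc_mul conjc_involutive mulrC.
Qed.

Lemma innerB x y z : l2 x -> l2 y -> l2 z ->
  inner x (fun a => y a - z a) u = inner x y u - inner x z u.
Proof.
move=> hx hy hz; rewrite (_ : (fun a => _) = (fun a => y a + (-1) * z a)).
  by rewrite innerD ?innerZ ?mulN1r//; exact: l2Z.
by apply/funext => a; rewrite mulN1r.
Qed.

Lemma innerDl x y z : l2 x -> l2 y -> l2 z ->
  inner (fun a => y a + z a) x u = inner y x u + inner z x u.
Proof.
move=> hx hy hz; rewrite innerC ?innerD//; last exact: l2D.
by rewrite conjc_add -!innerC.
Qed.

Lemma innerZl x y k : l2 x -> l2 y ->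
  inner (fun a => k * y a) x u = conjc k * inner y x u.
Proof.
move=> hx hy; rewrite innerC ?innerZ//; last exact: l2Z.
by rewrite conjc_mul -!innerC.
Qed.

Lemma innerBl x y z : l2 x -> l2 y -> l2 z ->
  inner (fun a => y a - z a) x u = inner y x u - inner z x u.
Proof.
move=> hx hy hz; rewrite (_ : (fun a => _) = (fun a => y a + (-1) * z a)).
  rewrite innerDl ?innerZl//; last exact: l2Z.
  by rewrite conjc_opp conjc_one mulN1r.
by apply/funext => a; rewrite mulN1r.
Qed.

Lemma inner_CS c c' x y : 0 <= c -> 0 <= c' -> fiber_bound u c x ->
  fiber_bound u c' y ->
  normc (inner x y u) <= c * c'.
Proof.
move=> c0 c'0 Hx Hy.
have hx : l2 x by exists c.
have hy : l2 y by exists c'.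
have H : (fun s => normc (\sum_(a <- s) (conjc (x a) * y a : Cplx R))) @
    finsub (sfiber u) --> normc (inner x y u).
  by apply: cvg_comp (inner_cvg hx hy) _; exact: continuous_normc.
apply: (cvgr_to_le H); apply: filterS (finsub_self (sfiber u)) => s sA.
exact: le_trans (normc_sum _ _) (fiber_bound_inner_sum c0 c'0 Hx Hy sA).
Qed.

(** The number [q] is the norm of [x] on the fibre: it is the least fibre bound, and its square is
    the inner product. *)
Lemma inner_self x : l2 x -> exists2 q : R, 0 <= q &
  inner x x u = (q ^+ 2)%:C%C /\ forall c, 0 <= c -> (fiber_bound u c x <-> q <= c).
Proof.
move=> hx; have cv := inner_cvg hx hx.
have E s : \sum_(a <- s) (conjc (x a) * x a : Cplx R) =
    (\sum_(a <- s) normc (x a) ^+ 2)%:C%C.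
  elim: s => [|a s IH]; first by rewrite !big_nil.
  by rewrite !big_cons IH conj_mulE -realcD.
have Hr : (fun s => \sum_(a <- s) normc (x a) ^+ 2) @ finsub (sfiber u) -->
    complex.Re (inner x x u).
  rewrite (_ : (fun s => _) =
    (fun s => complex.Re (\sum_(a <- s) (conjc (x a) * x a : Cplx R)))).
    by apply: cvg_comp cv _; exact: continuous_Re.
  by apply/funext => s; rewrite E.
have Hi : complex.Im (inner x x u) = 0.
  have : (fun s => complex.Im (\sum_(a <- s) (conjc (x a) * x a : Cplx R))) @
      finsub (sfiber u) --> complex.Im (inner x x u).
    by apply: cvg_comp cv _; exact: continuous_Im.
  rewrite (_ : (fun s => _) = cst 0); last by apply/funext => s; rewrite E.
  move=> H; apply: cvg_unique H (cvg_cst _); exact: norm_hausdorff.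
have r0 : 0 <= complex.Re (inner x x u).
  apply: (cvgr_to_ge Hr); apply: filterS (finsub_self (sfiber u)) => s _.
  by apply: sumr_ge0 => a _; exact: sqr_ge0.
exists (Num.sqrt (complex.Re (inner x x u))); first exact: sqrtr_ge0.
split.
  rewrite sqr_sqrtr//; case: (inner x x u) Hi => a b /= ->; by [].
move=> c c0; rewrite -(ler_sqr (sqrtr_ge0 _)) ?nnegrE// sqr_sqrtr//.
split=> [H|le s sA].
  by apply: (cvgr_to_le Hr); exact: filterS H (finsub_self (sfiber u)).
apply: le_trans le; apply: (cvgr_to_ge Hr).
have [us _] := sA; exists s => // s' [us' _] sub.
by apply: ler_sum_subset => // a; exact: sqr_ge0.
Qed.

Lemma inner_finite x y s0 : subseq_of (sfiber u) s0 ->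
  (forall a, gsource a = u -> a \notin s0 -> x a = 0 \/ y a = 0) ->
  inner x y u = \sum_(a <- s0) conjc (x a) * y a.
Proof.
move=> sA H; apply: csum_finite => // a /H{}H /H[] ->.
  by rewrite conjc_zero mul0r.
by rewrite mulr0.
Qed.

End Fiber.

Definition unif_bound (c : R) (xi : G -> Cplx R) := forall u, fiber_bound u c xi.

Lemma module_norm_leP c (xi : G -> Cplx R) : 0 <= c ->
  (module_norm xi <= c%:E)%E <-> unif_bound c xi.
Proof.
move=> c0; have h0 a : 0 <= normc (xi a) ^+ 2 by exact: sqr_ge0.
have S u : (sqrte (\esum_(a in sfiber u) (normc (xi a) ^+ 2)%:E) <= c%:E)%E <->
    fiber_bound u c xi.
  have -> : c%:E = sqrte (c ^+ 2)%:E by rewrite /= sqrtr_sqr ger0_norm.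
  rewrite lee_sqrt ?lee_fin ?sqr_ge0//; exact: esum_leP.
split=> [H u s sA|H].
  (* [module_norm] only ranges over units, but a fibre containing some arrow [b] lies over the unit
     [gsource b]. *)
  case: s sA => [|b s] sA; first by rewrite big_nil sqr_ge0.
  apply: (iffLR (S u)) => //; apply: le_trans H.
  apply: ereal_sup_ubound; left; exists u => //.
  have [_ /(_ b)] := sA; rewrite mem_head => /(_ isT) <-.
  exact: unit_gsource.
apply: ge_ereal_sup => _ [[u _ <-]|->]; first exact/S/H.
by rewrite lee_fin.
Qed.

Lemma module_norm_ge0 (xi : G -> Cplx R) : (0 <= module_norm xi)%E.
Proof. by apply: ereal_sup_ubound; right. Qed.

Lemma module_norm_lt c (xi : G -> Cplx R) : (module_norm xi < c%:E)%E ->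
  unif_bound c xi.
Proof.
move=> H; apply/module_norm_leP; last exact: ltW.
by rewrite -lee_fin; apply: le_trans (ltW H); exact: module_norm_ge0.
Qed.

Implicit Types (x y z xi eta : G -> Cplx R) (c r : R).

Lemma unif_bound_le c c' x : 0 <= c -> c <= c' -> unif_bound c x -> unif_bound c' x.
Proof. by move=> c0 cc H u; exact: fiber_bound_le (H u). Qed.

Lemma unif_boundD c c' x y : 0 <= c -> 0 <= c' -> unif_bound c x -> unif_bound c' y ->
  unif_bound (c + c') (fun a => x a + y a).
Proof. by move=> c0 c0' Hx Hy u; exact: fiber_boundD. Qed.

Lemma unif_boundZ c k x : unif_bound c x -> unif_bound (normc k * c) (fun a => k * x a).
Proof. by move=> H u; exact: fiber_boundZ. Qed.

Lemma unif_boundN c x : unif_bound c x -> unif_bound c (fun a => - x a).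
Proof.
by move=> H u s /H; under [X in _ -> X <= _]eq_bigr do rewrite normc_opp.
Qed.

Lemma unif_boundB c c' x y : 0 <= c -> 0 <= c' -> unif_bound c x -> unif_bound c' y ->
  unif_bound (c + c') (fun a => x a - y a).
Proof. by move=> c0 c0' Hx Hy; apply: unif_boundD => //; exact: unif_boundN. Qed.

Lemma unif_bound_normc c x a : 0 <= c -> unif_bound c x -> normc (x a) <= c.
Proof. by move=> c0 H; exact: fiber_bound_normc (H (gsource a)) _. Qed.

Lemma mb0_eq x : unif_bound 0 x -> x = fun=> 0.
Proof.
move=> H; apply/funext => a; apply/eqP; rewrite -normc_eq0 eq_le normc_ge0 andbT.
exact: unif_bound_normc.
Qed.

Lemma unif_bound_zero c : unif_bound c (fun=> 0).
Proof.
move=> u s _; rewrite big1 ?sqr_ge0// => a _.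
by rewrite normc_zero expr0n.
Qed.

(** Only finite partial sums occur in [unif_bound], so it passes to limits taken arrow by arrow. *)
Lemma unif_bound_lim c (xs : nat -> G -> Cplx R) x : (forall k, unif_bound c (xs k)) ->
  (forall a, (fun k => xs k a) @ \oo --> x a) -> unif_bound c x.
Proof.
move=> H cv u s sA.
have : (fun k => \sum_(a <- s) normc (xs k a) ^+ 2) @ \oo -->
    \sum_(a <- s) normc (x a) ^+ 2.
  elim: (s) => [|a l IH].
    under eq_fun do rewrite big_nil; rewrite big_nil; exact: cvg_cst.
  rewrite big_cons (_ : (fun k => _) = (fun k => normc (xs k a) ^+ 2 +
    \sum_(a <- l) normc (xs k a) ^+ 2)); last first.
    by apply/funext => k; rewrite big_cons.
  apply: cvgD => //; apply: cvgM; apply: cvg_comp (cv a) _;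
  exact: continuous_normc.
move=> cvs; apply: (cvgr_to_le cvs); apply: nearW => k; exact: (H k u s sA).
Qed.

Lemma hmodP xi : hmod xi <->
  forall e, 0 < e -> exists2 eta, Cc eta & unif_bound e (fun a => xi a - eta a).
Proof.
split=> H e e0.
  by have [eta Ce /module_norm_lt ?] := H e e0; exists eta.
have e20 : 0 < e / 2 by rewrite divr_gt0.
have [eta Ce He] := H _ e20; exists eta => //.
apply: (@le_lt_trans _ _ (e / 2)%:E); last by rewrite lte_fin; lra.
by apply/module_norm_leP; rewrite ?ltW.
Qed.

End FiberSums.

(** * Length balls and continuity of convolution *)

Section MainProof.
Variables (R : realType) (G : groupoid) (ell : G -> R).
Hypothesis ell_length : length_function ell.
Hypothesis ell_proper : proper_length ell.
Hypothesis ell_fibers : bounded_fibers ell.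
Hypothesis G_etale : etale G.
Hypothesis units_open : open (@units G).
Implicit Types (a b m p u : G) (t : R).

Lemma ell_ge0 a : 0 <= ell a. Proof. by case: ell_length. Qed.
Lemma ellV a : ell (ginv a) = ell a. Proof. by case: ell_length. Qed.
Lemma ell_unit u : units u -> ell u = 0.
Proof. by case: ell_length => _ _ /(_ u)[_ +] _ _. Qed.
Lemma ell_gt0 a : ~ units a -> 0 < ell a.
Proof.
case: ell_length => _ _ /(_ a)[H _] _ _ aU; rewrite lt_neqAle ell_ge0 andbT.
by apply/eqP => /esym/H.
Qed.
Lemma ellM a b : gsource a = grange b -> ell (gmul a b) <= ell a + ell b.
Proof. by case: ell_length => _ _ _ _ H /composableE; exact: H. Qed.
Lemma continuous_ell : continuous ell. Proof. by case: ell_length. Qed.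

Lemma ell_div_sym a m : gsource m = gsource a ->
  ell (gmul m (ginv a)) = ell (gmul a (ginv m)).
Proof. by move=> ma; rewrite -ellV ginv_div. Qed.

Lemma ell_div_le a m : gsource m = gsource a ->
  `|ell a - ell m| <= ell (gmul a (ginv m)).
Proof.
move=> ma; rewrite ler_distl lerBlDr -lerBlDl.
have H x y : gsource y = gsource x -> ell x <= ell (gmul x (ginv y)) + ell y.
  by move=> yx; rewrite -{1}(gdivK yx); apply: ellM; exact: gsource_div.
have := H _ _ ma; have := H _ _ (esym ma); rewrite (ell_div_sym ma).
by move=> ? ?; apply/andP; split; lra.
Qed.

Definition fball t u : seq G :=
  enum_fset (fset_set (lball ell t `&` sfiber u)).

Lemma fball_uniq t u : uniq (fball t u).
Proof. exact: fset_uniq. Qed.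

Lemma mem_fball t u a : 0 <= t -> units u ->
  a \in fball t u <-> ell a <= t /\ gsource a = u.
Proof.
move=> t0 uu; have [F _ /(_ _ uu) cF] := ell_fibers t0.
have fin : finite_set (lball ell t `&` sfiber u).
  by apply/finite_set_leP; exists F.
rewrite /fball in_fset_set// inE; split=> [[]//|[]]; split => //.
Qed.

Lemma size_fball t : 0 <= t -> exists F : nat, forall u, units u ->
  (size (fball t u) <= F)%N.
Proof.
move=> t0; have [F _ cF] := ell_fibers t0; exists F => u uu.
exact: geq_card_fset_set (cF _ uu).
Qed.

(** The ball of radius [t] about [a] in its source fibre for the distance [ell (a m^-1)]. Right
    translation by [a] carries the length ball over [grange a] onto it, which makes its cardinality
    bounded uniformly in [a]. *)
Definition nbr t a : seq G := [seq gmul b a | b <- fball t (grange a)].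

Lemma mem_nbr t a m : 0 <= t ->
  m \in nbr t a <-> gsource m = gsource a /\ ell (gmul a (ginv m)) <= t.
Proof.
move=> t0; split=> [/mapP[b /(mem_fball _ t0 (unit_grange a))[bt ba] ->]|].
  have E : gsource (gmul b a) = gsource a by exact: gsourceM.
  by split=> //; rewrite -ell_div_sym// gmulK.
move=> [ma mt]; apply/mapP; exists (gmul m (ginv a)).
  apply/(mem_fball _ t0 (unit_grange a)); rewrite ell_div_sym//.
  by split=> //; rewrite gsource_div.
by rewrite gdivK.
Qed.

Lemma nbr_uniq t a : 0 <= t -> uniq (nbr t a).
Proof.
move=> t0; rewrite map_inj_in_uniq ?fball_uniq// => x y.
move=> /(mem_fball _ t0 (unit_grange a))[_ xa].
move=> /(mem_fball _ t0 (unit_grange a))[_ ya] E.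
by rewrite -(gmulK xa) -(gmulK ya) E.
Qed.

Lemma nbr_sym t a m : 0 <= t -> (m \in nbr t a) = (a \in nbr t m).
Proof.
move=> t0; apply/idP/idP => /(mem_nbr _ _ t0)[E H]; apply/(mem_nbr _ _ t0).
  by rewrite ell_div_sym.
by rewrite ell_div_sym.
Qed.

Lemma size_nbr t : 0 <= t -> exists F : nat, forall a, (size (nbr t a) <= F)%N.
Proof.
move=> /size_fball[F H]; exists F => a; rewrite size_map; apply: H.
exact: unit_grange.
Qed.

Lemma closed_lball t : closed (lball ell t).
Proof.
have -> : lball ell t = ell @^-1` [set x | x <= t] by [].
by apply: closed_comp; [move=> x _; exact: continuous_ell|exact: closed_le].
Qed.

(** Length balls are closed, and compact by properness; for negative [t] the function is zero.
    Together with [Cc_elim] this replaces compact supports by bounds on [ell]. *)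
Lemma Cc_intro (f : G -> Cplx R) t : continuous f ->
  (forall a, f a != 0 -> ell a <= t) -> Cc f.
Proof.
move=> cf ft; split=> //.
have sub : closure [set a | f a != 0] `<=` lball ell t.
  rewrite [X in _ `<=` X](_ : _ = closure (lball ell t)).
    exact: closureS.
  exact/closure_id/closed_lball.
have [t0|t0] := leP 0 t.
  exact: subclosed_compact (@closed_closure _ _) (ell_proper t0) sub.
rewrite (_ : closure _ = set0); first exact: compact0.
rewrite -subset0 => a /sub; rewrite /lball /= => /le_lt_trans/(_ t0).
by rewrite ltNge ell_ge0.
Qed.

Lemma compact_real_bound (D : set G) (g : G -> R) : compact D -> continuous g ->
  exists2 M, 0 <= M & forall a, D a -> g a <= M.
Proof.
move=> cD cg.
have : compact (g @` D).
  by apply: continuous_compact => //; exact: continuous_subspaceT.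
move=> /compact_bounded [M [_ H]]; exists (`|M| + 1); first by rewrite addr_ge0.
move=> a Da; apply: le_trans (ler_norm _) _; apply: H; last by exists a.
by rewrite (le_lt_trans (ler_norm M))// ltrDl.
Qed.

Lemma Cc_elim (f : G -> Cplx R) : Cc f -> exists c t,
  [/\ 0 <= c, 0 <= t, continuous f, forall a, normc (f a) <= c
    & forall a, f a != 0 -> ell a <= t].
Proof.
move=> [cf cD].
have cn : continuous (fun a => normc (f a)).
  move=> a; apply: (@continuous_comp _ _ _ f (fun x : Cplx R => normc x)) => //;
    [exact: cf|exact: (@continuous_normc R (f a))].
have [c c0 Hc] := compact_real_bound cD cn.
have [t t0 Ht] := compact_real_bound cD continuous_ell.
exists c, t; split=> // a.
  by have [->|fa] := eqVneq (f a) 0; [rewrite normc_zero|apply/Hc/subset_closure].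
by move=> fa; apply/Ht/subset_closure.
Qed.

(** Near [a0], every point of [G_(s a0)] of length at most [t] moves along a local
    section of the source map, and by compactness there are no other points of that
    length in the nearby fibers. *)
Lemma fiber_sum_cvg (h : G -> G -> Cplx R) t a0 : 0 <= t ->
  (forall a m, gsource m = gsource a -> h a m != 0 -> ell m <= t) ->
  (forall m0 (sg : G -> G), gsource m0 = gsource a0 -> sg @ a0 --> m0 ->
     (\forall a \near a0, gsource (sg a) = gsource a) ->
     (fun a => h a (sg a)) @ a0 --> h a0 m0) ->
  (fun a => \sum_(m \in sfiber (gsource a)) h a m) @ a0 -->
    \sum_(m \in sfiber (gsource a0)) h a0 m.
Proof.
move=> t0 supp hc; pose L := fball t (gsource a0).
have LP m : m \in L <-> ell m <= t /\ gsource m = gsource a0.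
  by apply: mem_fball => //; exact: unit_gsource.
have /choice[US USP] : forall m, exists USm : set G * (G -> G),
    [/\ open USm.1, USm.1 m, {in USm.1 &, injective (@gsource G)}
    & forall a0, gsource m = gsource a0 ->
      (\forall a \near a0, USm.1 (USm.2 a) /\ gsource (USm.2 a) = gsource a) /\
      USm.2 @ a0 --> m].
  by move=> m; have [U [sg H]] := source_section G_etale m; exists (U, sg).
pose U m := (US m).1; pose sg m := (US m).2.
have sgU : \forall a \near a0, forall m, m \in L ->
    U m (sg m a) /\ gsource (sg m a) = gsource a.
  apply: near_seq => m /LP[_ ma]; have [_ _ _ /(_ _ ma)[]] := USP m.
  by move=> + _.
have sgc m : m \in L -> sg m @ a0 --> m.
  by move=> /LP[_ ma]; have [_ _ _ /(_ _ ma)[]] := USP m.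
have sgN : \forall a \near a0, forall m, m \in L -> forall n, n \in L ->
    m != n -> sg m a <> sg n a.
  apply: near_seq => m mL; apply: near_seq => n nL.
  have [->|mn] := eqVneq m n; first exact: filterE.
  have := @arrow_hausdorff G; rewrite open_hausdorff => /(_ _ _ mn)[[A B] /=].
  rewrite !inE => -[Am Bn] [oA oB AB].
  have : \forall a \near a0, A (sg m a).
    exact: sgc _ mL _ (open_nbhs_nbhs (conj oA Am)).
  have : \forall a \near a0, B (sg n a).
    exact: sgc _ nL _ (open_nbhs_nbhs (conj oB Bn)).
  apply: filterS2 => a /= Ba Aa _ E.
  by have : (A `&` B) (sg m a); [split=> //; rewrite E|rewrite AB].
have cover : \forall a \near a0, forall m, gsource m = gsource a ->
    ell m <= t -> exists2 n, n \in L & U n m.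
  pose D := lball ell t `\` \bigcup_(n in [set` L]) U n.
  have cD : compact D.
    apply: (subclosed_compact _ (ell_proper t0)); last by move=> x [].
    apply: closedI; first exact: closed_lball.
    by apply: open_closedC; apply: bigcup_open => n _; have [] := USP n.
  have cD' : closed (@gsource G @` D).
    apply: compact_closed; first exact: arrow_hausdorff.
    apply: continuous_compact => //.
    exact: (continuous_subspaceT (@continuous_gsource G)).
  have nD : (~` (@gsource G @` D)) (gsource a0).
    move=> [x [xt nx] xa]; apply: nx; exists x; first exact/LP.
    by have [] := USP x.
  have : \forall a \near a0, (~` (@gsource G @` D)) (gsource a).
    exact: continuous_gsource (open_nbhs_nbhs (conj (closed_openC cD') nD)).
  apply: filterS => a na m ma mt.
  have : ~ D m by move=> Dm; apply: na; exists m.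
  by move=> /not_andP[//|/contrapT [n nL Um]]; exists n.
have -> : \sum_(m \in sfiber (gsource a0)) h a0 m = \sum_(m <- L) h a0 m.
  apply: fsbig_list; [exact: fball_uniq|by move=> a /LP[]|].
  move=> m ma /negP mL; apply/eqP/negP => /negP/(supp _ _ ma) mt.
  by apply: mL; apply/LP.
have E : \forall a \near a0, \sum_(m <- L) h a (sg m a) =
    \sum_(m \in sfiber (gsource a)) h a m.
  near=> a.
  rewrite (@fsbig_list _ _ _ [seq sg m a | m <- L]) ?big_map//.
  - rewrite map_inj_in_uniq ?fball_uniq// => m n mL nL E; apply/eqP/negP.
    by move/negP => mn; move: E; apply: (near sgN a).
  - by move=> _ /mapP[m mL ->]; have [] := near sgU a _ _ mL.
  - move=> m ma /negP nm; apply/eqP/negP => /negP/(supp _ _ ma) mt.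
    have [//|n nL Um] := near cover a _ m ma mt.
    apply: nm; apply/mapP; exists n => //.
    have [//|Us ss] := near sgU a _ _ nL.
    by have [_ _ inj _] := USP n; apply: inj; rewrite ?inE// ss.
apply: cvg_trans (near_eq_cvg E) _; apply: cvgc_sum => m mL.
have [_ ma] := iffLR (LP m) mL.
by apply: hc => //; [exact: sgc|apply: filterS sgU => a /(_ _ mL)[]].
Unshelve. all: by end_near. Qed.

Lemma lreg_Cc (f xi : G -> Cplx R) :
  Cc f -> Cc xi -> Cc (lreg f xi).
Proof.
move=> /Cc_elim[c1 [t1 [_ t10 cf _ ft]]] /Cc_elim[c2 [t2 [_ t20 cx _ xt]]].
apply: (@Cc_intro _ (t1 + t2)).
  move=> a0; apply: (@fiber_sum_cvg (fun a m => f (gmul a (ginv m)) * xi m) t2) => //.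
    by move=> a m _; rewrite mulf_eq0 negb_or => /andP[_ /xt].
  move=> m0 sg ma sgm sga; apply: cvgcM; last first.
    by apply: cvg_comp sgm _; exact: cx.
  apply: cvg_comp; last exact: cf.
  apply: gmul_cvg; first exact: cvg_id.
  - by apply: cvg_comp sgm _; exact: ginv_continuous.
  - by apply/composableE; rewrite grangeV.
  - by apply: filterS sga => a sga; apply/composableE; rewrite grangeV.
move=> a; apply: contraNT => at12; apply/eqP; apply: fsbig1 => m ma.
apply/eqP; rewrite mulf_eq0; apply: contraNT at12.
rewrite negb_or => /andP[/ft H1 /xt H2]; rewrite -(gdivK ma).
by rewrite (le_trans (ellM (gsource_div ma)))// lerD.
Qed.

Lemma CcD (f g : G -> Cplx R) : Cc f -> Cc g -> Cc (fun a => f a + g a).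
Proof.
move=> /Cc_elim[c1 [t1 [_ t10 cf _ ft]]] /Cc_elim[c2 [t2 [_ t20 cx _ xt]]].
apply: (@Cc_intro _ (Num.max t1 t2)).
  by move=> a; apply: cvgcD; [exact: cf|exact: cx].
move=> a; apply: contraNT; rewrite le_max negb_or -!ltNge => /andP[l1 l2].
have -> : f a = 0 by apply/eqP; apply: contraTT l1 => /ft; rewrite -leNgt.
have -> : g a = 0 by apply/eqP; apply: contraTT l2 => /xt; rewrite -leNgt.
by rewrite addr0.
Qed.

Lemma Cc_mul (g f : G -> Cplx R) : continuous g -> Cc f -> Cc (fun a => g a * f a).
Proof.
move=> cg /Cc_elim[c1 [t1 [_ t10 cf _ ft]]]; apply: (@Cc_intro _ t1).
  by move=> a; apply: cvgcM; [exact: cg|exact: cf].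
by move=> a; rewrite mulf_eq0 negb_or => /andP[_ /ft].
Qed.

Lemma CcZ (k : Cplx R) (f : G -> Cplx R) : Cc f -> Cc (fun a => k * f a).
Proof. by apply: Cc_mul => a; exact: cvg_cst. Qed.

Lemma CcB (f g : G -> Cplx R) : Cc f -> Cc g -> Cc (fun a => f a - g a).
Proof.
move=> Cf Cg; rewrite (_ : (fun a => _) = (fun a => f a + (-1) * g a)).
  by apply: CcD => //; exact: CcZ.
by apply/funext => a; rewrite mulN1r.
Qed.

Lemma Cc0 : Cc ((fun=> 0) : G -> Cplx R).
Proof.
by apply: (@Cc_intro _ 0) => [a|a]; [exact: cvg_cst|rewrite eqxx].
Qed.

Lemma Cc_star (f : G -> Cplx R) : Cc f -> Cc (gstar f).
Proof.
move=> /Cc_elim[c1 [t1 [_ t10 cf _ ft]]]; apply: (@Cc_intro _ t1).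
  move=> a; apply: (@continuous_comp _ _ _ (fun a => f (ginv a)) (fun x :
    Cplx R => conjc x : Cplx R)).
    by apply: (@continuous_comp _ _ _ (@ginv G)); [exact: ginv_continuous|exact: cf].
  exact: continuous_conjc.
move=> a; rewrite /gstar -normc_eq0 normc_conj normc_eq0 => /ft.
by rewrite ellV.
Qed.

Lemma unitsE a : units a <-> ell a = 0.
Proof. by case: ell_length => _ _ /(_ a)[A B] _ _; split. Qed.

Lemma gunitE a : gunit a = (`[< units a >])%:R :> Cplx R.
Proof.
by rewrite /gunit indicE.
Qed.

Lemma gunit1 a : units a -> gunit a = 1 :> Cplx R.
Proof. by move=> /asboolT U; rewrite gunitE U. Qed.

Lemma gunit0 a : ~ units a -> gunit a = 0 :> Cplx R.
Proof. by move=> /asboolF U; rewrite gunitE U. Qed.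

Lemma units_closed : closed (@units G).
Proof.
rewrite (_ : @units G = lball ell 0); first exact: closed_lball.
apply/seteqP; split=> [a /unitsE a0|a a0]; first by rewrite /lball /= a0.
by apply/unitsE/eqP; rewrite eq_le ell_ge0 andbT.
Qed.

(** The unit space is open, and closed as the zero set of [ell], so its indicator is continuous. *)
Lemma Cc_gunit : Cc (gunit : G -> Cplx R).
Proof.
apply: (@Cc_intro _ 0) => a.
  have [U|U] := pselect (units a).
    apply: (cvg_trans (G := (fun=> 1 : Cplx R) @ a)); last first.
      by rewrite gunit1//; exact: cvg_cst.
    apply: near_eq_cvg; apply: filterS (open_nbhs_nbhs (conj units_open U)) => b Ub.
    by rewrite gunit1.
  apply: (cvg_trans (G := (fun=> 0 : Cplx R) @ a)); last first.
    by rewrite gunit0//; exact: cvg_cst.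
  have := open_nbhs_nbhs (conj (closed_openC units_closed) U).
  move=> nU; apply: near_eq_cvg; apply: filterS nU => b Ub.
  by rewrite gunit0.
have [U _|U] := pselect (units a); first by rewrite ell_unit.
by rewrite gunit0// eqxx.
Qed.

Lemma unif_bound_gunit : unif_bound 1 (gunit : G -> Cplx R).
Proof.
move=> u s [us su].
have -> : \sum_(a <- s) normc (gunit a : Cplx R) ^+ 2 =
    \sum_(a <- [seq x <- s | x == u]) normc (gunit a : Cplx R) ^+ 2.
  rewrite big_filter [RHS]big_mkcond /= big_seq [RHS]big_seq;
    apply: eq_bigr => a /su sa.
  have [//|au] := eqVneq a u; rewrite gunit0 ?normc_zero ?expr0n// => U.
  by move: au; rewrite -sa gsource_unit// eqxx.
rewrite expr1n (@le_trans _ _ (\sum_(a <- [seq x <- s | x == u]) 1))//.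
  apply: ler_sum => a _; rewrite gunitE.
  by case: asbool; rewrite ?normc_one ?normc_zero ?expr1n ?expr0n.
rewrite big_const_seq iter_addr_0 -(mulr1n 1) ler_nat.
rewrite count_predT size_filter -/(count_mem u s) count_uniq_mem//.
by case: (u \in s).
Qed.

Lemma Cc_mb (f : G -> Cplx R) : Cc f -> exists2 c, 0 <= c & unif_bound c f.
Proof.
move=> /Cc_elim[c [t [c0 t0 _ fc ft]]]; have [F HF] := size_fball t0.
(* The sum of squares is at most [c^2 F]; since [F <= (F + 1)^2], no square root is needed. *)
exists (c * F.+1%:R); first by rewrite mulr_ge0.
move=> u [|b s] [us su]; first by rewrite big_nil sqr_ge0.
have Uu : units u by rewrite -(su b (mem_head _ _)); exact: unit_gsource.
pose L := fball t u.
apply: (@le_trans _ _ (\sum_(a <- undup ((b :: s) ++ L)) normc (f a) ^+ 2)).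
  apply: ler_sum_subset; rewrite ?undup_uniq//; last by move=> a; exact: sqr_ge0.
  by move=> a aS; rewrite mem_undup mem_cat aS.
rewrite (@sum_widen _ _ L) ?undup_uniq ?fball_uniq//; first last.
- move=> a; rewrite mem_undup mem_cat => /orP[/su ua /negP aL|->//].
  have [->|/ft at_] := eqVneq (f a) 0; first by rewrite normc_zero expr0n.
  by exfalso; apply: aL; apply/(mem_fball _ t0 Uu).
- by move=> a aL; rewrite mem_undup mem_cat aL orbT.
apply: (@le_trans _ _ (\sum_(a <- L) c ^+ 2)).
  by apply: ler_sum => a _; rewrite ler_sqr ?nnegrE ?normc_ge0.
rewrite big_const_seq iter_addr_0 count_predT exprMn -[_ *+ size L]mulr_natr.
apply: ler_wpM2l; first exact: sqr_ge0.
rewrite -natrX ler_nat (leq_trans (HF _ Uu))// (leq_trans (leqnSn F))//.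
by rewrite leq_pmulr.
Qed.

Lemma Cc_hmod (f : G -> Cplx R) : Cc f -> hmod f.
Proof.
move=> Cf; apply/hmodP => e e0; exists f => //.
by rewrite (_ : (fun a => _) = fun=> 0); [exact: unif_bound_zero|apply/funext => a;
  rewrite subrr].
Qed.

Lemma hmod_mb (x : G -> Cplx R) : hmod x -> exists2 c, 0 <= c & unif_bound c x.
Proof.
move=> /hmodP/(_ 1 ltr01)[y /Cc_mb[c c0 Hy] Hxy].
exists (1 + c); first by rewrite addr_ge0.
have := unif_boundD ler01 c0 Hxy Hy; congr unif_bound; apply/funext => a; exact: subrK.
Qed.

Lemma hmod_l2 (x : G -> Cplx R) u : hmod x -> l2 u x.
Proof. by move=> /hmod_mb[c c0 H]; exists c. Qed.

Lemma hmodD (x y : G -> Cplx R) : hmod x -> hmod y -> hmod (fun a => x a + y a).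
Proof.
move=> /hmodP Hx /hmodP Hy; apply/hmodP => e e0.
have e20 : 0 < e / 2 by rewrite divr_gt0.
have [x' Cx Ex] := Hx _ e20; have [y' Cy Ey] := Hy _ e20.
exists (fun a => x' a + y' a); first exact: CcD.
have := unif_boundD (ltW e20) (ltW e20) Ex Ey; rewrite -splitr; congr unif_bound.
by apply/funext => a; rewrite opprD addrACA.
Qed.

Lemma hmodZ k (x : G -> Cplx R) : hmod x -> hmod (fun a => k * x a).
Proof.
move=> /hmodP Hx; apply/hmodP => e e0; have p : 0 < normc k + 1.
  by rewrite ltr_wpDl ?normc_ge0.
have [x' Cx Ex] := Hx _ (divr_gt0 e0 p); exists (fun a => k * x' a); first exact: CcZ.
have := unif_boundZ k Ex; rewrite (_ : (fun a => _) = (fun a => k * x a - k * x' a)).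
  apply: unif_bound_le; first by apply: mulr_ge0; [exact: normc_ge0|apply: divr_ge0;
    exact: ltW].
  rewrite mulrCA ler_piMr ?(ltW e0)// ler_pdivrMr//; lra.
by apply/funext => a; rewrite mulrBr.
Qed.

Lemma hmodB (x y : G -> Cplx R) : hmod x -> hmod y -> hmod (fun a => x a - y a).
Proof.
move=> Hx Hy; rewrite (_ : (fun a => _) = (fun a => x a + (-1) * y a)).
  by apply: hmodD => //; exact: hmodZ.
by apply/funext => a; rewrite mulN1r.
Qed.

Lemma normc_small_eq0 (z : Cplx R) (M : R) :
  (forall e, 0 < e -> normc z <= e * M) -> z = 0.
Proof.
move=> H; apply/eqP; rewrite -normc_eq0 eq_le normc_ge0 andbT leNgt.
apply/negP => z0; have M0 : 0 < M.
  by have := H 1 ltr01; rewrite mul1r; exact: lt_le_trans.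
have := H (normc z / (2 * M)) (divr_gt0 z0 (mulr_gt0 (ltr0n _ 2) M0)).
rewrite (_ : _ / _ * M = normc z / 2); first lra.
by field; rewrite gt_eqF.
Qed.

(** Density of [Cc]: a bounded additive functional on [hmod] that vanishes on [Cc] is zero. It
    extends identities from finitely supported fibre sums to the whole module. *)
Lemma hmod_ext (phi : (G -> Cplx R) -> Cplx R) M :
  (forall x y, hmod x -> hmod y -> phi (fun a => x a - y a) = phi x - phi y) ->
  (forall x r, hmod x -> 0 <= r -> unif_bound r x -> normc (phi x) <= r * M) ->
  (forall x, Cc x -> phi x = 0) -> forall x, hmod x -> phi x = 0.
Proof.
move=> phiB phiM phi0 x hx; apply: (@normc_small_eq0 _ M) => e e0.
have [y Cy Hy] := iffLR (hmodP x) hx _ e0; have hy := Cc_hmod Cy.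
rewrite -[phi x]subr0 -(phi0 _ Cy) -phiB//; apply: phiM => //; last exact: ltW.
exact: hmodB.
Qed.

(** No test functions are needed: [y] itself is a limit of elements of [Cc]. *)
Lemma hmod_inner_eq0 (y : G -> Cplx R) :
  hmod y -> (forall x u, Cc x -> units u -> inner x y u = 0) -> y = fun=> 0.
Proof.
move=> hy H; apply/funext => a; pose u := gsource a.
have Uu : units u by exact: unit_gsource.
have [c c0 Hc] := hmod_mb hy.
have E : inner y y u = 0.
  apply: (@hmod_ext (fun x => inner x y u) c) => //.
  - by move=> x z hx hz; apply: innerBl; exact: hmod_l2.
  - by move=> x r _ r0 Hx; exact: inner_CS.
  - by move=> x Cx; exact: H.
have [q q0 [Eq /(_ 0 (lexx 0))[_ Hq]]] := inner_self (hmod_l2 u hy).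
move: Eq; rewrite E => -[] /esym/eqP; rewrite sqrf_eq0 => /eqP q00.
have := Hq; rewrite q00 lexx => /(_ isT) F0.
by apply/eqP; rewrite -normc_eq0 eq_le normc_ge0 andbT (fiber_bound_normc _ F0).
Qed.

(** * Operators given by kernels *)

Definition kernel_op (k : G -> G -> Cplx R) : (G -> Cplx R) -> (G -> Cplx R) :=
  fun xi a => \sum_(m \in sfiber (gsource a)) (k a m * xi m).

(** Kernels with bounded entries and propagation at most [t], in the sense of coarse geometry, on
    each source fibre. *)
Definition kernel_bound c t (k : G -> G ->
  Cplx R) := forall a m, gsource m = gsource a ->
  normc (k a m) <= c /\ (k a m != 0 -> ell (gmul a (ginv m)) <= t).

Lemma kernel_op_eq (k k' : G -> G -> Cplx R) :
  (forall a m, gsource m = gsource a -> k a m = k' a m) -> kernel_op k = kernel_op k'.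
Proof.
move=> E; apply/funext => x; apply/funext => a; apply: eq_fsbigr => m.
by rewrite inE => /E ->.
Qed.

Lemma kernel_op_list c t k xi a : 0 <= t -> kernel_bound c t k ->
  kernel_op k xi a = \sum_(m <- nbr t a) (k a m * xi m).
Proof.
move=> t0 Hk; apply: fsbig_list; first exact: nbr_uniq.
  by move=> m /(mem_nbr _ _ t0)[].
move=> m ma /negP mL; have [->|k0] := eqVneq (k a m) 0; first by rewrite mul0r.
by exfalso; apply/mL/(mem_nbr _ _ t0); split=> //; apply: (Hk a m ma).2.
Qed.

Lemma sqr_sum_le (T : Type) (s : seq T) (x : T -> R) : (forall i, 0 <= x i) ->
  (\sum_(i <- s) x i) ^+ 2 <= (size s)%:R * \sum_(i <- s) x i ^+ 2.
Proof.
move=> x0; set X := \sum_(i <- s) x i ^+ 2.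
have X0 : 0 <= X by apply: sumr_ge0 => i _; exact: sqr_ge0.
have S0 : 0 <= \sum_(i <- s) x i by apply: sumr_ge0.
have : \sum_(i <- s) x i * 1 <= Num.sqrt X * Num.sqrt (size s)%:R.
  apply: (@finite_CS R T s x (fun=> 1)); rewrite ?sqrtr_ge0// ?sqr_sqrtr//.
  by rewrite big_const_seq iter_addr_0 count_predT expr1n.
under eq_bigr do rewrite mulr1; rewrite -sqrtrM// => H.
rewrite mulrC -[leRHS]sqr_sqrtr ?mulr_ge0// ler_sqr ?nnegrE ?sqrtr_ge0//.
Qed.

(** Schur test: each row and, by symmetry of [nbr], each column has at most [F] nonzero entries.
    Cauchy-Schwarz along a row costs one factor [F] and the exchange of sums another. It matters
    that [F] depends on [t] only and that the bound is linear in [c]. *)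
Lemma kernel_op_schur t : 0 <= t -> exists F : nat, forall c k x r, 0 <= c ->
  kernel_bound c t k -> 0 <= r -> unif_bound r x ->
    unif_bound (c * F%:R * r) (kernel_op k x).
Proof.
move=> t0; have [F HF] := size_nbr t0; exists F => c k x r c0 Hk r0 Hx u s [us su].
pose L := undup (flatten [seq nbr t a | a <- s]).
have memL a m : a \in s -> m \in nbr t a -> m \in L.
  by move=> sa ma; rewrite mem_undup; apply/flatten_mapP; exists a.
have LA : subseq_of (sfiber u) L.
  split; first exact: undup_uniq.
  move=> m; rewrite mem_undup => /flatten_mapP[a /su <-].
  by move=> /(mem_nbr _ _ t0)[].
apply: (@le_trans _ _ (\sum_(a <- s) c ^+ 2 * F%:R *
    \sum_(m <- L) (m \in nbr t a)%:R * normc (x m) ^+ 2)).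
  rewrite big_seq [leRHS]big_seq; apply: ler_sum => a sa.
  rewrite (kernel_op_list _ _ t0 Hk).
  apply: (@le_trans _ _ ((c * \sum_(m <- nbr t a) normc (x m)) ^+ 2)).
    rewrite ler_sqr ?nnegrE ?normc_ge0//; last first.
      by rewrite mulr_ge0// sumr_ge0// => m _; exact: normc_ge0.
    rewrite (le_trans (normc_sum _ _))// mulr_sumr big_seq [leRHS]big_seq.
    apply: ler_sum => m /(mem_nbr _ _ t0)[ma _]; rewrite normc_mul.
    by rewrite ler_wpM2r ?normc_ge0//; have [] := Hk a m ma.
  rewrite exprMn -mulrA ler_wpM2l ?sqr_ge0//.
  apply: le_trans (sqr_sum_le _ (fun m => normc_ge0 (x m))) _.
  apply: ler_pM; rewrite ?ler0n ?ler_nat//.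
    by apply: sumr_ge0 => m _; exact: sqr_ge0.
  rewrite (@le_trans _ _ (\sum_(m <- nbr t a) (m \in nbr t a)%:R * normc (x m) ^+ 2))//.
    by rewrite big_seq [leRHS]big_seq; apply: ler_sum => m ->; rewrite mul1r.
  apply: ler_sum_subset; rewrite ?nbr_uniq ?undup_uniq// => m.
    exact: memL.
  by rewrite mulr_ge0 ?sqr_ge0.
rewrite -mulr_sumr exchange_big /=.
apply: (@le_trans _ _ (c ^+ 2 * F%:R * \sum_(m <- L) F%:R * normc (x m) ^+ 2)).
  rewrite ler_wpM2l ?mulr_ge0 ?sqr_ge0//.
  apply: ler_sum => m _; rewrite -mulr_suml ler_wpM2r ?sqr_ge0//.
  apply: (@le_trans _ _ (\sum_(a <- s) (a \in nbr t m)%:R)).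
    by apply: ler_sum => a _; rewrite nbr_sym.
  rewrite -natr_sum ler_nat; apply: leq_trans (HF m).
  rewrite -big_mkcond /= sum1_count -size_filter; apply: uniq_leq_size.
    exact: filter_uniq.
  by move=> a; rewrite mem_filter => /andP[].
rewrite -mulr_sumr; have := Hx u L LA => H.
rewrite (_ : (c * F%:R * r) ^+ 2 = c ^+ 2 * F%:R * (F%:R * r ^+ 2)); last by ring.
by rewrite ler_wpM2l ?mulr_ge0 ?sqr_ge0// ler_wpM2l.
Qed.

Lemma kbd_le c c' t t' k : c <= c' -> t <= t' -> kernel_bound c t k ->
  kernel_bound c' t' k.
Proof.
move=> cc tt H a m /H[H1 H2]; split; first exact: le_trans cc.
by move=> /H2/le_trans; apply.
Qed.

Lemma kernel_op_lin c t k z x y : 0 <= t -> kernel_bound c t k ->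
  kernel_op k (fun a => z * x a + y a) = fun a => z * kernel_op k x a + kernel_op k y a.
Proof.
move=> t0 Hk; apply/funext => a;
  rewrite !(kernel_op_list _ _ t0 Hk) mulr_sumr -big_split.
by apply: eq_bigr => m _ /=; rewrite mulrDr mulrCA.
Qed.

Lemma kernel_op_lin_kernel c1 t1 c2 t2 k1 k2 z : 0 <= t1 -> 0 <= t2 ->
  kernel_bound c1 t1 k1 -> kernel_bound c2 t2 k2 ->
  kernel_op (fun a m => z * k1 a m + k2 a m) =
    fun x a => z * kernel_op k1 x a + kernel_op k2 x a.
Proof.
move=> t10 t20 H1 H2; apply/funext => x; apply/funext => a.
have t0 : 0 <= Num.max t1 t2 by rewrite le_max t10.
have {}H1 : kernel_bound c1 (Num.max t1 t2) k1 by apply: kbd_le H1 => //;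
  rewrite le_max lexx.
have {}H2 : kernel_bound c2 (Num.max t1 t2) k2.
  by apply: kbd_le H2 => //; rewrite le_max lexx orbT.
have H : kernel_bound (normc z * c1 + c2) (Num.max t1 t2) (fun a m => z * k1 a m + k2
  a m).
  move=> b m sm; have [A1 B1] := H1 b m sm; have [A2 B2] := H2 b m sm; split.
    apply: le_trans (normcD_le _ _) _; rewrite normc_mul lerD//.
    by rewrite ler_wpM2l ?normc_ge0.
  have [E1|/B1//] := eqVneq (k1 b m) 0; have [E2|/B2//] := eqVneq (k2 b m) 0.
  by rewrite E1 E2 mulr0 addr0 eqxx.
rewrite (kernel_op_list _ _ t0 H) (kernel_op_list _ _ t0 H1) (kernel_op_list _ _ t0 H2).
rewrite mulr_sumr -big_split; apply: eq_bigr => m _ /=.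
by rewrite mulrDl mulrA.
Qed.

(** The second clause stands in for a continuity condition on the kernel; with boundedness it makes
    the operator preserve the closure [hmod]. *)
Definition Cc_kernel k := (exists c t, [/\ 0 <= c, 0 <= t & kernel_bound c t k]) /\
  (forall x, Cc x -> Cc (kernel_op k x)).

Lemma Cc_kernel_lin k z x y : Cc_kernel k ->
  kernel_op k (fun a => z * x a + y a) = fun a => z * kernel_op k x a + kernel_op k y a.
Proof. by move=> [[c [t [_ t0 Hk]]] _]; exact: kernel_op_lin Hk. Qed.

Lemma kop0 k : kernel_op k (fun=> 0) = fun=> 0.
Proof. by apply/funext => a; apply: fsbig1 => m _; rewrite mulr0. Qed.

Lemma Cc_kernel_scale k z x : Cc_kernel k ->
  kernel_op k (fun a => z * x a) = fun a => z * kernel_op k x a.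
Proof.
move=> gk; have := Cc_kernel_lin z x (fun=> 0) gk; rewrite kop0.
rewrite (_ : (fun a => z * x a + 0) = fun a => z * x a).
  by move=> ->; apply/funext => a; rewrite addr0.
by apply/funext => a; rewrite addr0.
Qed.

Lemma Cc_kernel_sub k x y : Cc_kernel k ->
  kernel_op k (fun a => x a - y a) = fun a => kernel_op k x a - kernel_op k y a.
Proof.
move=> gk; have := Cc_kernel_lin (-1) y x gk.
rewrite (_ : (fun a => -1 * y a + x a) = fun a => x a - y a).
  by move=> ->; apply/funext => a; rewrite mulN1r addrC.
by apply/funext => a; rewrite mulN1r addrC.
Qed.

Lemma Cc_kernel_mb k : Cc_kernel k -> exists2 C, 0 <= C &
  forall x r, 0 <= r -> unif_bound r x -> unif_bound (C * r) (kernel_op k x).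
Proof.
move=> [[c [t [c0 t0 Hk]]] _]; have [F HF] := kernel_op_schur t0.
by exists (c * F%:R) => [|x r r0 Hx]; [exact: mulr_ge0|exact: HF].
Qed.

Lemma Cc_kernel_hmod k x : Cc_kernel k -> hmod x -> hmod (kernel_op k x).
Proof.
move=> gk /hmodP hx; have [C C0 HC] := Cc_kernel_mb gk; apply/hmodP => e e0.
have p : 0 < C + 1 by rewrite ltr_wpDl.
have [y Cy Hy] := hx _ (divr_gt0 e0 p); exists (kernel_op k y); first exact: gk.2.
rewrite -(Cc_kernel_sub _ _ gk).
apply: unif_bound_le (HC _ _ _ Hy).
- by apply: mulr_ge0 => //; apply: divr_ge0; exact: ltW.
- by rewrite mulrCA ler_piMr ?(ltW e0)// ler_pdivrMr//; lra.
- by apply: divr_ge0; exact: ltW.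
Qed.

(** For two elements of [Cc] both sides are finite double sums that differ by an exchange. The
    identity is then extended by density, in the right variable and afterwards in the left one. *)
Lemma Cc_kernel_inner k k' x y u : Cc_kernel k -> Cc_kernel k' ->
  (forall a m, gsource m = gsource a -> k' m a = conjc (k a m)) ->
  hmod x -> hmod y -> units u -> inner (kernel_op k x) y u = inner x (kernel_op k' y) u.
Proof.
move=> gk gk' kk' hx hy Uu.
have [C C0 HC] := Cc_kernel_mb gk; have [C' C'0 HC'] := Cc_kernel_mb gk'.
have CcE f g : Cc f -> Cc g -> inner (kernel_op k f) g u = inner f (kernel_op k' g) u.
  move=> /Cc_elim[_ [t1 [_ t10 _ _ ft]]] /Cc_elim[_ [t2 [_ t20 _ _ gt]]].
  pose L1 := fball t1 u; pose L2 := fball t2 u.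
  have LA t : 0 <= t -> subseq_of (sfiber u) (fball t u).
    by move=> t0; split; [exact: fball_uniq|move=> a /(mem_fball _ t0 Uu)[]].
  have f0 a : gsource a = u -> a \notin L1 -> f a = 0.
    move=> au /negP aL; apply/eqP/negPn/negP => /ft at_; apply: aL.
    exact/(mem_fball _ t10 Uu).
  have g0 a : gsource a = u -> a \notin L2 -> g a = 0.
    move=> au /negP aL; apply/eqP/negPn/negP => /gt at_; apply: aL.
    exact/(mem_fball _ t20 Uu).
  have -> : inner (kernel_op k f) g u = \sum_(a <- L2) conjc (kernel_op k f a) * g a.
    apply: inner_finite; first exact: LA.
    by move=> a au /(g0 _ au); right.
  have -> : inner f (kernel_op k' g) u = \sum_(a <- L1) conjc (f a) * kernel_op k' g a.
    apply: inner_finite; first exact: LA.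
    by move=> a au /(f0 _ au); left.
  have E1 a : a \in L2 -> kernel_op k f a = \sum_(m <- L1) k a m * f m.
    move=> /(mem_fball _ t20 Uu)[_ au]; rewrite /kernel_op au.
    have [uL sL] := LA _ t10; apply: fsbig_list => // m mu /(f0 _ mu) ->.
    by rewrite mulr0.
  have E2 m : m \in L1 -> kernel_op k' g m = \sum_(a <- L2) k' m a * g a.
    move=> /(mem_fball _ t10 Uu)[_ mu]; rewrite /kernel_op mu.
    have [uL sL] := LA _ t20; apply: fsbig_list => // a au /(g0 _ au) ->.
    by rewrite mulr0.
  transitivity (\sum_(a <- L2) \sum_(m <- L1) conjc (f m) * (k' m a * g a) : Cplx R).
    rewrite big_seq [RHS]big_seq; apply: eq_bigr => a aL; rewrite E1//.
    rewrite conjc_sum mulr_suml big_seq [RHS]big_seq; apply: eq_bigr => m mL.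
    rewrite kk' ?conjc_mul; first by rewrite mulrCA mulrA.
    by have [_ ->] := iffLR (mem_fball _ t10 Uu) mL;
       have [_ ->] := iffLR (mem_fball _ t20 Uu) aL.
  rewrite exchange_big /= big_seq [RHS]big_seq; apply: eq_bigr => m mL.
  by rewrite E2// mulr_sumr.
have CcE' f : Cc f -> inner (kernel_op k f) y u = inner f (kernel_op k' y) u.
  move=> Cf; have hf := Cc_hmod Cf; have [r r0 Hf] := hmod_mb hf.
  apply/eqP; rewrite -subr_eq0; apply/eqP.
  apply: (@hmod_ext (fun y => inner (kernel_op k f) y u - inner f (kernel_op k' y) u)
    (C * r + r * C')) y hy => [y1 y2 h1 h2|y1 s h1 s0 H1|y1 /(CcE _ _ Cf) ->].
  - rewrite Cc_kernel_sub// !innerB; try by apply: hmod_l2 => //; exact: Cc_kernel_hmod.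
    by rewrite opprB addrACA addrC [RHS]addrC opprD opprK; ring.
  - apply: le_trans (normcB_le _ _) _.
    have := inner_CS (mulr_ge0 C0 r0) s0 (HC _ _ r0 Hf u) (H1 u).
    have := inner_CS r0 (mulr_ge0 C'0 s0) (Hf u) (HC' _ _ s0 H1 u).
    rewrite mulrDr; have -> : s * (C * r) = C * r * s by ring.
    have -> : s * (r * C') = r * (C' * s) by ring.
    by move=> ? ?; lra.
  - by rewrite subrr.
have [r r0 Hy] := hmod_mb hy.
apply/eqP; rewrite -subr_eq0; apply/eqP.
apply: (@hmod_ext (fun x => inner (kernel_op k x) y u - inner x (kernel_op k' y) u)
    (C * r + r * C')) x hx => [x1 x2 h1 h2|x1 s h1 s0 H1|x1 /CcE' ->].
- rewrite Cc_kernel_sub// !innerBl; try by apply: hmod_l2 => //; exact: Cc_kernel_hmod.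
  by rewrite opprB; ring.
- apply: le_trans (normcB_le _ _) _.
  have := inner_CS (mulr_ge0 C0 s0) r0 (HC _ _ s0 H1 u) (Hy u).
  have := inner_CS s0 (mulr_ge0 C'0 r0) (H1 u) (HC' _ _ r0 Hy u).
  rewrite mulrDr; have -> : s * (C * r) = C * s * r by ring.
  have -> : s * (r * C') = s * (C' * r) by ring.
  by move=> ? ?; lra.
- by rewrite subrr.
Qed.

Lemma Cc_kernel_is_adjoint k k' : Cc_kernel k -> Cc_kernel k' ->
  (forall a m, gsource m = gsource a -> k' m a = conjc (k a m)) ->
  is_adjoint (kernel_op k) (kernel_op k').
Proof.
move=> gk gk' kk'; split; [move=> x; exact: Cc_kernel_hmod..|].
by move=> x y hx hy u Uu; exact: Cc_kernel_inner.
Qed.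

(** A bound on [opnorm T] that also makes sense for an input of arbitrary norm [r],
    so that bounds compose without normalization. *)
Definition op_bound c (T : (G -> Cplx R) -> (G -> Cplx R)) :=
  forall x r, 0 <= r -> hmod x -> unif_bound r x -> unif_bound (c * r) (T x).

Definition homog (T : (G -> Cplx R) -> (G -> Cplx R)) := forall z x, hmod x ->
  T (fun a => z * x a) = fun a => z * T x a.

Lemma opnorm_ge0 (T : (G -> Cplx R) -> (G -> Cplx R)) : (0 <= opnorm T)%E.
Proof. by apply: ereal_sup_ubound; right. Qed.

Lemma opnorm_leP c T : 0 <= c -> homog T -> (opnorm T <= c%:E)%E <-> op_bound c T.
Proof.
move=> c0 hT; split=> [le x r r0 hx Hx|H].
  move: r0; rewrite le_eqVlt => /predU1P[r0|r0].
    rewrite -r0 in Hx *; have x0 := mb0_eq Hx.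
    have := hT 0 x hx; rewrite {1}x0 (_ : (fun a => _) = fun=> 0); last first.
      by apply/funext => a; rewrite mul0r.
    by rewrite -x0 => ->; under eq_fun do rewrite mul0r; exact: unif_bound_zero.
  have rn : r%:C%C != 0 :> Cplx R by rewrite -normc_eq0 normc_real normr_eq0 gt_eqF.
  pose y : G -> Cplx R := fun a => (r^-1)%:C%C * x a.
  have hy : hmod y by exact: hmodZ.
  have Hy : unif_bound 1 y.
    have := unif_boundZ ((r^-1)%:C%C) Hx; rewrite normc_real ger0_norm ?invr_ge0 ?ltW//.
    by rewrite mulVf ?gt_eqF.
  have : unif_bound c (T y).
    apply/module_norm_leP => //; apply: le_trans le; apply: ereal_sup_ubound.
    by left; exists y => //; split=> //; apply/module_norm_leP.
  move=> /(unif_boundZ (r%:C)%C); rewrite normc_real ger0_norm ?ltW// mulrC.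
  rewrite (_ : (fun a => _) = T x)// -hT//; congr T; apply/funext => a.
  by rewrite /y mulrA -realcM mulfV ?gt_eqF// mul1r.
apply: ge_ereal_sup => _ [[x [hx /module_norm_leP Hx] <-]|->]; last by rewrite lee_fin.
by apply/module_norm_leP => //; rewrite -[c]mulr1; apply: H => //; exact: Hx.
Qed.

Lemma opnorm_ext (T T' : (G -> Cplx R) -> (G -> Cplx R)) :
  (forall x, hmod x -> T x = T' x) -> opnorm T = opnorm T'.
Proof.
move=> E; rewrite /opnorm; congr esup0; apply/seteqP.
by split=> _ [x [hx Hx] <-]; exists x => //; rewrite E.
Qed.

Lemma op_bound_ext c (T T' : (G -> Cplx R) -> (G -> Cplx R)) :
  (forall x, hmod x -> T x = T' x) -> op_bound c T -> op_bound c T'.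
Proof. by move=> E H x r r0 hx Hx; rewrite -E//; exact: H. Qed.

Lemma op_boundD c c' (T T' : (G -> Cplx R) -> (G -> Cplx R)) : 0 <= c -> 0 <= c' ->
  op_bound c T -> op_bound c' T' -> op_bound (c + c') (fun x a => T x a + T' x a).
Proof.
move=> c0 c'0 H H' x r r0 hx Hx; rewrite mulrDl.
by apply: unif_boundD; rewrite ?mulr_ge0//; [exact: H|exact: H'].
Qed.

Lemma op_boundZ c z (T : (G -> Cplx R) -> (G -> Cplx R)) : op_bound c T ->
  op_bound (normc z * c) (fun x a => z * T x a).
Proof. by move=> H x r r0 hx Hx; rewrite -mulrA; apply: unif_boundZ; exact: H. Qed.

Lemma op_bound_le c c' (T : (G -> Cplx R) -> (G -> Cplx R)) : 0 <= c -> c <= c' ->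
  op_bound c T -> op_bound c' T.
Proof.
move=> c0 cc H x r r0 hx Hx; apply: unif_bound_le (H _ _ r0 hx Hx);
  first exact: mulr_ge0.
exact: ler_wpM2r.
Qed.

Lemma Cc_kernel_homog k : Cc_kernel k -> homog (kernel_op k).
Proof. by move=> gk z x _; exact: Cc_kernel_scale. Qed.

Lemma Cc_kernel_ob k : Cc_kernel k -> exists2 c, 0 <= c & op_bound c (kernel_op k).
Proof.
by move=> /Cc_kernel_mb[c c0 H]; exists c => // x r r0 _ Hx; exact: H.
Qed.

Lemma unif_bound_units c (x : G -> Cplx R) : (forall u, units u ->
  fiber_bound u c x) -> unif_bound c x.
Proof.
move=> H u [|b s] sA; first by rewrite big_nil sqr_ge0.
have [_ /(_ b)] := sA; rewrite mem_head => /(_ isT) bu.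
by apply: (H u) => //; rewrite -bu; exact: unit_gsource.
Qed.

(** With [y = T' x] and [s] its module norm, [<y, y> = <T y, x>] is at most [c s r] on every fibre.
    Taking the supremum over units gives [s^2 <= c s r], and [s] cancels. *)
Lemma op_bound_adjoint c T T' : 0 <= c -> is_adjoint T T' -> op_bound c T ->
  op_bound c T'.
Proof.
move=> c0 [hT hT' adj] H x r r0 hx Hx; set y := T' x.
have hy : hmod y by exact: hT'.
have [C C0 HC] := hmod_mb hy.
have [s s0 Es] : exists2 s, 0 <= s & module_norm y = s%:E.
  have := module_norm_ge0 y; have : (module_norm y <= C%:E)%E by exact/module_norm_leP.
  by case: (module_norm y) => [s _ s0|//|//]; exists s.
have Hs : unif_bound s y by apply/module_norm_leP; rewrite ?Es.
suff le : s <= c * r by exact: unif_bound_le Hs.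
have p0 : 0 <= c * s * r by rewrite !mulr_ge0.
have : unif_bound (Num.sqrt (c * s * r)) y.
  apply: unif_bound_units => u Uu.
  have [q q0 [Eq Hq]] := inner_self (hmod_l2 u hy).
  apply/Hq; first exact: sqrtr_ge0.
  rewrite -ler_sqr ?nnegrE ?sqrtr_ge0// sqr_sqrtr//.
  have := inner_CS (mulr_ge0 c0 s0) r0 (H _ _ s0 hy Hs u) (Hx u).
  by rewrite adj// -/y Eq normc_real ger0_norm ?sqr_ge0.
move/module_norm_leP; rewrite Es lee_fin => /(_ (sqrtr_ge0 _)).
rewrite -ler_sqr ?nnegrE ?sqrtr_ge0// sqr_sqrtr// => le.
rewrite leNgt; apply/negP => lt; have s1 : 0 < s.
  by apply: le_lt_trans lt; exact: mulr_ge0.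
have : s * (c * r) < s * s by rewrite ltr_pM2l.
by have -> : s * (c * r) = c * s * r by [ring]; rewrite -expr2; lra.
Qed.

(** An adjoint is determined by the values on the dense subspace [Cc], and the
    operator is then determined by its adjoint. *)
Lemma adj_ext_eq (T T' : (G -> Cplx R) -> (G -> Cplx R)) : is_adjoint T T' ->
  forall x, hmod x -> adj_ext T x = T x.
Proof.
move=> adjT; have [hT hT' adj] := adjT.
have [[S' [hS hS' adjS]] SE] : adjointable (adj_ext T) /\
    forall xi, Cc xi -> adj_ext T xi = T xi.
  apply: (@xgetI _ T [set S | adjointable S /\ forall xi, Cc xi -> S xi = T xi] T).
  by split=> //; exists T'.
set S := adj_ext T in hS SE adjS *.
have E' y : hmod y -> S' y = T' y.
  move=> hy; have hz : hmod (fun a => S' y a - T' y a).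
    by apply: hmodB; [exact: hS'|exact: hT'].
  have : (fun a => S' y a - T' y a) = fun=> 0.
    apply: hmod_inner_eq0 => // x u Cx Uu; have hx := Cc_hmod Cx.
    rewrite innerB; [|exact: hmod_l2|exact/hmod_l2/hS'|exact/hmod_l2/hT'].
    by rewrite -adjS// -adj// SE// subrr.
  move=> E; apply/funext => a; apply/eqP; rewrite -subr_eq0; apply/eqP.
  by have := congr1 (fun f => f a) E.
move=> x hx; have hz : hmod (fun a => S x a - T x a).
  by apply: hmodB; [exact: hS|exact: hT].
have : (fun a => S x a - T x a) = fun=> 0.
  apply: hmod_inner_eq0 => // y u Cy Uu; have hy := Cc_hmod Cy.
  rewrite innerC; [|exact: hmod_l2|exact: hmod_l2].
  rewrite innerBl; [|exact: hmod_l2|exact/hmod_l2/hS|exact/hmod_l2/hT].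
  by rewrite adjS// adj// E'// subrr conjc_zero.
move=> E; apply/funext => a; apply/eqP; rewrite -subr_eq0; apply/eqP.
by have := congr1 (fun f => f a) E.
Qed.

(** * The regular representation and its iterated commutators *)

Section Regular.
Implicit Types (f g : G -> Cplx R).

Definition lreg_kernel f : G -> G -> Cplx R :=
  fun a m => f (gmul a (ginv m)).

Lemma lregE f : lreg f = kernel_op (lreg_kernel f). Proof. by []. Qed.

Lemma Cc_kernel_lregk f : Cc f -> Cc_kernel (lreg_kernel f).
Proof.
move=> Cf; split; last by move=> x; exact: lreg_Cc.
have [c [t [c0 t0 _ fc ft]]] := Cc_elim Cf.
by exists c, t; split=> // a m _; split; [exact: fc|exact: ft].
Qed.

Lemma lregk_adj f a m : gsource m = gsource a ->
  lreg_kernel (gstar f) m a = conjc (lreg_kernel f a m).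
Proof. by move=> ma; rewrite /lreg_kernel /gstar ginv_div. Qed.

Lemma lreg_is_adjoint f : Cc f -> is_adjoint (lreg f) (lreg (gstar f)).
Proof.
move=> Cf; apply: Cc_kernel_is_adjoint;
  [exact: Cc_kernel_lregk|exact/Cc_kernel_lregk/Cc_star|].
by move=> a m; exact: lregk_adj.
Qed.

(** The kernel of the [n]-fold commutator: each commutator with [Dlen] multiplies a kernel by
    [ell a - ell m]. *)
Definition delta_kernel n (f : G -> Cplx R) : G -> G -> Cplx R :=
  fun a m => ((ell a - ell m) ^+ n)%:C%C * f (gmul a (ginv m)).

(** The triangle inequality gives [|ell a - ell m| <= ell (a m^-1)], which is at most [t] wherever
    the kernel is nonzero; so commutators with the unbounded [Dlen] are bounded. *)
Lemma delta_kernel_bd n f c t : 0 <= t -> (forall a, normc (f a) <= c) ->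
  (forall a, f a != 0 -> ell a <= t) -> kernel_bound (t ^+ n * c) t (delta_kernel n f).
Proof.
move=> t0 fc ft a m ma; rewrite /delta_kernel.
have c0 : 0 <= c by apply: le_trans (fc a); exact: normc_ge0.
have [->|f0] := eqVneq (f (gmul a (ginv m))) 0.
  by rewrite mulr0 normc_zero eqxx; split=> //; rewrite mulr_ge0// exprn_ge0.
have lt := ft _ f0; split; last by [].
rewrite normc_mul ler_pM ?normc_ge0// normc_real normrX lerXn2r ?nnegrE//.
exact: le_trans (ell_div_le ma) lt.
Qed.

Lemma delta_kop n f : Cc f -> delta ell n f = kernel_op (delta_kernel n f).
Proof.
move=> Cf; have [c [t [c0 t0 _ fc ft]]] := Cc_elim Cf.
elim: n => [|n IH].
  rewrite /delta /= lregE; apply: kernel_op_eq => a m _.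
  by rewrite /delta_kernel expr0 /lreg_kernel mul1r.
rewrite /delta iterS -/(delta ell n f) IH; apply/funext => x; apply/funext => a.
rewrite /commD /Dlen (kernel_op_list _ _ t0 (delta_kernel_bd n t0 fc ft)).
rewrite (kernel_op_list _ _ t0 (delta_kernel_bd n t0 fc ft)) (kernel_op_list _ _ t0
  (delta_kernel_bd n.+1 t0 fc ft)).
rewrite mulr_sumr -sumrB; apply: eq_bigr => m _.
by rewrite /delta_kernel exprS realcM realcB; ring.
Qed.

Lemma continuous_ellc : continuous (fun a => (ell a)%:C%C : Cplx R).
Proof.
move=> a; apply: (@continuous_comp _ _ _ ell (fun r : R => r%:C%C : Cplx R)).
  exact: continuous_ell.
exact: continuous_realc.
Qed.

(** Preservation of [Cc] is read off the commutator form, which combines [lreg f] with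
    multiplications by the continuous function [ell]. *)
Lemma Cc_kernel_dk n f : Cc f -> Cc_kernel (delta_kernel n f).
Proof.
move=> Cf; have [c [t [c0 t0 _ fc ft]]] := Cc_elim Cf; split.
  exists (t ^+ n * c), t; split=> //; last exact: delta_kernel_bd.
  by rewrite mulr_ge0// exprn_ge0.
rewrite -delta_kop//; elim: n => [|n IH] x Cx; first exact: lreg_Cc.
apply: CcB; first by apply: Cc_mul; [exact: continuous_ellc|exact: IH].
by apply: IH; apply: Cc_mul => //; exact: continuous_ellc.
Qed.

Lemma delta_kernel_lin n z f g : Cc f -> Cc g ->
  kernel_op (delta_kernel n (fun a => z * f a + g a)) =
  fun x a => z * kernel_op (delta_kernel n f) x a + kernel_op (delta_kernel n g) x a.
Proof.
move=> Cf Cg; have [[c1 [t1 [_ t10 H1]]] _] := Cc_kernel_dk n Cf.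
have [[c2 [t2 [_ t20 H2]]] _] := Cc_kernel_dk n Cg.
rewrite -(kernel_op_lin_kernel z t10 t20 H1 H2); apply: kernel_op_eq => a m _.
by rewrite /delta_kernel mulrDr mulrCA.
Qed.

Lemma dk0 f : kernel_op (delta_kernel 0 f) = lreg f.
Proof. by rewrite lregE; apply: kernel_op_eq => a m _;
  rewrite /delta_kernel expr0 mul1r. Qed.

(** Exchanging the two arguments of the kernel changes the sign of [ell a - ell m], hence the factor
    [(-1)^n]. *)
Lemma delta_kernel_adjoint n f : Cc f ->
  is_adjoint (kernel_op (delta_kernel n f)) (kernel_op (fun m a => (-1) ^+ n *
    delta_kernel n (gstar f) m a)).
Proof.
move=> Cf; have gs := Cc_kernel_dk n (Cc_star Cf).
have E : kernel_op (fun m a => (-1) ^+ n * delta_kernel n (gstar f) m a) =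
    fun x a => (-1) ^+ n * kernel_op (delta_kernel n (gstar f)) x a.
  have [[c [t [c0 t0 H]]] _] := gs.
  have H0 : kernel_bound 0 0 (fun _ _ => 0 : Cplx R).
    by move=> a m _; rewrite normc_zero eqxx.
  have := kernel_op_lin_kernel ((-1) ^+ n) t0 (lexx 0) H H0.
  rewrite (_ : (fun a m => _ + 0) =
    fun a m => (-1) ^+ n * delta_kernel n (gstar f) a m).
    move=> ->; apply/funext => x; apply/funext => a.
    by rewrite [X in _ + X]fsbig1 ?addr0// => m _; rewrite mul0r.
  by apply/funext => a; apply/funext => m; rewrite addr0.
apply: Cc_kernel_is_adjoint.
- exact: Cc_kernel_dk.
- split.
    have [[c [t [c0 t0 H]]] _] := gs; exists c, t; split=> // a m /H[H1 H2].
    split; last by rewrite mulf_eq0 negb_or => /andP[_]; exact: H2.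
    rewrite normc_mul (_ : normc _ = 1) ?mul1r//; elim: (n) => [|j].
      by rewrite expr0 normc_one.
    by rewrite exprS normc_mul normc_opp normc_one mul1r.
  by move=> x Cx; rewrite E; apply: CcZ; exact: gs.2.
- move=> a m ma; rewrite /delta_kernel /gstar ginv_div// conjc_mul mulrA; congr (_ * _).
  have -> : (-1) ^+ n = ((-1) ^+ n)%:C%C :> Cplx R.
    by rewrite realcX realcN realc1.
  by rewrite -realcM -exprMn mulN1r opprB conjc_realc.
Qed.

(** The kernel operator is an adjointable extension of the commutator, and on [hmod] there is only
    one. *)
Lemma LellE n f : Cc f -> Lell ell n f = opnorm (kernel_op (delta_kernel n f)).
Proof.
move=> Cf; rewrite /Lell delta_kop//; apply: opnorm_ext.
exact: (adj_ext_eq (delta_kernel_adjoint n Cf)).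
Qed.

Lemma LellP n f c : Cc f -> 0 <= c ->
  (Lell ell n f <= c%:E)%E <-> op_bound c (kernel_op (delta_kernel n f)).
Proof.
by move=> Cf c0; rewrite LellE//; apply: opnorm_leP => //;
  exact/Cc_kernel_homog/Cc_kernel_dk.
Qed.

Lemma Cred_normP f c : Cc f -> 0 <= c ->
  (Cred_norm f <= c%:E)%E <-> op_bound c (lreg f).
Proof.
by move=> Cf c0; apply: opnorm_leP => //; exact/Cc_kernel_homog/Cc_kernel_lregk.
Qed.

Lemma Lell_fin n f : Cc f -> exists2 c, 0 <= c & Lell ell n f = c%:E.
Proof.
move=> Cf; have [c c0 /(LellP n Cf c0)] := Cc_kernel_ob (Cc_kernel_dk n Cf).
have : (0 <= Lell ell n f)%E by exact: opnorm_ge0.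
by case: (Lell ell n f) => [r|//|//]; exists r.
Qed.

Lemma LellD n f g : Cc f -> Cc g ->
  (Lell ell n (fun a => f a + g a)%R <= Lell ell n f + Lell ell n g)%E.
Proof.
move=> Cf Cg; have [c c0 Ec] := Lell_fin n Cf; have [c' c'0 Ec'] := Lell_fin n Cg.
rewrite Ec Ec' -EFinD; apply/LellP; [exact: CcD|exact: addr_ge0|].
have := op_boundD c0 c'0 (iffLR (LellP n Cf c0) _) (iffLR (LellP n Cg c'0) _).
rewrite Ec Ec' => /(_ (lexx _) (lexx _)); apply: op_bound_ext => x _.
have := delta_kernel_lin n 1 Cf Cg;
  rewrite (_ : (fun a => 1 * f a + g a) = fun a => f a + g a).
  by move=> ->; apply/funext => a; rewrite mul1r.
by apply/funext => a; rewrite mul1r.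
Qed.

Lemma delta_kernel_scale n z f : Cc f ->
  kernel_op (delta_kernel n (fun a => z * f a)) =
    fun x a => z * kernel_op (delta_kernel n f) x a.
Proof.
move=> Cf; have := delta_kernel_lin n z Cf Cc0.
rewrite (_ : (fun a => z * f a + 0) = fun a => z * f a).
  move=> ->; apply/funext => x; apply/funext => a.
  by rewrite [X in _ + X]fsbig1 ?addr0// => m _; rewrite /delta_kernel mulr0 mul0r.
by apply/funext => a; rewrite addr0.
Qed.

Lemma LellZ_le n z f : Cc f ->
  (Lell ell n (fun a => z * f a)%R <= (normc z)%:E * Lell ell n f)%E.
Proof.
move=> Cf; have [c c0 Ec] := Lell_fin n Cf; rewrite Ec -EFinM.
apply/LellP; [exact: CcZ|by rewrite mulr_ge0 ?normc_ge0|].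
by rewrite delta_kernel_scale//; apply: op_boundZ; apply/LellP => //; rewrite Ec.
Qed.

Lemma gstarK (f : G -> Cplx R) : gstar (gstar f) = f.
Proof. by apply/funext => a; rewrite /gstar ginvK conjc_involutive. Qed.

Lemma normc_signr n : normc ((-1) ^+ n : Cplx R) = 1.
Proof.
elim: n => [|j IH]; first by rewrite expr0 normc_one.
by rewrite exprS normc_mul IH normc_opp normc_one mul1r.
Qed.

Lemma Lell_star n f : Cc f -> Lell ell n (gstar f) = Lell ell n f.
Proof.
move=> Cf; have H g : Cc g -> (Lell ell n (gstar g) <= Lell ell n g)%E.
  move=> Cg; have [c c0 Ec] := Lell_fin n Cg; rewrite Ec.
  have gs := Cc_kernel_dk n (Cc_star Cg).
  apply/LellP => //; first exact: Cc_star.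
  have O : op_bound c (kernel_op (delta_kernel n g)) by apply/LellP => //; rewrite Ec.
  have := op_bound_adjoint c0 (delta_kernel_adjoint n Cg) O.
  move=> /(op_boundZ ((-1) ^+ n)); rewrite normc_signr mul1r;
    apply: op_bound_ext => x _.
  have [[c1 [t [c10 t0 Hb]]] _] := gs.
  have Hb' : kernel_bound c1 t (fun m a => (-1) ^+ n * delta_kernel n (gstar g) m a).
    move=> a m /Hb[H1 H2]; rewrite normc_mul normc_signr mul1r; split=> //.
    by rewrite mulf_eq0 negb_or => /andP[_]; exact: H2.
  apply/funext => a; rewrite (kernel_op_list _ _ t0 Hb) (kernel_op_list _ _ t0 Hb')
    mulr_sumr.
  apply: eq_bigr => m _; rewrite !mulrA -exprMn mulrNN mulr1 expr1n mul1r//.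
apply/eqP; rewrite eq_le H//=; rewrite -{1}(gstarK f); apply: H; exact: Cc_star.
Qed.

Lemma kernel_op_gunit k a : kernel_op k gunit a = k a (gsource a).
Proof.
rewrite /kernel_op (@fsbig_list _ _ _ [:: gsource a])// ?big_seq1.
- by rewrite gunit1 ?mulr1//; exact: unit_gsource.
- by move=> m; rewrite mem_seq1 => /eqP ->; exact: gsource_gsource.
- move=> m ma; rewrite mem_seq1 => /eqP nm; rewrite gunit0 ?mulr0// => Um.
  by apply: nm; rewrite -ma gsource_unit.
Qed.

Lemma lreg_gunit f : lreg f gunit = f.
Proof. by apply/funext => a;
  rewrite lregE kernel_op_gunit /lreg_kernel gdiv_gsource. Qed.

Lemma lreg_gunitl (x : G -> Cplx R) : lreg gunit x = x.
Proof.
apply/funext => a; rewrite /lreg (@fsbig_list _ _ _ [:: a])// ?big_seq1.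
- by rewrite gunit1 ?mul1r//; exact: unit_grange.
- by move=> m; rewrite mem_seq1 => /eqP ->.
- move=> m ma; rewrite mem_seq1 => /eqP nm; rewrite gunit0 ?mul0r//.
  by move=> /(unit_div ma) am; apply: nm.
Qed.

Lemma Lell_gunit n : (0 < n)%N -> Lell ell n (gunit : G -> Cplx R) = 0%E.
Proof.
move=> n0; apply/eqP; rewrite eq_le opnorm_ge0 andbT.
apply/LellP => //; first exact: Cc_gunit.
move=> x r r0 hx Hx; rewrite (_ : kernel_op _ _ = fun=> 0);
  first exact: unif_bound_zero.
apply/funext => a; apply: fsbig1 => m ma; rewrite /delta_kernel.
have [U|U] := pselect (units (gmul a (ginv m))).
  have -> := iffLR (unit_div ma) U.
  by rewrite subrr expr0n gtn_eqF// !mul0r.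
by rewrite gunit0// mulr0 mul0r.
Qed.

(** The commutator applied to the vector [gunit], of norm at most one, takes the value
    [ell a ^+ n * f a] at [a], because [ell] vanishes at the source of [a]. *)
Lemma Lell_ge n f c a : Cc f -> 0 <= c -> (Lell ell n f <= c%:E)%E ->
  ell a ^+ n * normc (f a) <= c.
Proof.
move=> Cf c0 /(LellP n Cf c0) H.
have := unif_bound_normc a _ (H _ _ ler01 (Cc_hmod Cc_gunit) unif_bound_gunit).
rewrite mulr1 => /(_ c0); rewrite kernel_op_gunit /delta_kernel gdiv_gsource.
rewrite (ell_unit (unit_gsource a)) subr0 normc_mul normc_real.
by rewrite ger0_norm// exprn_ge0// ell_ge0.
Qed.

(** For fixed [a], the bounds on the supports restrict all sums to the finite sets [L] and [P],
    whatever [x] is. The inner convolution is reindexed by [m] to [m p^-1], and the two sums are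
    exchanged. *)
Lemma lreg_lreg f g x : Cc f -> Cc g -> lreg f (lreg g x) = lreg (lreg f g) x.
Proof.
move=> /Cc_elim[c1 [t1 [_ t10 _ _ ft]]] /Cc_elim[c2 [t2 [_ t20 _ _ gt]]].
have t0 : 0 <= t1 + t2 by exact: addr_ge0.
apply/funext => a; pose L := nbr t1 a; pose P := nbr (t1 + t2) a.
have LP m : m \in L <-> gsource m = gsource a /\ ell (gmul a (ginv m)) <= t1.
  exact: mem_nbr.
have PP p : p \in P <-> gsource p = gsource a /\ ell (gmul a (ginv p)) <= t1 + t2.
  exact: mem_nbr.
have gP m p : m \in L -> gsource p = gsource a -> p \notin P ->
    g (gmul m (ginv p)) = 0.
  move=> /LP[ma mt] pa /negP pP; apply/eqP/negPn/negP => /gt g2; apply: pP.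
  apply/PP; split=> //.
  have ps : gsource p = gsource m by rewrite pa.
  rewrite -(gdiv_div pa ma) ginv_div; last by rewrite ma pa.
  apply: le_trans (ellM _) _; last exact: lerD.
  by rewrite gsource_div// grange_div.
have Eh p : gsource p = gsource a -> lreg f g (gmul a (ginv p)) =
    \sum_(m <- L) f (gmul a (ginv m)) * g (gmul m (ginv p)).
  move=> pa; rewrite /lreg (@fsbig_list _ _ _ [seq gmul m (ginv p) | m <- L]).
  - rewrite big_map big_seq [RHS]big_seq; apply: eq_bigr => m /LP[ma _].
    by rewrite gdiv_div.
  - rewrite map_inj_in_uniq ?nbr_uniq// => m m' /LP[ma _] /LP[m'a _] E.
    by rewrite -[m](@gdivK _ m p) ?E ?gdivK ?pa.
  - move=> _ /mapP[m /LP[ma _] ->]; rewrite /sfiber /=.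
    by rewrite !gsource_div// ?ma ?pa.
  - move=> q; rewrite /sfiber /= gsource_div// => qp /negP nq.
    have sqp : gsource (gmul q p) = gsource a by rewrite gsourceM.
    suff -> : f (gmul (gmul a (ginv p)) (ginv q)) = 0 by rewrite mul0r.
    have E : gmul (gmul a (ginv p)) (ginv q) = gmul a (ginv (gmul q p)).
      by rewrite -(gdiv_div sqp pa) gmulK.
    apply/eqP/negPn/negP => /ft; rewrite E => fq; apply: nq.
    by apply/mapP; exists (gmul q p); [exact/LP|rewrite gmulK].
have -> : lreg (lreg f g) x a = \sum_(p <- P) lreg f g (gmul a (ginv p)) * x p.
  apply: fsbig_list; first exact: nbr_uniq.
    by move=> p /PP[].
  move=> p pa pP; rewrite Eh// big_seq big1 ?mul0r// => m mL.
  by rewrite (gP m p)// mulr0.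
have -> : lreg f (lreg g x) a = \sum_(m <- L) f (gmul a (ginv m)) * lreg g x m.
  apply: fsbig_list; first exact: nbr_uniq.
    by move=> m /LP[].
  move=> m ma /negP mL; have [->|/ft f0] := eqVneq (f (gmul a (ginv m))) 0.
    by rewrite mul0r.
  by exfalso; apply/mL/LP.
transitivity (\sum_(m <- L) \sum_(p <- P)
    f (gmul a (ginv m)) * g (gmul m (ginv p)) * x p).
  rewrite big_seq [RHS]big_seq; apply: eq_bigr => m mL.
  have [ma _] := iffLR (LP m) mL.
  rewrite {1}/lreg ma (@fsbig_list _ _ _ P).
  - by rewrite mulr_sumr; apply: eq_bigr => p _; rewrite mulrA.
  - exact: nbr_uniq.
  - by move=> p /PP[].
  - by move=> p pa pP; rewrite gP// mul0r.
rewrite exchange_big /= big_seq [RHS]big_seq; apply: eq_bigr => p /PP[pa _].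
by rewrite Eh// mulr_suml.
Qed.

End Regular.

(** * Geometric limits, composition and linearity of operators *)

Lemma half_pow_small (e : R) : 0 < e -> exists n, 2^-1 ^+ n <= e :> R.
Proof.
move=> e0; have /cvgrPdist_lt/(_ e e0)[n _ /(_ n (leqnn n))] :
    (fun n => (2^-1 : R) ^+ n) @ \oo --> (0 : R).
  by apply: cvg_expr; rewrite ger0_norm; lra.
by rewrite /= sub0r normrN ger0_norm ?exprn_ge0// => /ltW; exists n.
Qed.

Lemma half_pow_eq0 (z : Cplx R) (M : R) :
  (forall n, normc z <= 2^-1 ^+ n * M) -> z = 0.
Proof.
move=> H; have M0 : 0 <= M.
  by have := H 0%N; rewrite expr0 mul1r; apply: le_trans; exact: normc_ge0.
apply: (@normc_small_eq0 _ M) => e /half_pow_small[n ne].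
by apply: le_trans (H n) _; exact: ler_wpM2r.
Qed.

Lemma unif_bound_half_pow_eq0 (x : G -> Cplx R) (M : R) : 0 <= M ->
  (forall n, unif_bound (2^-1 ^+ n * M) x) -> x = fun=> 0.
Proof.
move=> M0 H; apply/funext => a; apply: (@half_pow_eq0 _ M) => n.
by apply: unif_bound_normc (H n); rewrite mulr_ge0// exprn_ge0.
Qed.

Lemma hmod_closed (x : G -> Cplx R) :
  (forall e, 0 < e -> exists2 y, hmod y & unif_bound e (fun a => x a - y a)) -> hmod x.
Proof.
move=> H; apply/hmodP => e e0; have e20 : 0 < e / 2 by rewrite divr_gt0.
have [y /hmodP/(_ _ e20)[z Cz Hz] Hy] := H _ e20; exists z => //.
have := unif_boundD (ltW e20) (ltW e20) Hy Hz; rewrite -splitr; congr unif_bound.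
by apply/funext => a; rewrite addrA subrK.
Qed.

Lemma op_bound_opnorm c (T : (G -> Cplx R) -> (G -> Cplx R)) :
  0 <= c -> op_bound c T -> (opnorm T <= c%:E)%E.
Proof.
move=> c0 H; apply: ge_ereal_sup => _ [[x [hx /module_norm_leP Hx] <-]|->].
  by apply/module_norm_leP => //; rewrite -[c]mulr1; apply: H => //; exact: Hx.
by rewrite lee_fin.
Qed.

Lemma op_bound_comp c c' (T T' : (G -> Cplx R) -> (G -> Cplx R)) : 0 <= c' ->
  (forall x, hmod x -> hmod (T' x)) -> op_bound c T -> op_bound c' T' ->
  op_bound (c * c') (fun x => T (T' x)).
Proof.
move=> c'0 h' H H' x r r0 hx Hx; rewrite -mulrA.
by apply: H; [exact: mulr_ge0|exact: h'|exact: H'].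
Qed.

Lemma lreg_lin z (f g : G -> Cplx R) : Cc f -> Cc g ->
  lreg (fun a => z * f a + g a) = fun x a => z * lreg f x a + lreg g x a.
Proof. by move=> Cf Cg; have := delta_kernel_lin 0 z Cf Cg; rewrite !dk0. Qed.

Lemma lreg_scale z (f : G -> Cplx R) : Cc f ->
  lreg (fun a => z * f a) = fun x a => z * lreg f x a.
Proof. by move=> Cf; have := delta_kernel_scale 0 z Cf; rewrite !dk0. Qed.

Lemma lreg_sub (f g : G -> Cplx R) : Cc f -> Cc g ->
  lreg (fun a => f a - g a) = fun x a => lreg f x a - lreg g x a.
Proof.
move=> Cf Cg; have := lreg_lin (-1) Cg Cf.
rewrite (_ : (fun a => -1 * g a + f a) = fun a => f a - g a).
  by move=> ->; apply/funext => x; apply/funext => a; rewrite mulN1r addrC.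
by apply/funext => a; rewrite mulN1r addrC.
Qed.

Lemma lreg_add (f g : G -> Cplx R) : Cc f -> Cc g ->
  lreg (fun a => f a + g a) = fun x a => lreg f x a + lreg g x a.
Proof.
move=> Cf Cg; have := lreg_lin 1 Cf Cg.
rewrite (_ : (fun a => 1 * f a + g a) = fun a => f a + g a).
  by move=> ->; apply/funext => x; apply/funext => a; rewrite mul1r.
by apply/funext => a; rewrite mul1r.
Qed.

Lemma lreg_hmod (f x : G -> Cplx R) : Cc f -> hmod x -> hmod (lreg f x).
Proof. by move=> Cf; exact/Cc_kernel_hmod/Cc_kernel_lregk. Qed.

(** * Positivity of small perturbations of the unit *)

Section SquareRoot.
Variable h : G -> Cplx R.
Hypothesis Ch : Cc h.
Hypothesis h_star : gstar h = h.
Hypothesis h_small : op_bound 2^-1 (lreg h).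

Let hf : Cplx R := (2^-1)%:C%C.

Let hfE : hf + hf = 1.
Proof. by rewrite /hf -realcD -realc1; congr (_%:C)%C; lra. Qed.

Let normc_hf : normc hf = 2^-1.
Proof. by rewrite normc_real ger0_norm// invr_ge0. Qed.

(** Iterates converging to [z = 1 - sqrt (1 - h)], the solution of
    [z = (h + z^2) / 2]. *)
Fixpoint sqrt_iter n : G -> Cplx R := if n is n'.+1
  then fun a => hf * (h a + lreg (sqrt_iter n') (sqrt_iter n') a) else fun=> 0.
Let zi := sqrt_iter.

Let Cz n : Cc (zi n).
Proof.
elim: n => [|n IH]; first exact: Cc0.
by apply: CcZ; apply: CcD => //; exact: lreg_Cc.
Qed.

Let zS n x : lreg (zi n.+1) x =
  fun a => hf * (lreg h x a + lreg (zi n) (lreg (zi n) x) a).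
Proof.
rewrite /zi /= lreg_scale; last by apply: CcD => //; exact/lreg_Cc.
rewrite lreg_add//; last exact/lreg_Cc.
by rewrite -lreg_lreg//; exact: Cz.
Qed.

Let z0 x : lreg (zi 0) x = fun=> 0.
Proof. by apply/funext => a; apply: fsbig1 => m _; rewrite mul0r. Qed.

Let hz n x : hmod x -> hmod (lreg (zi n) x).
Proof. exact/lreg_hmod. Qed.

Let hhi := @lreg_hmod h.

Let z_adj n x y u : hmod x -> hmod y -> units u ->
  inner (lreg (zi n) x) y u = inner x (lreg (zi n) y) u.
Proof.
move=> + + Uu; elim: n x y => [|n IH] x y hx hy.
  have E v : (fun=> 0) = (fun a => 0 * v a) :> (G -> Cplx R).
    by apply/funext => a; rewrite mul0r.
  rewrite !z0 {1}(E x) (E y) innerZl ?innerZ; try exact: hmod_l2.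
  by rewrite conjc_zero !mul0r.
have hh v : hmod v -> hmod (lreg h v) by exact: hhi.
rewrite !zS innerZl ?innerZ; try (by apply: hmod_l2 => //; apply: hmodD; auto).
rewrite conjc_realc innerDl ?innerD; try (by apply: hmod_l2; auto).
have [_ _ ad] := lreg_is_adjoint Ch; rewrite h_star in ad.
by rewrite ad// IH; auto; rewrite IH; auto.
Qed.

(** The ball of radius one half is stable under the iteration: [(1/2 + 1/4) / 2 = 3/8]. *)
Let z_half n : op_bound 2^-1 (lreg (zi n)).
Proof.
elim: n => [|n IH].
  by move=> x r r0 _ _; rewrite z0; exact: unif_bound_zero.
have i0 : 0 <= 2^-1 :> R by rewrite invr_ge0.
have := op_boundZ hf (op_boundD i0 (mulr_ge0 i0 i0) h_small (op_bound_comp i0 (@hz n)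
  IH IH)).
move=> H; apply: (@op_bound_le (normc hf * (2^-1 + 2^-1 * 2^-1))).
- by rewrite mulr_ge0 ?normc_ge0// addr_ge0// mulr_ge0.
- by rewrite normc_hf; lra.
- by apply: op_bound_ext H => x _; rewrite zS.
Qed.

(** The difference of squares is written [z' (z' - z) + (z' - z) z], with [z'] the successor of [z].
    Both outer factors have norm at most [1/2], so each step halves the difference. *)
Let z_diff n : op_bound (2^-1 ^+ n) (fun x a => lreg (zi n.+1) x a - lreg (zi n) x a).
Proof.
have i0 : 0 <= 2^-1 :> R by rewrite invr_ge0.
elim: n => [|n IH].
  have := op_boundZ hf h_small; rewrite normc_hf => /op_bound_le H.
  apply: op_bound_ext (H 1 _ _); [|by rewrite mulr_ge0|lra].
  by move=> x _; apply/funext => a; rewrite zS !z0 addr0 subr0.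
have p0 : 0 <= 2^-1 ^+ n :> R by rewrite exprn_ge0.
have hd x : hmod x -> hmod (fun a => lreg (zi n.+1) x a - lreg (zi n) x a).
  by move=> hx; apply: hmodB; exact: hz.
have := op_boundZ hf (op_boundD (mulr_ge0 i0 p0) (mulr_ge0 p0 i0)
  (op_bound_comp p0 hd (z_half n.+1) IH) (op_bound_comp i0 (@hz n) IH (z_half n))).
rewrite normc_hf exprS.
rewrite (_ : 2^-1 * (2^-1 * 2^-1 ^+ n + 2^-1 ^+ n * 2^-1) = 2^-1 * 2^-1 ^+ n);
  last first.
  by rewrite [2^-1 ^+ n * 2^-1]mulrC -mulrDl; congr (_ * _); lra.
apply: op_bound_ext => x hx; apply/funext => a.
have gz : Cc_kernel (lreg_kernel (zi n.+1)) by exact: Cc_kernel_lregk.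
rewrite [lreg (zi n.+1) (fun a => _)](Cc_kernel_sub _ _ gz) -!lregE.
rewrite (zS n.+1) [in X in _ = _ - X]zS; ring.
Qed.

(** The constant is the exact partial sum of the geometric series, which lets the induction on [k]
    close; the limit over [k] gives the rate of [zl_diff]. *)
Let z_diffk n k x r : 0 <= r -> hmod x -> unif_bound r x ->
  unif_bound (2 * (2^-1 ^+ n - 2^-1 ^+ (n + k)) * r)
     (fun a => lreg (zi (n + k)) x a - lreg (zi n) x a).
Proof.
move=> r0 hx Hx; have p0 (m : nat) : 0 <= 2^-1 ^+ m :> R by rewrite exprn_ge0.
have dec (m : nat) : 2^-1 ^+ (n + m) <= 2^-1 ^+ n :> R.
  by rewrite exprD ler_piMr// exprn_ile1//; lra.
elim: k => [|k IH].
  rewrite addn0 subrr mulr0 mul0r (_ : (fun a => _) = fun=> 0).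
    exact: unif_bound_zero.
  by apply/funext => a; rewrite subrr.
have i0 : 0 <= 2 * (2^-1 ^+ n - 2^-1 ^+ (n + k)) * r.
  by rewrite !mulr_ge0// subr_ge0.
have := unif_boundD i0 (mulr_ge0 (p0 (n + k)%N) r0) IH (z_diff (n + k) r0 hx Hx).
rewrite addnS -mulrDl (_ : 2 * _ + _ = 2 * (2^-1 ^+ n - 2^-1 ^+ (n + k).+1)).
  by congr unif_bound; apply/funext => a; ring.
by rewrite exprS; move: (2^-1 ^+ n) (2^-1 ^+ (n + k)) => A B; lra.
Qed.

(** The limit of the iterates is taken arrow by arrow, through its rate of convergence; the default
    0 is never reached for [x] in [hmod]. *)
Definition sqrt_lim (x : G -> Cplx R) : G -> Cplx R := fun a =>
  xget 0 [set l | exists r, forall n, normc (l - lreg (zi n) x a) <= 4 * r * 2^-1 ^+ n].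

Let zl_cvg x a n : hmod x -> (fun k => lreg (zi (n + k)) x a) @ \oo --> sqrt_lim x a.
Proof.
move=> hx; have [r r0 Hx] := hmod_mb hx.
have [s Hs] : exists r, forall n,
    normc (sqrt_lim x a - lreg (zi n) x a) <= 4 * r * 2^-1 ^+ n.
  have [l Hl] : exists l : Cplx R,
      forall m : nat, normc (l - lreg (zi m) x a) <= 4 * r * 2^-1 ^+ m.
    apply: geometric_complex => m; rewrite mulrC.
    apply: (@unif_bound_normc _ _ (2^-1 ^+ m * r)
      (fun a => lreg (zi m.+1) x a - lreg (zi m) x a)).
      by rewrite mulr_ge0// exprn_ge0.
    exact: z_diff.
  apply: (@xgetI _ 0 [set l | exists r, forall n,
    normc (l - lreg (zi n) x a) <= 4 * r * 2^-1 ^+ n] l); by exists r.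
apply/cvgcP => e e0.
have s0 : 0 <= 4 * s.
  by have := Hs 0%N; rewrite expr0 mulr1; apply: le_trans; exact: normc_ge0.
have p : 0 < 4 * s + 1 by rewrite ltr_wpDl.
have [m Hm] := half_pow_small (divr_gt0 e0 p).
exists m => // k /= mk; apply: le_lt_trans (Hs _) _.
apply: (@le_lt_trans _ _ (4 * s * 2^-1 ^+ m)).
  apply: ler_wpM2l => //; apply: ler_wiXn2l; rewrite ?invr_ge0 ?invf_le1 ?ler1n//.
  exact: leq_trans mk (leq_addl _ _).
apply: (@le_lt_trans _ _ (4 * s * (e / (4 * s + 1)))); first exact: ler_wpM2l.
by rewrite mulrCA gtr_pMr// ltr_pdivrMr//; lra.
Qed.

Let zl_diff n x r : 0 <= r -> hmod x -> unif_bound r x ->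
  unif_bound (2^-1 ^+ n * (2 * r)) (fun a => sqrt_lim x a - lreg (zi n) x a).
Proof.
move=> r0 hx Hx.
have p0 (m : nat) : 0 <= 2^-1 ^+ m :> R by rewrite exprn_ge0.
apply: (@unif_bound_lim _ _ _ (fun k a => lreg (zi (n + k)) x a - lreg (zi n) x a)).
  move=> k; apply: unif_bound_le (z_diffk n k r0 hx Hx).
    rewrite !mulr_ge0// subr_ge0 exprD ler_piMr// exprn_ile1//; lra.
  by have := mulr_ge0 (p0 (n + k)%N) r0; lra.
by move=> a; apply: cvgcD; [exact: zl_cvg|exact: cvg_cst].
Qed.

Let zl_hmod x : hmod x -> hmod (sqrt_lim x).
Proof.
move=> hx; have [r r0 Hx] := hmod_mb hx; apply: hmod_closed => e e0.
have p : 0 < 2 * r + 1 by rewrite ltr_wpDl// mulr_ge0.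
have [m Hm] := half_pow_small (divr_gt0 e0 p).
exists (lreg (zi m) x); first exact: hz.
apply: unif_bound_le (zl_diff m r0 hx Hx); first by rewrite !mulr_ge0// exprn_ge0.
apply: (@le_trans _ _ (e / (2 * r + 1) * (2 * r))).
  by apply: ler_wpM2r => //; rewrite mulr_ge0.
by rewrite mulrAC ler_pdivrMr//; apply: ler_wpM2l; [exact: ltW|lra].
Qed.

Definition sqrt_op (x : G -> Cplx R) : G -> Cplx R := fun a => x a - sqrt_lim x a.

Let T_hmod x : hmod x -> hmod (sqrt_op x).
Proof. by move=> hx; apply: hmodB => //; exact: zl_hmod. Qed.

Let T_adjoint : is_adjoint sqrt_op sqrt_op.
Proof.
split; [exact: T_hmod..|move=> x y hx hy u Uu].
have [hlx hly] := (zl_hmod hx, zl_hmod hy).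
rewrite innerBl ?innerB; try exact: hmod_l2.
congr (_ - _); apply/eqP; rewrite -subr_eq0; apply/eqP.
have [r r0 Hx] := hmod_mb hx; have [s s0 Hy] := hmod_mb hy.
apply: (@half_pow_eq0 _ (2 * r * s + r * (2 * s))) => n.
have p0 : 0 <= 2^-1 ^+ n :> R by rewrite exprn_ge0.
have [d1 d2] := (zl_diff n r0 hx Hx, zl_diff n s0 hy Hy).
have -> : inner (sqrt_lim x) y u - inner x (sqrt_lim y) u =
    inner (fun a => sqrt_lim x a - lreg (zi n) x a) y u -
    inner x (fun a => sqrt_lim y a - lreg (zi n) y a) u.
  rewrite innerBl ?innerB; try (by apply: hmod_l2; auto).
  by rewrite (z_adj n hx hy Uu); ring.
apply: le_trans (normcB_le _ _) _.
have i1 : 0 <= 2^-1 ^+ n * (2 * r) by rewrite !mulr_ge0.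
have i2 : 0 <= 2^-1 ^+ n * (2 * s) by rewrite !mulr_ge0.
have := inner_CS i1 s0 (d1 u) (Hy u); have := inner_CS r0 i2 (Hx u) (d2 u).
rewrite mulrDr; move: (2^-1 ^+ n) => A; lra.
Qed.

Let CB n : Cc (fun a => gunit a - zi n a).
Proof. by apply: CcB => //; exact: Cc_gunit. Qed.

Let T_Cred : Cred sqrt_op.
Proof.
split; first by exists sqrt_op.
move=> e e0; have e4 : 0 < e / 4 by rewrite divr_gt0.
have [n Hn] := half_pow_small e4; exists (fun a => gunit a - zi n a) => //.
apply: (@le_lt_trans _ _ (e / 2)%:E); last by rewrite lte_fin; lra.
apply: op_bound_opnorm; first by rewrite divr_ge0 ?ltW.
move=> x r r0 hx Hx; rewrite (lreg_sub Cc_gunit (Cz n)) lreg_gunitl.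
rewrite (_ : (fun a => _) = fun a => - (sqrt_lim x a - lreg (zi n) x a)).
  apply: unif_boundN; apply: unif_bound_le (zl_diff n r0 hx Hx).
    by rewrite !mulr_ge0// exprn_ge0.
  rewrite mulrA; apply: ler_wpM2r => //; lra.
by apply/funext => a; rewrite /sqrt_op; ring.
Qed.

(** The recursion amounts to [(1 - z_n)^2 = 1 - h + 2 (z_(n+1) - z_n)], which is [BB]. It remains to
    compare [sqrt_op] with [B n], that is with [1 - z_n], in both factors. *)
Let T_sqr x : hmod x -> lreg (fun a => gunit a - h a) x = sqrt_op (sqrt_op x).
Proof.
move=> hx; pose B n y : G -> Cplx R := fun a => y a - lreg (zi n) y a.
have [r r0 Hx] := hmod_mb hx; have [s s0 Hs] := hmod_mb (T_hmod hx).
have BB n : B n (B n x) = fun a => x a - lreg h x a +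
    2 * (lreg (zi n.+1) x a - lreg (zi n) x a).
  apply/funext => a; have gz : Cc_kernel (lreg_kernel (zi n)) by exact: Cc_kernel_lregk.
  have E : lreg (zi n) (B n x) =
      fun a => lreg (zi n) x a - lreg (zi n) (lreg (zi n) x) a.
    exact: Cc_kernel_sub gz.
  rewrite -[LHS]/(x a - lreg (zi n) x a - lreg (zi n) (B n x) a) E zS.
  have -> : (2 : Cplx R) * (hf * (lreg h x a + lreg (zi n) (lreg (zi n) x) a) -
      lreg (zi n) x a) = (hf + hf) * (lreg h x a + lreg (zi n) (lreg (zi n) x) a) -
      2 * lreg (zi n) x a by ring.
  by rewrite hfE; ring.
suff : (fun a => sqrt_op (sqrt_op x) a - (x a - lreg h x a)) = fun=> 0.
  move=> E; rewrite (lreg_sub Cc_gunit Ch) lreg_gunitl; apply/funext => a.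
  by apply/eqP; rewrite eq_sym -subr_eq0; apply/eqP; have := congr1 (fun f => f a) E.
(* Up to the factor [2^-n], replacing the outer [sqrt_op] costs [2 s], replacing the inner one costs
   [2 r + r] after applying [B n], and the remainder in [BB] costs [2 r]; the rest is slack. *)
apply: (@unif_bound_half_pow_eq0 _ (2 * s + 3 * r + 2 * r + 2 * r)) => [|n].
  by rewrite !addr_ge0// mulr_ge0.
have p0 : 0 <= 2^-1 ^+ n :> R by rewrite exprn_ge0.
have hB y : hmod y -> hmod (B n y) by move=> hy; apply: hmodB => //; exact: hz.
pose w : G -> Cplx R := fun a => sqrt_op x a - B n x a.
have hw : hmod w by apply: hmodB; [exact: T_hmod|exact: hB].
have Hw : unif_bound (2^-1 ^+ n * (2 * r)) w.
  have := unif_boundN (zl_diff n r0 hx Hx); congr unif_bound; apply/funext => a.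
  by rewrite /w /B /sqrt_op; ring.
have i1 : 0 <= 2^-1 ^+ n * (2 * r) by rewrite !mulr_ge0.
have i3 : 0 <= 2^-1 * (2^-1 ^+ n * (2 * r)) by rewrite mulr_ge0// invr_ge0.
have H1 := unif_boundN (zl_diff n s0 (T_hmod hx) Hs).
have H2 : unif_bound (2^-1 ^+ n * (2 * r) + 2^-1 * (2^-1 ^+ n * (2 * r))) (B n w).
  by apply: unif_boundB => //; exact: z_half.
have H3 := unif_boundZ (2%:R%:C)%C (z_diff n r0 hx Hx).
rewrite normc_real ger0_norm// in H3.
have i4 : 0 <= 2^-1 ^+ n * (2 * s) by rewrite !mulr_ge0.
have i5 : 0 <= 2 * (2^-1 ^+ n * r) by rewrite !mulr_ge0.
have := unif_boundD (addr_ge0 i4 (addr_ge0 i1 i3)) i5 (unif_boundD i4 (addr_ge0 i1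
  i3) H1 H2) H3.
rewrite (_ : (fun a => _) = fun a => sqrt_op (sqrt_op x) a - (x a - lreg h x a)).
  apply: unif_bound_le; first by rewrite !addr_ge0.
  have := mulr_ge0 p0 r0; have := mulr_ge0 p0 s0; rewrite !mulrDr.
  by move: (2^-1 ^+ n) => A; lra.
apply/funext => a; have gz : Cc_kernel (lreg_kernel (zi n)) by exact: Cc_kernel_lregk.
have Ew : B n w a = B n (sqrt_op x) a - B n (B n x) a.
  have E : lreg (zi n) w =
      fun a => lreg (zi n) (sqrt_op x) a - lreg (zi n) (B n x) a.
    exact: Cc_kernel_sub gz.
  rewrite -[LHS]/(sqrt_op x a - B n x a - lreg (zi n) w a) E.
  rewrite -[B n (sqrt_op x) a]/(sqrt_op x a - lreg (zi n) (sqrt_op x) a).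
  rewrite -[B n (B n x) a]/(B n x a - lreg (zi n) (B n x) a); ring.
have E2 : (2%:R%:C)%C = 2 :> Cplx R by rewrite realcD realc1.
rewrite Ew BB E2 -[sqrt_op (sqrt_op x) a]/(sqrt_op x a - sqrt_lim (sqrt_op x) a).
rewrite -[B n (sqrt_op x) a]/(sqrt_op x a - lreg (zi n) (sqrt_op x) a); ring.
Qed.

Lemma Cred_pos_sub : Cred_pos (fun a => gunit a - h a).
Proof. by exists sqrt_op, sqrt_op; split. Qed.

End SquareRoot.

(** * States and total boundedness *)

Section States.
Variable X : set (G -> Cplx R).
Hypothesis opX : operator_system X.
Implicit Types (f g : G -> Cplx R) (w v : functional X).

Lemma XCc f : X f -> Cc f. Proof. by case: opX => + _ _ _; exact. Qed.
Lemma Xgunit : X gunit. Proof. by case: opX. Qed.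
Lemma Xlin z f g : X f -> X g -> X (fun a => z * f a + g a).
Proof. by case: opX => _ _ + _; exact. Qed.
Lemma Xstar f : X f -> X (gstar f). Proof. by case: opX => _ _ _; exact. Qed.

Lemma X0 : X (fun=> 0).
Proof.
have := Xlin (-1) Xgunit Xgunit; congr X; apply/funext => a.
by rewrite mulN1r addNr.
Qed.

Lemma Xscale z f : X f -> X (fun a => z * f a).
Proof.
move=> Xf; have := Xlin z Xf X0; congr X; apply/funext => a.
by rewrite addr0.
Qed.

Lemma Xsub f g : X f -> X g -> X (fun a => f a - g a).
Proof.
move=> Xf Xg; have := Xlin (-1) Xg Xf; congr X; apply/funext => a.
by rewrite mulN1r addrC.
Qed.

(** Functionals only accept elements of the subtype of [X]; [eval] extends them
    by 0 to all functions. *)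
Definition eval w f : Cplx R :=
  if pselect (X f) is left Xf then w (SigSub (mem_set Xf)) else 0.

Lemma evE w (x : X) : eval w (val x) = w x.
Proof.
rewrite /eval; case: pselect => [Xf|]; last by case; exact: set_valP.
by congr (w _); exact: val_inj.
Qed.

Lemma eval_lin w z f g : states w -> X f -> X g ->
  eval w (fun a => z * f a + g a) = z * eval w f + eval w g.
Proof.
move=> [lw _ _] Xf Xg; have Xh := Xlin z Xf Xg.
pose x : X := SigSub (mem_set Xf); pose y : X := SigSub (mem_set Xg).
pose h : X := SigSub (mem_set Xh).
have -> : eval w f = w x by rewrite -evE.
have -> : eval w g = w y by rewrite -evE.
by rewrite -[LHS]/(eval w (val h)) evE; exact: lw.
Qed.

Lemma eval_gunit w : states w -> eval w gunit = 1.
Proof.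
move=> [_ _ uw]; pose x : X := SigSub (mem_set Xgunit).
by rewrite -[LHS]/(eval w (val x)) evE; exact: uw.
Qed.

Lemma eval_pos w f : states w -> X f -> Cred_pos f -> (0 <= (eval w f : R[i])).
Proof.
move=> [_ pw _] Xf pf; pose x : X := SigSub (mem_set Xf).
by rewrite -[f]/(val x) evE; exact: pw.
Qed.

Lemma ev0 w : states w -> eval w (fun=> 0) = 0.
Proof.
move=> sw; have E : eval w (fun=> 0) = -1 * eval w (fun=> 0) + eval w (fun=> 0).
  rewrite -(eval_lin (-1) sw X0 X0); congr eval; apply/funext => a.
  by rewrite mulr0 addr0.
by rewrite E mulN1r addNr.
Qed.

Lemma eval_scale w z f : states w -> X f -> eval w (fun a => z * f a) = z * eval w f.
Proof.
move=> sw Xf; rewrite -[RHS]addr0 -(ev0 sw) -eval_lin//; last exact: X0.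
by congr eval; apply/funext => a; rewrite addr0.
Qed.

Lemma eval_sub w f g : states w -> X f -> X g ->
  eval w (fun a => f a - g a) = eval w f - eval w g.
Proof.
move=> sw Xf Xg; rewrite -mulN1r addrC -eval_lin//.
by congr eval; apply/funext => a; rewrite mulN1r addrC.
Qed.

(** For self-adjoint [f] of norm at most [c], both [1 - f / 2c] and [1 + f / 2c] are
    positive; the constant is not optimal. *)
Lemma eval_selfadjoint_bound w f c : states w -> X f -> 0 < c -> gstar f = f ->
  op_bound c (lreg f) -> normc (eval w f) <= 2 * c.
Proof.
move=> sw Xf c0 sf H.
have P (z : R) : `|z| = (2 * c)^-1 -> 0 <= (1 - z%:C%C * eval w f : R[i]).
  move=> zE; pose h : G -> Cplx R := fun a => z%:C%C * f a.
  have Xh : X h by exact: Xscale.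
  have sh : gstar h = h.
    by apply/funext => a; rewrite /gstar /h conjc_mul conjc_realc -{2}sf.
  have Hh : op_bound 2^-1 (lreg h).
    have := op_boundZ (z%:C)%C H; rewrite normc_real zE (_ : (2 * c)^-1 * c = 2^-1).
      by rewrite /h lreg_scale//; exact: XCc.
    by field; rewrite gt_eqF.
  have := eval_pos sw (Xsub Xgunit Xh) (Cred_pos_sub (XCc Xh) sh Hh).
  by rewrite (eval_sub sw Xgunit Xh) eval_gunit// eval_scale.
have c20 : 0 < 2 * c by rewrite mulr_gt0.
have := P (2 * c)^-1; have := P (- (2 * c)^-1).
rewrite normrN ger0_norm ?invr_ge0 ?(ltW c20)// => /(_ erefl) + /(_ erefl).
case: (eval w f) => p q; rewrite !lecE /= !(mul0r, addr0, subr0, oppr0).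
move=> /andP[/eqP q0 p1] /andP[_ p2].
have k0 : 0 < (2 * c)^-1 by rewrite invr_gt0.
have q00 : q = 0.
  have : (2 * c)^-1 * q = 0 by move: q0; lra.
  by move=> /eqP; rewrite mulf_eq0 gt_eqF//= => /eqP.
rewrite q00 expr0n /= addr0 sqrtr_sqr.
rewrite -(ler_pM2l k0) mulVf ?gt_eqF// -[X in X * _](ger0_norm (ltW k0)) -normrM.
by rewrite ler_norml; apply/andP; split; move: p1 p2; lra.
Qed.

(** Decomposition [f = p + i q] into self-adjoint parts. Each has norm at most [c], since the
    adjoint obeys the same bound, and contributes [2 c]. *)
Lemma eval_bound w f c : states w -> X f -> 0 < c -> op_bound c (lreg f) ->
  normc (eval w f) <= 4 * c.
Proof.
move=> sw Xf c0 H; have Cf := XCc Xf; have Xfs := Xstar Xf; have Cs := XCc Xfs.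
have Hs : op_bound c (lreg (gstar f)) :=
  op_bound_adjoint (ltW c0) (lreg_is_adjoint Cf) H.
pose hf : Cplx R := (2^-1)%:C%C; pose ih : Cplx R := (0 +i* (- 2^-1))%C.
pose p a := hf * (f a + gstar f a); pose q a := ih * (f a - gstar f a).
have Xd : X (fun a => f a - gstar f a) by exact: Xsub.
have Xs : X (fun a => f a + gstar f a).
  by have := Xlin 1 Xf Xfs; congr X; apply/funext => a; rewrite mul1r.
have [Xp Xq] : X p /\ X q by split; exact: Xscale.
have sp : gstar p = p.
  apply/funext => a; rewrite /p /gstar conjc_mul conjc_realc conjc_add ginvK
    conjc_involutive.
  by rewrite addrC.
have sq : gstar q = q.
  apply/funext => a; rewrite /q /gstar conjc_mul conjc_add conjc_opp ginvK
    conjc_involutive.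
  have -> : conjc ih = - ih :> Cplx R.
    by apply/eqP; rewrite eq_complex /= oppr0 !eqxx.
  by rewrite mulNr -mulrN opprB addrC.
have nhf : normc hf = 2^-1 by rewrite normc_real ger0_norm// invr_ge0.
have nih : normc ih = 2^-1.
  by rewrite /= expr0n /= add0r sqrrN sqrtr_sqr ger0_norm// invr_ge0.
have cc : 2^-1 * (c + c) = c by lra.
have Hp : op_bound c (lreg p).
  have := op_boundZ hf (op_boundD (ltW c0) (ltW c0) H Hs); rewrite nhf cc.
  rewrite /p lreg_scale; last exact: XCc.
  by rewrite lreg_add.
have Hq : op_bound c (lreg q).
  have Hs' := op_boundZ (-1) Hs; rewrite normc_opp normc_one mul1r in Hs'.
  have := op_boundZ ih (op_boundD (ltW c0) (ltW c0) H Hs'); rewrite nih cc.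
  rewrite /q lreg_scale; last exact: XCc.
  rewrite lreg_sub//; apply: op_bound_ext => x _; apply/funext => a.
  by rewrite mulN1r.
have -> : eval w f = 'i%C * eval w q + eval w p.
  rewrite -eval_lin//; congr eval; apply/funext => a; rewrite /p /q mulrA.
  have -> : 'i%C * ih = hf :> Cplx R.
    by apply/eqP; rewrite eq_complex /=; apply/andP; split; apply/eqP; ring.
  rewrite -mulrDr (_ : f a - _ + _ = f a + f a); last by ring.
  by rewrite -mulr2n -[X in _ * X]mulr_natl mulrA -[LHS]mul1r; congr (_ * _);
     apply/eqP; rewrite eq_complex /=; apply/andP; split; apply/eqP; field.
have b1 := eval_selfadjoint_bound sw Xp c0 sp Hp.
have b2 := eval_selfadjoint_bound sw Xq c0 sq Hq.
apply: le_trans (normcD_le _ _) _; rewrite normc_mul.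
have -> : normc ('i%C : Cplx R) = 1 by rewrite /= expr0n expr1n add0r sqrtr1.
by rewrite mul1r; lra.
Qed.

Definition vstate (x : G -> Cplx R) (u : G) : functional X :=
  fun y : X => inner x (lreg (val y) x) u.

(** Normalization is required at the single unit [u] only. Positivity holds since an element [S T],
    with [S] adjoint to [T], is sent to the inner product of [T x] with itself. *)
Lemma vstate_states x u : hmod x -> units u -> inner x x u = 1 ->
  states (vstate x u).
Proof.
move=> hx Uu x1; split.
- move=> c y z t E.
  have Ey := XCc (set_valP y); have Ez := XCc (set_valP z).
  rewrite /vstate (_ : val t = fun a => c * val y a + val z a); last exact/funext.
  have lx := hmod_l2 u hx; have ly := hmod_l2 u (lreg_hmod Ey hx).
  have lz := hmod_l2 u (lreg_hmod Ez hx).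
  by rewrite lreg_lin// innerD ?innerZ//; exact: l2Z.
- move=> y [T [S [[[T' [hT _ _]] _] [_ _ adj] E]]].
  rewrite /vstate E// -adj//; last exact: hT.
  have [q q0 [-> _]] := inner_self (hmod_l2 u (hT _ hx)).
  by rewrite ler0c sqr_ge0.
- by move=> y E; rewrite /vstate E lreg_gunitl.
Qed.

(** Vector states bound the quadratic form of [f], hence [f] by polarization. *)
Lemma numerical_radius f B : X f -> 0 <= B ->
  (forall w, states w -> normc (eval w f) <= B) -> op_bound (4 * B) (lreg f).
Proof.
move=> Xf B0 HB; have Cf := XCc Xf; have gf := Cc_kernel_lregk Cf.
have hl x : hmod x -> hmod (lreg f x) by exact: lreg_hmod.
(* A vector state needs norm exactly one at [u], so [x] is divided by its fibre norm [q]; when [q]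
   is zero the inner product vanishes. *)
have Q x u c : hmod x -> units u -> 0 <= c -> fiber_bound u c x ->
    normc (inner x (lreg f x) u) <= B * c ^+ 2.
  move=> hx Uu c0 Hc; have [q q0 [Eq Hq]] := inner_self (hmod_l2 u hx).
  have qc : q <= c by apply/Hq.
  apply: (@le_trans _ _ (B * q ^+ 2)); last first.
    by apply: ler_wpM2l => //; rewrite ler_sqr ?nnegrE.
  move: q0; rewrite le_eqVlt => /predU1P[q0|q0].
    have F0 : fiber_bound u 0 x by apply/Hq; rewrite // -q0.
    have [r r0 Hr] := hmod_mb (hl _ hx).
    have := inner_CS (lexx 0) r0 F0 (Hr u); rewrite mul0r => /le_trans; apply.
    by rewrite mulr_ge0 ?sqr_ge0.
  pose t : Cplx R := (q^-1)%:C%C; pose y a := t * x a.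
  have hy : hmod y by exact: hmodZ.
  have ct : conjc t = t by exact: conjc_realc.
  have y1 : inner y y u = 1.
    rewrite innerZl ?innerZ//; try exact: hmod_l2.
    rewrite Eq ct -!realcM -realc1; congr (_%:C)%C; field; by rewrite gt_eqF.
  have := HB _ (vstate_states hy Uu y1).
  rewrite (_ : eval _ f = t * (t * inner x (lreg f x) u)).
    rewrite !normc_mul normc_real ger0_norm ?invr_ge0 ?(ltW q0)// mulrA -invfM.
    by rewrite ler_pdivrMl ?mulr_gt0// mulrC -expr2.
  rewrite -[f]/(val (SigSub (mem_set Xf) : X)) evE /vstate.
  rewrite [lreg _ y](Cc_kernel_scale t x gf) -lregE.
  have l1 := hmod_l2 u hx; have l2' := hmod_l2 u (hl _ hx).
  by rewrite innerZl ?innerZ//; [rewrite ct|exact: l2Z].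
move=> x r r0 hx Hx; apply: unif_bound_units => u Uu.
move: r0; rewrite le_eqVlt => /predU1P[r0|r0].
  rewrite -r0 in Hx; rewrite (mb0_eq Hx) lregE kop0; exact: unif_bound_zero.
set y := lreg f x; have hy : hmod y by exact: hl.
have [q q0 [Eq Hq]] := inner_self (hmod_l2 u hy).
apply/Hq; first by rewrite !mulr_ge0 ?(ltW r0).
move: q0; rewrite le_eqVlt => /predU1P[<-|q0].
  by rewrite !mulr_ge0 ?(ltW r0).
(* The vector [z] points along [y] and has fibre norm at most [r], so for [|s| = 1] the vector
   [s z + x] has fibre norm at most [2 r], and [<z, y> = r q]. Polarization gives
   [4 r q <= 4 B (2 r)^2], that is [q <= 4 B r]. *)
pose t : Cplx R := (r / q)%:C%C; pose z a := t * y a.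
have t0 : 0 <= r / q by rewrite divr_ge0 ?ltW.
have hz : hmod z by exact: hmodZ.
have Fy : fiber_bound u q y by apply/Hq; rewrite ?(ltW q0).
have Fz : fiber_bound u r z.
  have := fiber_boundZ t Fy; rewrite normc_real ger0_norm// mulfVK ?gt_eqF//.
have Iz : inner z y u = (r * q)%:C%C.
  rewrite innerZl; [|exact: hmod_l2..].
  by rewrite Eq conjc_realc -realcM; congr (_%:C)%C; field; rewrite gt_eqF.
pose i : Cplx R := 'i%C; have ni : normc i = 1.
  by rewrite /= expr0n expr1n add0r sqrtr1.
have ii : i * i = -1.
  by apply/eqP; rewrite eq_complex /=; apply/andP; split; apply/eqP; ring.
have ci : conjc i = - i by apply/eqP; rewrite eq_complex /= oppr0 !eqxx.
have bound s : normc s = 1 ->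
    normc (inner (fun a => s * z a + x a) (lreg f (fun a => s * z a + x a)) u) <=
    B * (r + r) ^+ 2.
  move=> s1; apply: Q => //.
  - by apply: hmodD => //; exact: hmodZ.
  - by rewrite addr_ge0 ?ltW.
  - apply: fiber_boundD; rewrite ?(ltW r0)//.
    by have := fiber_boundZ s Fz; rewrite s1 mul1r.
have expand s : inner (fun a => s * z a + x a) (lreg f (fun a => s * z a + x a)) u =
    conjc s * s * inner z (lreg f z) u + conjc s * inner z y u +
    s * inner x (lreg f z) u + inner x y u.
  rewrite [lreg f (fun a => _)](Cc_kernel_lin s z x gf) -!lregE -/y.
  have lz := hmod_l2 u hz; have lx := hmod_l2 u hx; have ly := hmod_l2 u hy.
  have lfz := hmod_l2 u (hl _ hz).
  rewrite innerDl//; [|apply: l2D => //; exact: l2Z|exact: l2Z].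
  rewrite innerZl//; [|apply: l2D => //; exact: l2Z].
  rewrite !innerD//; try exact: l2Z.
  by rewrite !innerZ//; ring.
have n1 : normc (1 : Cplx R) = 1 by exact: normc_one.
have nm s : normc (- s : Cplx R) = normc s by exact: normc_opp.
have b1 := bound 1 n1.
have b2 := bound (-1); rewrite nm n1 in b2; have {}b2 := b2 erefl.
have b3 := bound i ni.
have b4 := bound (- i); rewrite nm ni in b4; have {}b4 := b4 erefl.
rewrite !expand in b1 b2 b3 b4.
set Q1 := (X in normc X <= _) in b1; set Q2 := (X in normc X <= _) in b2.
set Q3 := (X in normc X <= _) in b3; set Q4 := (X in normc X <= _) in b4.
have polar : Q1 - Q2 + i * (Q3 - Q4) = 4 * inner z y u.
  rewrite /Q1 /Q2 /Q3 /Q4 !conjc_opp conjc_one ci.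
  set A := inner z (lreg f z) u; set C := inner z y u.
  set D := inner x (lreg f z) u; set E := inner x y u.
  transitivity (2 * C + 2 * D - (i * i) * (2 * C - 2 * D)); first by ring.
  by rewrite ii; ring.
have : normc (4 * inner z y u) <= 4 * (B * (r + r) ^+ 2).
  rewrite -polar; apply: le_trans (normcD_le _ _) _.
  have := normcB_le Q1 Q2; have := normcB_le Q3 Q4; rewrite normc_mul ni mul1r.
  by lra.
rewrite normc_mul Iz normc_real ger0_norm; last by rewrite mulr_ge0 ?ltW.
have -> : normc (4 : Cplx R) = 4.
  have -> : (4 : Cplx R) = 4%:C%C by rewrite !realcD realc1.
  by rewrite normc_real ger0_norm.
rewrite ler_pM2l// (_ : B * (r + r) ^+ 2 = r * (4 * B * r)); last by ring.
by rewrite ler_pM2l.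
Qed.

(** * Compactness of the state space and the Monge-Kantorovich distance *)

Variable L : (G -> Cplx R) -> \bar R.

Lemma Xsub_gunit f g z : X f -> X g -> X (fun a => f a - g a - z * gunit a).
Proof. by move=> Xf Xg; apply: Xsub; [exact: Xsub|exact/Xscale/Xgunit]. Qed.

Lemma eval_sub_gunit w f g z : states w -> X f -> X g ->
  eval w (fun a => f a - g a - z * gunit a) = eval w f - eval w g - z.
Proof.
move=> sw Xf Xg; rewrite (eval_sub sw (Xsub Xf Xg) (Xscale z Xgunit)).
by rewrite (eval_sub sw Xf Xg) (eval_scale z sw Xgunit) eval_gunit// mulr1.
Qed.

Lemma eval_bounded f : X f ->
  exists2 M, 0 <= M & forall w, states w -> normc (eval w f) <= M.
Proof.
move=> Xf; have [c c0 H] := Cc_kernel_ob (Cc_kernel_lregk (XCc Xf)).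
have c1 : 0 < c + 1 by rewrite ltr_wpDl.
exists (4 * (c + 1)); first by rewrite mulr_ge0// ltW.
move=> w sw; apply: eval_bound => //; apply: op_bound_le H => //; lra.
Qed.

Lemma continuous_eval (x : X) : continuous (fun w : functional X => w x : Cplx R).
Proof. exact: (@proj_continuous X (fun=> Cplx R) x). Qed.

Lemma near_eval (w : functional X) (x : X) e : 0 < e ->
  \forall v \near w, normc (w x - v x) < e.
Proof.
move=> e0; have cv := @continuous_eval x w.
exact: (iffLR (@cvgcP R (functional X) (nbhs w) (nbhs_filter w)
  (fun v : functional X => v x) (w x)) cv e e0).
Qed.

Lemma closed_zeros (T : topologicalType) (phi : T -> Cplx R) : continuous phi ->
  closed [set y | phi y = 0].
Proof.
move=> cp; rewrite (_ : [set y | _] = (fun y => normc (phi y)) @^-1` [set r | r <= 0]).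
  apply: closed_comp; last exact: closed_le.
  move=> y _; apply: (@continuous_comp _ _ _ phi (fun z : Cplx R => normc z)).
    exact: cp.
  exact: continuous_normc.
apply/seteqP; split=> [y /= ->|y /= H]; first by rewrite normc_zero.
by apply/eqP; rewrite -normc_eq0 eq_le H normc_ge0.
Qed.

(** Every defining condition involves finitely many evaluations, which are continuous. Nonnegativity
    in [R[i]] splits into a vanishing imaginary part and a nonnegative real part. *)
Lemma states_closed : closed (@states R G X).
Proof.
pose D1 := [set p : Cplx R * X * X * X |
  forall a, val p.2 a = p.1.1.1 * val p.1.1.2 a + val p.1.2 a].
have -> : @states R G X =
    \bigcap_(p in D1) [set w : functional X |
      w p.2 - (p.1.1.1 * w p.1.1.2 + w p.1.2) = 0] `&`
    (\bigcap_(x in [set x : X | Cred_pos (val x)]) [set w : functional X |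
      (complex.Im (w x))%:C%C = 0 :> Cplx R] `&`
     \bigcap_(x in [set x : X | Cred_pos (val x)])
       ((fun w : functional X => complex.Re (w x)) @^-1` [set r | 0 <= r])) `&`
    \bigcap_(x in [set x : X | val x = gunit]) [set w : functional X | w x - 1 = 0].
  apply/seteqP; split=> [w [lw pw uw]|w [[H1 [H2 H3]] H4]].
    split; [split; [|split]|].
    - by move=> [[[c x] y] z] /= /lw ->; rewrite subrr.
    - by move=> x /= /pw; rewrite lecE /= => /andP[/eqP -> _].
    - by move=> x /= /pw; rewrite lecE /= => /andP[_].
    - by move=> x /= /uw ->; rewrite subrr.
  split.
  - move=> c x y z E; apply/eqP; rewrite -subr_eq0; apply/eqP.
    exact: (H1 (c, x, y, z) E).
  - move=> x px; rewrite lecE /=; have -> : 0 <= complex.Re (w x) by exact: H3.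
    by have [->] := H2 x px; rewrite eqxx.
  - by move=> x ux; apply/eqP; rewrite -subr_eq0; apply/eqP; exact: H4.
have cv (x : X) (w : functional X) :
    (fun v : functional X => v x : Cplx R) @ nbhs w --> (w x : Cplx R).
  exact: (@continuous_eval x w).
apply: closedI; [apply: closedI; [|apply: closedI]|]; apply: closed_bigI.
- move=> [[[c x] y] z] _.
  apply: (@closed_zeros _ (fun w : functional X => w z - (c * w x + w y))) => w.
  have cf := nbhs_filter w.
  have cc : (fun v : functional X => c) @ nbhs w --> c by exact: cvg_cst.
  have cx := @cvgcM R _ _ cf (fun v : functional X => c) (fun v : functional X => v x)
    _ _ cc (cv x w).
  have cxy := @cvgcD R _ _ cf (fun v : functional X => c * v x)
    (fun v : functional X => v y) _ _ cx (cv y w).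
  exact: (@cvgcB R _ _ cf (fun v : functional X => v z)
    (fun v : functional X => c * v x + v y) _ _ (cv z w) cxy).
- move=> x _; apply: (@closed_zeros _ (fun w : functional X =>
    (complex.Im (w x))%:C%C)) => w.
  have ci := @continuous_comp _ _ _ (fun v : functional X => v x : Cplx R)
    (fun y : Cplx R => complex.Im y) w (cv x w) (@continuous_Im R (w x)).
  exact: (@continuous_comp _ _ _ (fun v : functional X => complex.Im (v x))
    (fun r : R => r%:C%C : Cplx R) w ci (@continuous_realc R _)).
- move=> x _; apply: closed_comp; last exact: closed_ge.
  move=> w _; exact: (@continuous_comp _ _ _ (fun v : functional X => v x : Cplx R)
    (fun y : Cplx R => complex.Re y) w (cv x w) (@continuous_Re R (w x))).
- move=> x _; apply: (@closed_zeros _ (fun w : functional X => w x - 1)) => w.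
  have cf := nbhs_filter w.
  have c1 : (fun v : functional X => 1 : Cplx R) @ nbhs w --> (1 : Cplx R).
    exact: cvg_cst.
  exact: (@cvgcB R _ _ cf (fun v : functional X => v x) (fun v : functional X => 1)
    _ _ (cv x w) c1).
Qed.

(** Banach-Alaoglu: each evaluation is bounded over all states, so the states form a closed subset
    of a product of compact rectangles. *)
Lemma states_compact : compact (@states R G X).
Proof.
have /choice[M HM] : forall x : X, exists M, forall w : functional X, states w ->
  normc (w x) <= M.
  move=> x; have [M _ HM] := eval_bounded (set_valP x); exists M => w /HM.
  by rewrite evE.
have cB : compact [set w : functional X | forall x,
    [set z : Cplx R | `|complex.Re z| <= M x /\ `|complex.Im z| <= M x] (w x)].
  apply: (@tychonoff X (fun=> Cplx R) (fun x => [set z : Cplx R |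
    `|complex.Re z| <= M x /\ `|complex.Im z| <= M x])) => x.
  exact: compact_rectangle.
apply: (subclosed_compact states_closed cB) => w sw x; split.
  exact: le_trans (normc_Re _) (HM x w sw).
exact: le_trans (normc_Im _) (HM x w sw).
Qed.

Let E : set (G -> Cplx R) := [set f | X f /\ (L f <= 1)%E].

Lemma mk_dist_ge0 w v : (0 <= mk_dist L w v)%E.
Proof. by apply: ereal_sup_ubound; right. Qed.

Lemma mk_dist_elim w v c f : (mk_dist L w v <= c%:E)%E -> E f ->
  normc (eval w f - eval v f) <= c.
Proof.
move=> H [Xf Lf]; rewrite -lee_fin; apply: le_trans H.
apply: ereal_sup_ubound; left; exists (SigSub (mem_set Xf) : X) => //.
by rewrite -!evE.
Qed.

Lemma mk_dist_intro w v c : 0 <= c ->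
  (forall f, E f -> normc (eval w f - eval v f) <= c) -> (mk_dist L w v <= c%:E)%E.
Proof.
move=> c0 H; apply: ge_ereal_sup => _ [[x Lx <-]|->]; last by rewrite lee_fin.
by rewrite lee_fin -!evE; apply: H; split=> //; exact: set_valP.
Qed.

(** Total boundedness of the image of [F] in the quotient by the scalars. The centres lie in [F], so
    that the estimates valid on [F] apply to them too. *)
Definition mod1_totally_bounded (F : set (G -> Cplx R)) := forall e, 0 < e ->
  exists (m : nat) (A : 'I_m -> (G -> Cplx R)), (forall i, F (A i)) /\
    forall f, F f -> exists i (c : Cplx R),
      op_bound e (lreg (fun a => f a - A i a - c * gunit a)).

Lemma cqms_totally_bounded : compact_quantum_metric_space X L -> mod1_totally_bounded E.
Proof.
move=> [_ _ fin [_ top]] e e0.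
(* Without states the numerical radius bound holds with constant 0, and any single element of [E] is
   a net. *)
have [[w0 sw0]|ns] := pselect (exists w, @states R G X w); last first.
  have [//|m [A [EA HA]]] := @cells R nat _ E [::] (fun _ _ => 0) 1 ltr01.
  exists m, A; split=> // f Ef; have [i _] := HA f Ef; exists i, 0.
  have Xh := Xsub_gunit 0 Ef.1 (EA i).1.
  apply: op_bound_le (numerical_radius Xh (lexx 0) _); rewrite ?mulr0 ?(ltW e0)//.
  by move=> w sw; exfalso; apply: ns; exists w.
(* Three errors of size [dl] add up to [e / 4], and passing from states to the operator bound costs
   a factor 4. *)
pose dl := e / 12; have dl0 : 0 < dl by rewrite divr_gt0.
pose B w := [set v : functional X | states v -> fine (mk_dist L w v) < dl].
have nB w : states w -> nbhs w (B w).
  move=> sw; have [_ H] := top w sw [set v | fine (mk_dist L w v) < dl].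
  by apply: H; exists dl.
have mkB w v : states w -> states v -> B w v -> (mk_dist L w v <= dl%:E)%E.
  move=> sw sv /(_ sv); have := mk_dist_ge0 w v; have := fin w v sw sv.
  by case: (mk_dist L w v) => [r _ _ /=|//|//]; rewrite lee_fin => /ltW.
have [D' [sub cov]] := compact_finite_cover states_compact nB.
have [w wD|m [A [EA HA]]] := @cells R (functional X) _ E D'
    (fun w f => eval w f - eval w0 f) dl dl0.
  have sw : states w by exact: sub.
  have := mk_dist_ge0 w w0; have := fin w w0 sw sw0.
  case Ek: (mk_dist L w w0) => [r|//|//] _ _; exists r => f Ef.
  by apply: mk_dist_elim Ef; rewrite Ek.
exists m, A; split=> // f Ef; have [i Hi] := HA f Ef.
(* This scalar makes the difference vanish at the reference state [w0]. The cells record values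
   relative to [w0] because only such differences are bounded on [E]. *)
exists i, (eval w0 f - eval w0 (A i)).
have Xf := Ef.1; have XA := (EA i).1.
have e4 : 0 <= e / 4 by rewrite divr_ge0// ltW.
have ee : 4 * (e / 4) = e by lra.
rewrite -[e in op_bound e _]ee; apply: numerical_radius => //; first exact: Xsub_gunit.
move=> v sv; rewrite eval_sub_gunit//; have [w wD Bv] := cov v sv.
have sw : states w by exact: sub.
have mk := mkB w v sw sv Bv.
have m1 := mk_dist_elim mk Ef; have m2 := mk_dist_elim mk (EA i).
have m3 := Hi w wD.
have -> : eval v f - eval v (A i) - (eval w0 f - eval w0 (A i)) =
    - (eval w f - eval v f) + (eval w (A i) - eval v (A i)) +
    (eval w f - eval w0 f - (eval w (A i) - eval w0 (A i))) by ring.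
apply: le_trans (normcD_le _ _) _;
  have := normcD_le (- (eval w f - eval v f)) (eval w (A i) - eval v (A i)).
rewrite normc_opp; move: m1 m2 m3; rewrite /dl; lra.
Qed.

Lemma totally_bounded_cqms : slip_norm X L -> mod1_totally_bounded E ->
  compact_quantum_metric_space X L.
Proof.
move=> slip tbE; have [Lfin _ Lhom _ _] := slip.
(* The scalar [c] cancels in the difference of two states, and each state contributes [4 e] on the
   remainder. *)
have key e : 0 < e -> exists (m : nat) (A : 'I_m -> G -> Cplx R),
    (forall i, E (A i)) /\ forall f w v, states w -> states v -> E f ->
      exists i, normc (eval w f - eval v f) <=
        normc (eval w (A i) - eval v (A i)) + 8 * e.
  move=> e0; have [m [A [EA HA]]] := tbE e e0; exists m, A; split=> // f w v sw sv Ef.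
  have [i [c Hc]] := HA f Ef; exists i.
  have Xh := Xsub_gunit c Ef.1 (EA i).1.
  have b1 := eval_bound sw Xh e0 Hc; have b2 := eval_bound sv Xh e0 Hc.
  rewrite (eval_sub_gunit c sw Ef.1 (EA i).1) in b1.
  rewrite (eval_sub_gunit c sv Ef.1 (EA i).1) in b2.
  have -> : eval w f - eval v f = (eval w (A i) - eval v (A i)) +
      (eval w f - eval w (A i) - c - (eval v f - eval v (A i) - c)) by ring.
  apply: le_trans (normcD_le _ _) _.
  have := normcB_le (eval w f - eval w (A i) - c) (eval v f - eval v (A i) - c).
  by move: b1 b2; lra.
have fin w v : states w -> states v -> exists2 c, 0 <= c & mk_dist L w v = c%:E.
  move=> sw sv; have [m [A [EA HA]]] := key 1 ltr01.
  pose F i := normc (eval w (A i) - eval v (A i)).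
  have F0 i : 0 <= F i by exact: normc_ge0.
  have : (mk_dist L w v <= (\sum_i F i + 8)%:E)%E.
    apply: mk_dist_intro; first by rewrite addr_ge0// sumr_ge0.
    move=> f Ef; have [i Hi] := HA f w v sw sv Ef; apply: le_trans Hi _.
    rewrite mulr1 lerD2r (bigD1 i)//= lerDl sumr_ge0//.
  have := mk_dist_ge0 w v.
  by case: (mk_dist L w v) => [r|//|//]; exists r.
have mkE w v c : states w -> states v -> 0 <= c ->
    fine (mk_dist L w v) <= c <-> (mk_dist L w v <= c%:E)%E.
  by move=> sw sv c0; have [r r0 ->] := fin w v sw sv; rewrite lee_fin.
have mkS w v : mk_dist L w v = mk_dist L v w.
  rewrite /mk_dist; congr esup0; apply/seteqP.
  by split=> _ [x Lx <-]; exists x => //; rewrite normcBC.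
(* A positive multiple of [f] lies in [E], so the distance controls every evaluation. This gives
   separation of states and the weak* continuity of evaluations along metric balls. *)
have point f : X f -> exists2 s, 0 < s & forall w v c, states w -> states v ->
    0 <= c -> (mk_dist L w v <= c%:E)%E -> normc (eval w f - eval v f) <= s * c.
  move=> Xf; have [L0 Loo] := Lfin f Xf.
  have [r Er] : exists r, L f = r%:E by case: (L f) L0 Loo => [r|//|//]; exists r.
  have r0 : 0 <= r by rewrite -lee_fin -Er.
  have p : 0 < r + 1 by rewrite ltr_wpDl.
  exists (r + 1) => // w v c sw sv c0 mk; pose g a := ((r + 1)^-1)%:C%C * f a.
  have Eg : E g.
    split; first exact: Xscale.
    rewrite /g Lhom// Er normc_real ger0_norm ?invr_ge0 ?(ltW p)// -EFinM lee_fin.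
    by rewrite mulrC ler_pdivrMr// mul1r lerDl.
  have := mk_dist_elim mk Eg; rewrite /g !eval_scale// -mulrBr normc_mul normc_real.
  by rewrite ger0_norm ?invr_ge0 ?(ltW p)// ler_pdivrMl.
split=> //; first by move=> w v sw sv; have [c _ ->] := fin w v sw sv; rewrite ltry.
split.
  split.
  - by move=> w v sw sv; have [c c0 ->] := fin w v sw sv.
  - move=> w v sw sv; split=> [m0|->].
      apply/funext => x; rewrite -!evE; have [s s0 Hs] := point _ (set_valP x).
      apply/eqP; rewrite -subr_eq0 -normc_eq0 eq_le normc_ge0 andbT.
      by rewrite -(mulr0 s); apply: Hs => //; apply/mkE; rewrite ?m0.
    apply/eqP; rewrite eq_le; apply/andP; split; last first.
      by have [c c0 ->] := fin v v sv sv.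
    apply/mkE => //; apply: mk_dist_intro => // f _.
    by rewrite subrr normc_zero.
  - by move=> w v _ _; rewrite mkS.
  - move=> w v z sw sv sz; have [c c0 Ec] := fin w v sw sv.
    have [c' c'0 Ec'] := fin v z sv sz; rewrite Ec Ec' /=.
    apply/mkE => //; first exact: addr_ge0.
    apply: mk_dist_intro; first exact: addr_ge0.
    move=> f Ef; rewrite -(subrK (eval v f) (eval w f)) -addrA.
    apply: le_trans (normcD_le _ _) _; apply: lerD.
      by apply: mk_dist_elim Ef; rewrite Ec.
    by apply: mk_dist_elim Ef; rewrite Ec'.
move=> w sw B; split=> [nB|[r r0 HB]].
  (* The filter of metric balls about [w]: evaluations converge along it, hence it is finer than the
     weak* neighbourhood filter. *)
  pose F : set_system (functional X) := [set S | exists2 r, 0 < r &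
    forall v, states v -> fine (mk_dist L w v) < r -> S v].
  have FF : Filter F.
    split; first by exists 1.
    - move=> P Q [r r0 HP] [s s0 HQ]; exists (Num.min r s).
        by rewrite lt_min r0 s0.
      by move=> v sv; rewrite lt_min => /andP[vr vs]; split; [exact: HP|exact: HQ].
    - by move=> P Q PQ [r r0 HP]; exists r => // v sv vr; apply/PQ/HP.
  have pw (x : X) : (fun v : functional X => v x : Cplx R) @ F --> (w x : Cplx R).
    apply/cvgcP => e e0.
    have [s s0 Hs] := point _ (set_valP x).
    have es : 0 < e / (2 * s) by rewrite divr_gt0// mulr_gt0.
    exists (e / (2 * s)) => // v sv /ltW /(mkE _ _ _ sw sv (ltW es)).
    move=> /(Hs _ _ _ sw sv (ltW es)); rewrite !evE => /le_lt_trans; apply.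
    rewrite (_ : s * _ = e / 2); first lra.
    by field; rewrite gt_eqF.
  have [r r0 Hr] := ptws_cvg FF pw nB; exists r => // v sv vr.
  exact: Hr.
have r4 : 0 < r / 4 by rewrite divr_gt0.
(* The error [8 (r / 32)] is [r / 4]; the weak* neighbourhood fixes the net up to another
   [r / 4]. *)
have [m [A [EA HA]]] := key (r / 32) (divr_gt0 r0 (ltr0n _ 32)).
have : \forall v \near w, forall i, i \in enum 'I_m ->
    normc (w (SigSub (mem_set (EA i).1)) - v (SigSub (mem_set (EA i).1))) < r / 4.
  by apply: (@near_seq _ _ (nbhs w) (nbhs_filter w)) => i _; exact: near_eval.
apply: (@filterS _ (nbhs w) (nbhs_filter w)) => v Hv sv; apply: HB => //.
apply: (@le_lt_trans _ _ (r / 2)); last by rewrite ltr_pdivrMr// mulr_natr mulr2n ltrDl.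
apply/mkE => //; first by rewrite divr_ge0// ltW.
apply: mk_dist_intro; first by rewrite divr_ge0// ltW.
move=> f Ef; have [i Hi] := HA f w v sw sv Ef; apply: le_trans Hi _.
have := Hv i (mem_enum _ i); rewrite -!evE /=; lra.
Qed.

End States.

(** * Metric stratifications *)

Section Stratified.
Variables (d : G -> G -> R) (I : countType) (K : I -> set G) (n : nat).
Hypothesis K_strat : metric_stratification d K.
Hypothesis n_ge1 : (1 <= n)%N.
Implicit Types (f g phi : G -> Cplx R) (i j : I).

Let ds := dstrat d.
Let X := LipC d K.
Let L := total_seminorm d K ell n.

Lemma K_cover a : exists i, K i a.
Proof.
case: K_strat => cov _ _ _ _; have : [set: G] a by [].
by rewrite -cov => -[i _ Ka]; exists i.
Qed.

Lemma K_disjoint i j a : K i a -> K j a -> i = j.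
Proof.
move=> Ki Kj; case: K_strat => _ dis _ _ _; apply: contrapT => /dis E.
by have : (K i `&` K j) a by []; rewrite E.
Qed.

Lemma K_open i : open (K i).
Proof. by case: K_strat => _ _ /(_ i)[]. Qed.

Lemma K_units : exists e, K e = @units G.
Proof. by case: K_strat. Qed.

Lemma K_inv i : exists j, forall a, K i a -> K j (ginv a).
Proof.
case: K_strat => _ _ _ _ [/(_ i)[j E] _]; exists j => a Ka.
by rewrite E; exists a.
Qed.

Lemma ds_ge0 i a b : K i a -> K i b -> 0 <= ds a b.
Proof. by case: K_strat => _ _ _ _ [_ /(_ i)[[+ _ _ _] _]]; exact. Qed.

Lemma ds_gt0 i a b : K i a -> K i b -> a <> b -> 0 < ds a b.
Proof.
move=> Ka Kb ab; rewrite lt_neqAle (ds_ge0 Ka Kb) andbT eq_sym; apply/eqP.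
by case: K_strat => _ _ _ _ [_ /(_ i)[[_ + _ _] _]] => /(_ a b Ka Kb)[+ _] => /[apply].
Qed.

Lemma dsV a b : ds (ginv a) (ginv b) = ds a b.
Proof. by rewrite /ds /dstrat !gsourceV !grangeV maxC. Qed.

(** The unit space is one of the strata and distinct strata are disjoint, so a stratum meeting it
    coincides with it. *)
Lemma K_gunit i a b : K i a -> K i b -> gunit a = gunit b :> Cplx R.
Proof.
have [e Ke] := K_units => Ka Kb.
have H x y : K i x -> K i y -> units x -> units y.
  move=> Kx Ky; rewrite -Ke => Kex; by rewrite -(K_disjoint Kx Kex).
have [U|U] := pselect (units a); first by rewrite !gunit1//; exact: H U.
by rewrite !gunit0// => U'; apply: U; exact: H U'.
Qed.

Lemma LLip_leP f c : 0 <= c -> (LLip d K f <= c%:E)%E <->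
  forall i a b, K i a -> K i b -> normc (f a - f b) <= c * ds a b.
Proof.
move=> c0; split=> [H i a b Ka Kb|H].
  have [->|ab] := eqVneq a b.
    by rewrite subrr normc_zero mulr_ge0// (ds_ge0 Kb Kb).
  have p := ds_gt0 Ka Kb (elimN eqP ab).
  rewrite -ler_pdivrMr// -lee_fin; apply: le_trans H.
  apply: (@le_trans _ _ (LLip_on d K i f)).
    apply: ereal_sup_ubound; left; exists (a, b) => //.
    by split=> //; exact/eqP.
  by apply: ereal_sup_ubound; left; exists i.
apply: ge_ereal_sup => _ [[i _ <-]|->]; last by rewrite lee_fin.
apply: ge_ereal_sup => _ [[[a b] /= [Ka Kb ab] <-]|->]; last by rewrite lee_fin.
by rewrite lee_fin /= ler_pdivrMr ?(ds_gt0 Ka Kb ab)//; exact: (H i a b Ka Kb).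
Qed.

Lemma LLip_ge0 f : (0 <= LLip d K f)%E.
Proof. by apply: ereal_sup_ubound; right. Qed.

Lemma LLip_fin f : X f -> exists2 c, 0 <= c & LLip d K f = c%:E.
Proof.
move=> [_]; have := LLip_ge0 f.
by case: (LLip d K f) => [c c0 _|//|//]; exists c.
Qed.

Lemma LLip_lin z f g c c' : 0 <= c -> 0 <= c' -> (LLip d K f <= c%:E)%E ->
  (LLip d K g <= c'%:E)%E ->
  (LLip d K (fun a => z * f a + g a)%R <= (normc z * c + c')%:E)%E.
Proof.
move=> c0 c'0 /(LLip_leP _ c0) Hf /(LLip_leP _ c'0) Hg; apply/LLip_leP.
  by rewrite addr_ge0// mulr_ge0// normc_ge0.
move=> i a b Ka Kb; have Hfi := Hf i a b Ka Kb; have Hgi := Hg i a b Ka Kb.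
have -> : z * f a + g a - (z * f b + g b) = z * (f a - f b) + (g a - g b) by ring.
apply: le_trans (normcD_le _ _) _; rewrite normc_mul mulrDl lerD// -mulrA.
by apply: ler_wpM2l => //; exact: normc_ge0.
Qed.

(** Inversion maps each stratum into a stratum and merely swaps the two terms of the maximum in
    [ds]. *)
Lemma LLip_star f : (LLip d K (gstar f) <= LLip d K f)%E.
Proof.
have := LLip_ge0 f; case E: (LLip d K f) => [c||//]; last by move=> _; rewrite leey.
rewrite lee_fin => c0; apply/LLip_leP => // i a b Ka Kb.
have [j Kj] := K_inv i.
rewrite /gstar -conjc_opp -conjc_add normc_conj -dsV.
by apply: (iffLR (LLip_leP f c0) _ j); rewrite ?E//; exact: Kj.
Qed.

Lemma LLip_gunit : LLip d K (gunit : G -> Cplx R) = 0%E.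
Proof.
apply/eqP; rewrite eq_le LLip_ge0 andbT; apply/LLip_leP => // i a b Ka Kb.
by rewrite (K_gunit Ka Kb) subrr normc_zero mul0r.
Qed.

Lemma LipC_operator_system : operator_system X.
Proof.
split.
- by move=> f [].
- by split; [exact: Cc_gunit|rewrite LLip_gunit ltry].
- move=> z f g Xf Xg; have [c c0 Ec] := LLip_fin Xf; have [c' c'0 Ec'] := LLip_fin Xg.
  split; first by apply: CcD; [exact/CcZ/Xf.1|exact: Xg.1].
  apply: (@le_lt_trans _ _ (normc z * c + c')%:E); last exact: ltry.
  by apply: LLip_lin; rewrite ?Ec ?Ec'.
- move=> f [Cf Lf]; split; first exact: Cc_star.
  exact: le_lt_trans (LLip_star f) Lf.
Qed.

Lemma total_fin f : X f -> exists2 c, 0 <= c & L f = c%:E.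
Proof.
move=> Xf; have [c c0 Ec] := LLip_fin Xf; have [c' c'0 Ec'] := Lell_fin n Xf.1.
exists (Num.max c' c); first by rewrite le_max c0 orbT.
by rewrite /L /total_seminorm Ec Ec' EFin_max.
Qed.

Lemma total_leP f c : (L f <= c%:E)%E <->
  (Lell ell n f <= c%:E)%E /\ (LLip d K f <= c%:E)%E.
Proof. by rewrite /L /total_seminorm ge_max; split=> [/andP[]|[-> ->]]. Qed.

Lemma total_scale_le z f : X f ->
  (L (fun a => z * f a)%R <= (normc z)%:E * L f)%E.
Proof.
move=> Xf; have [c c0 Ec] := total_fin Xf; rewrite Ec -EFinM.
have [H1 H2] : (Lell ell n f <= c%:E)%E /\ (LLip d K f <= c%:E)%E.
  by apply/total_leP; rewrite Ec.
apply/total_leP; split.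
  apply: le_trans (LellZ_le n z Xf.1) _; rewrite EFinM.
  by apply: lee_wpmul2l => //; rewrite lee_fin normc_ge0.
have L0 : (LLip d K ((fun=> 0%R) : G -> Cplx R) <= 0%:E)%E.
  by apply/LLip_leP => // i a b _ _; rewrite subrr normc_zero mul0r.
have := LLip_lin z c0 (lexx 0) H2 L0; rewrite addr0.
by under eq_fun do rewrite addr0.
Qed.

Lemma total_slip_norm : slip_norm X L.
Proof.
have opX := LipC_operator_system; split.
- by move=> f /total_fin[c c0 ->]; rewrite lee_fin ltry.
- move=> f g Xf Xg; have [c c0 Ec] := total_fin Xf; have [c' c'0 Ec'] := total_fin Xg.
  have [H1 H2] : (Lell ell n f <= c%:E)%E /\ (LLip d K f <= c%:E)%E.
    by apply/total_leP; rewrite Ec.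
  have [H3 H4] : (Lell ell n g <= c'%:E)%E /\ (LLip d K g <= c'%:E)%E.
    by apply/total_leP; rewrite Ec'.
  rewrite Ec Ec' -EFinD; apply/total_leP; split.
    by apply: le_trans (LellD n Xf.1 Xg.1) _; rewrite EFinD leeD.
  have := LLip_lin 1 c0 c'0 H2 H4; rewrite normc_one mul1r.
  by under eq_fun do rewrite mul1r.
- move=> z f Xf; apply/eqP; rewrite eq_le total_scale_le//=.
  have [c c0 Ec] := total_fin Xf; have Xz := Xscale opX z Xf.
  have [c' c'0 Ec'] := total_fin Xz; rewrite Ec Ec' -EFinM lee_fin.
  have [->|z0] := eqVneq z 0; first by rewrite normc_zero mul0r.
  (* The missing inequality is the one already shown, for the scalar [z^-1] and the function
     [z f]. *)
  have := total_scale_le z^-1 Xz.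
  rewrite (_ : (fun a => z^-1 * (z * f a))%R = f); last first.
    by apply/funext => a; rewrite mulKf.
  have p : 0 < normc z by rewrite lt_neqAle eq_sym normc_eq0 z0 normc_ge0.
  rewrite Ec Ec' -EFinM lee_fin (_ : normc z^-1 = (normc z)^-1).
    by rewrite mulrC ler_pdivlMr// mulrC.
  exact: ComplexField.Normc.normcV.
- move=> f Xf; rewrite /L /total_seminorm Lell_star; last exact: Xf.1.
  congr maxe; apply/eqP; rewrite eq_le LLip_star/=.
  by rewrite -{1}(gstarK f) LLip_star.
- by rewrite /L /total_seminorm LLip_gunit Lell_gunit// maxxx.
Qed.

(** * Approximation by multipliers *)

Let E := seminorm_ball d K ell n.

(** On functions supported in a fixed length ball the reduced norm is dominated by the supremum
    norm. Both implications pass from pointwise to norm estimates in this way. *)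
Lemma lreg_ball t : 0 <= t -> exists F : nat, forall c f, 0 <= c ->
  (forall a, normc (f a) <= c) -> (forall a, f a != 0 -> ell a <= t) ->
  op_bound (c * F%:R) (lreg f).
Proof.
move=> t0; have [F HF] := kernel_op_schur t0; exists F => c f c0 fc ft x r r0 _ Hx.
apply: HF => // a m _; split; [exact: fc|exact: ft].
Qed.

Lemma mult_gunit phi c : mult_unital phi ->
  (fun a => phi a * (c * gunit a)) = fun a => c * gunit a.
Proof.
move=> up; apply/funext => a; have := congr1 (fun f => f a) up.
by rewrite /mult mulrCA => ->.
Qed.

Lemma seminorm_ball_totally_bounded : (forall e : R, 0 < e ->
  exists phi, [/\ Cc phi, mult_unital phi &
    forall f, E f -> op_bound e (lreg (fun a => f a - phi a * f a))]) ->
      mod1_totally_bounded E.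
Proof.
move=> H e e0.
(* Without units there are no fibres, and every operator has norm zero. *)
have [[u0 Uu0]|nu] := pselect (exists u0, @units G u0); last first.
  have [//|m [A [EA HA]]] := @cells R nat _ E [::] (fun _ _ => 0) 1 ltr01.
  exists m, A; split=> // f Ef; have [i _] := HA f Ef; exists i, 0.
  move=> x r _ _ _; apply: unif_bound_units => u Uu; exfalso; apply: nu; by exists u.
have e4 : 0 < e / 4 by rewrite divr_gt0.
have [phi [Cphi up Hphi]] := H _ e4.
have [c0 [t [c00 t0 _ phic phit]]] := Cc_elim Cphi.
have [F HF] := lreg_ball t0.
have /choice[ix Hix] := K_cover.
have [s [_ cov]] := @compact_finite_cover _ (lball ell t) (fun a => K (ix a))
  (ell_proper t0) (fun a _ => open_nbhs_nbhs (conj (K_open (ix a)) (Hix a))).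
pose C := c0 * F%:R; have C0 : 0 <= C by rewrite mulr_ge0.
have C1 : 0 < C + 1 by rewrite ltr_wpDl.
(* Chosen so that [C (3 dl) <= e / 2]; the two errors [e / 4] from [Hphi] complete the sum to
   [e]. *)
pose dl := e / (6 * (C + 1)); have dl0 : 0 < dl by rewrite divr_gt0// mulr_gt0.
have /choice[net Hnet] : forall y : G, exists N : seq G,
    (forall p, p \in N -> K (ix y) p) /\
    forall a, K (ix y) a -> exists2 p, p \in N & ds a p < dl.
  move=> y; case: K_strat => _ _ _ _ [_ /(_ (ix y))[_ /(_ dl dl0)[N [fN sN HN]]]].
  have memN p : (p \in finmap.enum_fset (fset_set N)) =
    (p \in N) by rewrite in_fset_set.
  exists (finmap.enum_fset (fset_set N)); split=> [p|a /HN[p Np ap]].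
    by rewrite memN inE => /sN.
  by exists p => //; rewrite memN inE.
pose P := flatten [seq net y | y <- s].
(* On units the value is compared with that at [u0] inside one stratum, by the Lipschitz bound; off
   units [ell p] is positive and [ell^n |f| <= 1] applies. *)
have bnd p : p \in P -> exists M, forall f, E f ->
    normc (f p - f u0 * gunit p) <= M.
  move=> _; have [Up|Up] := pselect (units p).
    exists (ds p u0) => f [_ /total_leP[_ /(LLip_leP _ ler01) Lf]].
    rewrite gunit1// mulr1; have [k Kk] := K_units.
    by have := Lf k p u0; rewrite mul1r Kk; apply.
  exists ((ell p ^+ n)^-1) => f [Xf /total_leP[Lf _]].
  rewrite gunit0// mulr0 subr0.
  have := Lell_ge p Xf.1 ler01 Lf.
  by rewrite -ler_pdivlMl ?mulr1// exprn_gt0// ell_gt0.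
have [m [A [EA HA]]] := @cells R _ _ E P (fun p f => f p - f u0 * gunit p) dl dl0 bnd.
exists m, A; split=> // f Ef; have [k Hk] := HA f Ef; set x := A k in Hk *.
have Ex : E x by exact: EA.
exists k, (f u0 - x u0); pose h a := f a - x a - (f u0 - x u0) * gunit a.
have [Cf Cx] : Cc f /\ Cc x by split; [exact: Ef.1.1|exact: Ex.1.1].
have Ch : Cc h by apply: CcB; [exact: CcB|apply/CcZ/Cc_gunit].
(* One [dl] comes from the cell at the net point [p], two from moving [f] and [x] from [a] to [p];
   the scalar part does not change within a stratum. *)
have hdl a : ell a <= t -> normc (h a) <= 3 * dl.
  move=> at_; have [y ys Ky] := cov a at_.
  have [HN1 HN2] := Hnet y; have [p pN ap] := HN2 a Ky.
  have Kp := HN1 p pN.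
  have pP : p \in P by apply/flatten_mapP; exists y.
  have b1 : normc (h p) <= dl.
    apply: le_trans (Hk p pP); rewrite le_eqVlt; apply/orP; left; apply/eqP.
    by congr normc; rewrite /h -/x; ring.
  have L1 g : E g -> normc (g a - g p) <= ds a p.
    move=> [_ /total_leP[_ /(LLip_leP _ ler01) Lg]].
    by have := Lg (ix y) a p Ky Kp; rewrite mul1r.
  have b2 := L1 f Ef; have b3 := L1 x Ex.
  have -> : h a = h p + ((f a - f p) - (x a - x p)).
    by rewrite /h (K_gunit Ky Kp); ring.
  apply: le_trans (normcD_le _ _) _.
  have := normcB_le (f a - f p) (x a - x p).
  by move: b1 b2 b3 ap; lra.
have cd0 : 0 <= c0 * (3 * dl) by apply: mulr_ge0 => //; apply: mulr_ge0 => //;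
  exact: ltW.
have Hph : op_bound (c0 * (3 * dl) * F%:R) (lreg (fun a => phi a * h a)).
  apply: HF => //.
    move=> a; have [pa|pa] := eqVneq (phi a) 0; first by rewrite pa mul0r normc_zero.
    rewrite normc_mul; apply: ler_pM; rewrite ?normc_ge0//.
    exact/hdl/phit.
  by move=> a; rewrite mulf_eq0 negb_or => /andP[/phit].
have cphi : continuous phi by exact: Cphi.1.
have [Cpf [Cpx Cph]] : Cc (fun a => phi a * f a) /\ Cc (fun a => phi a * x a) /\
    Cc (fun a => phi a * h a) by split; [|split]; exact: Cc_mul.
(* Since [phi] fixes the constants, [f - x] minus the scalar equals the error of [f], minus the
   error of [x], plus [phi h]. *)
have Of := Hphi f Ef; have Ox := op_boundZ (-1) (Hphi x Ex).
rewrite normc_opp normc_one mul1r in Ox.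
have b0 : 0 <= c0 * (3 * dl) * F%:R by exact: mulr_ge0.
have := op_boundD (addr_ge0 (ltW e4) (ltW e4)) b0 (op_boundD (ltW e4) (ltW e4) Of Ox)
  Hph.
move/(@op_bound_le _ e) => ob1.
apply: op_bound_ext (ob1 _ _); last 2 first.
- by rewrite !addr_ge0 ?(ltW e4).
- have -> : c0 * (3 * dl) * F%:R = C * (3 * dl) by rewrite /C; ring.
  have : C * (3 * dl) <= e / 2.
    rewrite /dl (_ : C * _ = e / 2 * (C / (C + 1))).
      by rewrite ler_piMr ?divr_ge0 ?(ltW e0)// ler_pdivrMr//; lra.
    by field; rewrite gt_eqF.
  by lra.
move=> y _; apply/funext => a.
rewrite (lreg_sub Cf Cpf) (lreg_sub Cx Cpx).
have -> : (fun a => phi a * h a) =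
    fun a => phi a * f a - phi a * x a - (f u0 - x u0) * gunit a.
  apply/funext => b; have := congr1 (fun v => v b) (mult_gunit (f u0 - x u0) up).
  by move=> /= <-; rewrite /h; ring.
have Cg : Cc (fun a => (f u0 - x u0) * gunit a) by exact/CcZ/Cc_gunit.
rewrite (lreg_sub (CcB Cpf Cpx) Cg) (lreg_sub Cpf Cpx).
by rewrite (lreg_sub (CcB Cf Cx) Cg) (lreg_sub Cf Cx); ring.
Qed.

(** The supremum in [mult_norm] runs over operators of norm at most one; [lreg] of [f / c] is among
    them, and its value at [gunit] gives the function back. *)
Lemma mult_norm_ob phi M c f : Cc phi -> 0 <= M -> (mult_norm phi <= M%:E)%E ->
  Cc f -> 0 < c -> op_bound c (lreg f) -> op_bound (M * c) (lreg (mult phi f)).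
Proof.
move=> Cphi M0 HM Cf c0 Hf; pose g : G -> Cplx R := fun a => (c^-1)%:C%C * f a.
have Cg : Cc g by exact: CcZ.
have Hg : op_bound 1 (lreg g).
  rewrite /g lreg_scale//; have := op_boundZ (c^-1)%:C%C Hf.
  by rewrite normc_real ger0_norm ?invr_ge0 ?(ltW c0)// mulVf ?gt_eqF.
have Cpg : Cc (mult phi g) by apply: Cc_mul => //; exact: Cphi.1.
have : op_bound M (lreg (mult phi g)).
  apply/Cred_normP => //; apply: le_trans HM; apply: ereal_sup_ubound; left.
  exists (lreg g); last by rewrite /mult_op lreg_gunit.
  split; last by apply: op_bound_opnorm.
  split; first by exists (lreg (gstar g)); exact: lreg_is_adjoint.
  move=> e e0; exists g => //; apply: (@le_lt_trans _ _ 0%:E); last by rewrite lte_fin.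
  apply: op_bound_opnorm => // x r r0 _ _.
  rewrite (_ : (fun a => _) = fun=> 0); first exact: unif_bound_zero.
  by apply/funext => a; rewrite subrr.
move=> /(op_boundZ (c%:C)%C); rewrite normc_real ger0_norm ?(ltW c0)// [c * M]mulrC.
rewrite -lreg_scale//; congr (op_bound _ (lreg _)); apply/funext => a.
have cc : c%:C%C * (c^-1)%:C%C = 1 :> Cplx R by rewrite -realcM mulfV ?gt_eqF// realc1.
rewrite /mult /g; transitivity ((c%:C%C * (c^-1)%:C%C) * (phi a * f a)); first by ring.
by rewrite cc mul1r.
Qed.

Lemma cvg1P (phi : nat -> G -> Cplx R) (A : set G) (e : R) :
  cvg1_on_compacts phi -> compact A -> 0 < e ->
  \forall j \near \oo, forall a, A a -> normc (1 - phi j a) < e.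
Proof.
move=> cv cA e0.
have {cv} cv := iffLR (@fam_cvgP _ _ compact (phi @ \oo) (cst 1) _) cv A cA.
have : nbhs (cst 1 : {uniform` A -> Cplx R})
    [set h : {uniform` A -> Cplx R} | forall a, A a -> normc (1 - h a) < e].
  apply/uniform_nbhs; exists [set p | normc (p.1 - p.2) < e]; split; last by [].
  have ec : (0 : R[i]) < e%:C%C by rewrite ltcR.
  have := @entourage_ball R[i] (Cplx R) (PosNum ec).
  apply: filterS => -[x y] /=; rewrite -ball_normE /ball_ /= normc_def ltcR.
  by case: (x - y).
by move=> /cv.
Qed.

Lemma totally_bounded_approx (phi : nat -> G -> Cplx R) :
  (forall j : nat, Cc (phi j)) -> cvg1_on_compacts phi ->
  (forall j : nat, mult_unital (phi j) /\ Kcontinuous d K (phi j)) ->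
  (ereal_sup (range (fun j : nat => mult_norm (phi j))) < +oo)%E ->
    mod1_totally_bounded E ->
  forall eps : R, 0 < eps -> exists phi,
  [/\ Cc phi, mult_unital phi, Kcontinuous d K phi
    & (esup0 [set Cred_norm (fun a => f a - mult phi f a)%R | f in E] < eps%:E)%E].
Proof.
move=> Cphi cv up Hsup tbE eps eps0.
have [M M0 HM] : exists2 M, 0 <= M & forall j : nat, (mult_norm (phi j) <= M%:E)%E.
  have ub (j : nat) : (mult_norm (phi j) <= ereal_sup (range (fun j :
    nat => mult_norm (phi j))))%E.
    by apply: ereal_sup_ubound; exists j.
  have p0 : (0 <= mult_norm (phi 0%N))%E by apply: ereal_sup_ubound; right.
  have := le_trans p0 (ub 0%N).
  by case: (ereal_sup _) Hsup ub => [M _ ub M0|//|//]; exists M.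
(* With this choice the remainder [h] and its image under the multiplier contribute
   [e + M e = eps / 4] together; the net contributes the other [eps / 4]. *)
pose e := eps / (4 * (M + 1)).
have M1 : 0 < M + 1 by rewrite ltr_wpDl.
have e0 : 0 < e by rewrite divr_gt0// mulr_gt0.
have eM : (M + 1) * e = eps / 4 by rewrite /e; field; rewrite gt_eqF.
have [m [A [EA HA]]] := tbE e e0.
have q0 : 0 < eps / 4 by rewrite divr_gt0.
have CA k : Cc (A k) by exact: (EA k).1.1.
have cphi (j : nat) : continuous (phi j) by exact: (Cphi j).1.
(* The net is finite and each of its elements is supported in a length ball, so uniform convergence
   on these balls yields one index for all of them. *)
have [j Hj] : exists j : nat, forall k, k \in enum 'I_m ->
    op_bound (eps / 4) (lreg (fun a => A k a - phi j a * A k a)).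
  apply: (@filter_ex _ \oo); apply: (@near_seq _ _ \oo) => k _.
  have [c [t [c0 t0 _ Ac At]]] := Cc_elim (CA k); have [F HF] := lreg_ball t0.
  have p : 0 < c * F%:R + 1 by rewrite ltr_wpDl// mulr_ge0.
  have dl0 := divr_gt0 q0 p.
  have := cvg1P cv (ell_proper t0) dl0; apply: filterS => j Hj.
  have := HF (c * (eps / 4 / (c * F%:R + 1))) (fun a => A k a - phi j a * A k a).
  move=> /(_ (mulr_ge0 c0 (ltW dl0))) H; apply: op_bound_le (H _ _).
  - by apply: mulr_ge0 => //; apply: mulr_ge0 => //; exact: ltW.
  - rewrite (_ : c * _ * _ = eps / 4 * (c * F%:R / (c * F%:R + 1))).
      by rewrite ler_piMr ?(ltW q0)// ler_pdivrMr//; lra.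
    by field; rewrite gt_eqF.
  - move=> a; have [->|Aa] := eqVneq (A k a) 0.
      by rewrite mulr0 subr0 normc_zero mulr_ge0// ltW.
    rewrite -{1}(mul1r (A k a)) -mulrBl normc_mul mulrC ler_pM ?normc_ge0//.
    exact/ltW/Hj/At.
  - move=> a; apply: contraNT; rewrite -ltNge => lt.
    suff -> : A k a = 0 by rewrite mulr0 subr0.
    by apply/eqP; apply: contraTT lt => /At; rewrite -leNgt.
have [upj Kj] := up j; exists (phi j); split=> //.
apply: (@le_lt_trans _ _ (eps / 2)%:E); last by rewrite lte_fin; lra.
have h0 : 0 <= eps / 2 by rewrite divr_ge0// ltW.
apply: ge_ereal_sup => _ [[f Ef <-]|->]; last by rewrite lee_fin.
have Cf : Cc f by exact: Ef.1.1.
have Cpf : Cc (fun a => phi j a * f a) by exact: Cc_mul.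
apply/Cred_normP => //; first exact: CcB.
have [k [c Hh]] := HA f Ef; set h := (X in lreg X) in Hh.
have Ch : Cc h by apply: CcB; [exact: CcB|apply/CcZ/Cc_gunit].
have Cph : Cc (mult (phi j) h) by exact: Cc_mul.
have CpA : Cc (fun a => phi j a * A k a) by exact: Cc_mul.
have Hph := op_boundZ (-1) (mult_norm_ob (Cphi j) M0 (HM j) Ch e0 Hh).
rewrite normc_opp normc_one mul1r in Hph.
have Me0 : 0 <= M * e by rewrite mulr_ge0// ltW.
have := op_boundD (ltW q0) (addr_ge0 (ltW e0) Me0) (Hj k (mem_enum _ k)) (op_boundD
  (ltW e0) Me0 Hh Hph).
have -> : eps / 4 + (e + M * e) = eps / 2.
  by have -> : e + M * e = eps / 4; [rewrite -eM; ring|lra].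
apply: op_bound_ext => x _; apply/funext => a.
(* The scalar in [f = A k + h + c 1] drops out because the multiplier fixes it. *)
have -> : (fun a => f a - mult (phi j) f a) =
    fun a => (A k a - phi j a * A k a) + (h a - mult (phi j) h a).
  apply/funext => b; have := congr1 (fun v => v b) (mult_gunit c upj).
  move=> /= ug; rewrite /h /mult.
  transitivity (f b - phi j b * f b - (c * gunit b - phi j b * (c * gunit b))).
    by rewrite ug subrr subr0.
  by ring.
rewrite (lreg_add (CcB (CA k) CpA) (CcB Ch Cph)) (lreg_sub Ch Cph).
by rewrite mulN1r.
Qed.

Lemma approx_cqms :
  (forall eps : R, 0 < eps -> exists phi,
    [/\ Cc phi, mult_unital phi, Kcontinuous d K phi
      & (esup0 [set Cred_norm (fun a => f a - mult phi f a)%R | f in E] < eps%:E)%E]) ->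
  compact_quantum_metric_space X L.
Proof.
move=> H; apply: (totally_bounded_cqms LipC_operator_system total_slip_norm);
  apply: seminorm_ball_totally_bounded => e e0.
have [phi [Cphi up _ Hphi]] := H e e0; exists phi; split=> // f Ef.
have Cf : Cc f by exact: Ef.1.1.
have Cpf : Cc (mult phi f) by apply: Cc_mul => //; exact: Cphi.1.
apply/(Cred_normP (CcB Cf Cpf) (ltW e0)); apply: le_trans (ltW Hphi).
by apply: ereal_sup_ubound; left; exists f.
Qed.

Lemma cqms_approx (phi : nat -> G -> Cplx R) :
  (forall j : nat, Cc (phi j)) -> cvg1_on_compacts phi ->
  (forall j : nat, mult_unital (phi j) /\ Kcontinuous d K (phi j)) ->
  (ereal_sup (range (fun j : nat => mult_norm (phi j))) < +oo)%E ->
  compact_quantum_metric_space X L ->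
  forall eps : R, 0 < eps -> exists phi,
    [/\ Cc phi, mult_unital phi, Kcontinuous d K phi
      & (esup0 [set Cred_norm (fun a => f a - mult phi f a)%R | f in E] < eps%:E)%E].
Proof.
move=> Cphi cv up Hsup /(cqms_totally_bounded LipC_operator_system).
exact: totally_bounded_approx cv up Hsup.
Qed.

End Stratified.

End MainProof.

Local Open Scope ereal_scope.

Theorem theorem3p14 (R : realType) (G : groupoid) (ell : G -> R)
  (d : G -> G -> R) (I : countType) (K : I -> set G) (n : nat)
  (G_etale : etale G)
  (units_compact : compact (@units G))
  (ell_length : length_function ell)
  (ell_proper : proper_length ell)
  (ell_fibers : bounded_fibers ell)
  (d_metric : metrizes (@units G) d)
  (K_strat : metric_stratification d K)
  (n_ge1 : (1 <= n)%N) :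
  let statement1 :=
    forall eps : R, (0 < eps)%R -> exists phi : G -> Cplx R,
      [/\ Cc phi, mult_unital phi, Kcontinuous d K phi
        & esup0 [set Cred_norm (fun a => f a - mult phi f a)%R
                | f in seminorm_ball d K ell n] < eps%:E] in
  let statement2 :=
    compact_quantum_metric_space (LipC d K) (total_seminorm d K ell n) in
  (statement1 -> statement2) /\
  ((exists phi : nat -> G -> Cplx R,
      [/\ forall j, Cc (phi j),
          cvg1_on_compacts phi,
          forall j, mult_unital (phi j) /\ Kcontinuous d K (phi j)
        & ereal_sup (range (fun j => mult_norm (phi j))) < +oo]) ->
   statement2 -> statement1).
Proof.
(* The unit space is the distinguished stratum, and strata are open. *)
have units_open : open (@units G).
  by have [e <-] := K_units K_strat; exact: (K_open K_strat).
move=> statement1 statement2; split.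
  exact: (approx_cqms ell_length ell_proper ell_fibers G_etale units_open).
move=> [phi [Cphi cv up Hsup]].
exact: (cqms_approx ell_length ell_proper ell_fibers G_etale units_open K_strat
  Cphi cv up Hsup).
Qed.
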